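(* Let $d=1$ and let $\mathbb{P}$ be a probability measure on $\Omega=(0,\infty)^{\mathbb{R}\times E_1}$ that is stationary and ergodic with respect to time-space shifts and satisfies $\mathbb{E}[\omega_t(e)]<\infty$ and $\mathbb{E}[\omega_t(e)^{-1}]<\infty$ for all $e\in E_1$ and $t\in\mathbb{R}$. Let $p,q\in[1,\infty]$ be such that $$\frac{1}{p-1}+\frac{1}{q(p-1)}<1,$$ and assume that $\mathbb{E}[\omega_t(e)^p]<\infty$ and $\mathbb{E}[\omega_t(e)^{-q}]<\infty$ for all $t\in\mathbb{R}$ and $e\in E_1$. Then the corrector $\chi$ satisfies $$\lim_{n\to\infty}\ \max_{(t,x)\in Q(n)}\Big|\frac1n\,\chi(\omega,t,x)\Big|=0\qquad\mathbb{P}\text{-a.s.},$$ where $Q(n)=[0,n^2]\times\{-n,\dots,n\}$.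
   Context: Environment. $E_1=\{\{x,y\}:x,y\in\mathbb{Z},|x-y|=1\}$; write $x\sim y$ if $\{x,y\}\in E_1$. An element $\omega=\{\omega_t(e):t\in\mathbb{R},e\in E_1\}$ of $\Omega$ is a family of positive time-dependent weights, $\omega_t(x,y)=\omega_t(y,x)=\omega_t(\{x,y\})$ if $\{x,y\}\in E_1$ and $0$ otherwise. $\Omega$ carries its Borel $\sigma$-algebra $\mathcal{F}$; $\mathbb{E}$ is expectation under $\mathbb{P}$. The time-space shift by $(s,z)\in\mathbb{R}\times\mathbb{Z}$ is $(\tau_{s,z}\omega)_t(x,y)=\omega_{t+s}(x+z,y+z)$. Stationary and ergodic means $\mathbb{P}\circ\tau_{t,x}^{-1}=\mathbb{P}$ for all $(t,x)$ and $\mathbb{P}[A]\in\{0,1\}$ for every $A\in\mathcal{F}$ with $\tau_{t,x}(A)=A$ for all $(t,x)$. For $f:\mathbb{Z}\to\mathbb{R}$, $(\mathcal{L}^\omega_tf)(x)=\sum_{y\sim x}\omega_t(x,y)(f(y)-f(x))$. Function spaces. $L^2_{\mathrm{cov}}$ is the Hilbert space of measurable functions $\Psi:\Omega\times\mathbb{Z}\to\mathbb{R}$ with the cocycle property $\Psi(\tau_{0,x}\omega,y-x)=\Psi(\omega,y)-\Psi(\omega,x)$ for all $x,y\in\mathbb{Z}$, for $\mathbb{P}$-a.e. $\omega$, and $\|\Psi\|^2_{L^2_{\mathrm{cov}}}=\mathbb{E}[\sum_{x\sim0}\omega_0(0,x)|\Psi(\omega,x)|^2]<\infty$. For bounded measurable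 $\varphi:\Omega\to\mathbb{R}$ let $\mathrm{D}\varphi(\omega,x)=\varphi(\tau_{0,x}\omega)-\varphi(\omega)$. $L^2_{\mathrm{pot}}$ is the closure in $L^2_{\mathrm{cov}}$ of $\{\mathrm{D}\varphi:\varphi\text{ bounded}\}$. The position field is $\Pi(\omega,x)=x$. Corrector. $\Phi_0\in L^2_{\mathrm{cov}}$ denotes the function (known to exist when $\mathbb{P}$ is stationary and ergodic with respect to time-space shifts and satisfies $\mathbb{E}[\omega_t(e)]<\infty$ and $\mathbb{E}[\omega_t(e)^{-1}]<\infty$ for all $e\in E_1$ and $t\in\mathbb{R}$) characterized by: (i) $\chi_0=\Pi-\Phi_0\in L^2_{\mathrm{pot}}$; (ii) the function $\Phi:\Omega\times\mathbb{R}\times\mathbb{Z}\to\mathbb{R}$, $$\Phi(\omega,t,x)=\Phi_0(\tau_{t,0}\omega,x)-\int_0^t\big(\mathcal{L}^\omega_s\Phi_0(\tau_{s,0}\omega,\cdot)\big)(0)\,ds,$$ satisfies, for $\mathbb{P}$-a.e. $\omega$: $\Phi$ is differentiable for almost every $t\in\mathbb{R}$ with $\partial_t\Phi(\omega,t,x)+\mathcal{L}^\omega_t\Phi(\omega,t,x)=0$, and $\Phi(\omega,0,0)=0$. The corrector is $\chi(\omega,t,x)=x-\Phi(\omega,t,x)$. Conventions: $1/0=\infty$ and $1/\infty=0$; for $p=\infty$ (respectively $q=\infty$) the moment condition means that $\omega_t(e)$ (respectively $\omega_t(e)^{-1}$) is $\mathbb{P}$-essentially bounded.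
   Formalization: In (ii), Φ is also required to be locally absolutely continuous in t (otherwise changing Φ_0 on a null set that orbits hit at discrete times breaks the claim), and the integrand of the time integral is assumed jointly measurable in (s,ω) up to a null set. *)

(* Defs.v *)
From HB Require Import structures.
From mathcomp Require Import all_boot all_order all_algebra.
From mathcomp Require Import all_classical all_reals all_analysis.

Set Implicit Arguments.
Unset Strict Implicit.
Unset Printing Implicit Defensive.

Import Order.TTheory GRing.Theory Num.Theory.
Import numFieldNormedType.Exports.

Local Open Scope classical_set_scope.
Local Open Scope ring_scope.

(* An edge of E_1 is represented by its left endpoint: e stands for {e, e+1}. *)
Definition edge : Type := int.

Definition positive_reals (R : realType) : Type :=
  set_type [set x : R | 0 < x].

Lemma positive_reals1 (R : realType) : (1 : R) \in [set x : R | 0 < x].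
Proof. by rewrite inE /= ltr01. Qed.

HB.instance Definition _ (R : realType) := Topological.on (positive_reals R).
HB.instance Definition _ (R : realType) :=
  isPointed.Build (positive_reals R)
    (exist (fun x : R => x \in [set x : R | 0 < x]) 1 (positive_reals1 R)).

Definition env_space (R : realType) : Type :=
  prod_topology (fun _ : R * edge => positive_reals R).

HB.instance Definition _ (R : realType) := Topological.on (env_space R).
HB.instance Definition _ (R : realType) :=
  isPointed.Build (env_space R) (fun=> point).

(* Omega with the Borel sigma-algebra of the product topology.  (This is larger
   than the product sigma-algebra, whose members depend on countably many
   coordinates only.) *)
Notation env R := (g_sigma_algebraType (@open (env_space R))).

Section environment.
Variable R : realType.
Implicit Types (w : env R) (P : probability (env R) R) (s t : R).
Implicit Types (e : edge) (x y z : int) (Psi : env R -> int -> R).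

Definition conductance w t e : R := set_val (w (t, e)).

Definition weight w t x y : R :=
  if y == x + 1 then conductance w t x
  else if x == y + 1 then conductance w t y
  else 0.

Definition neighbors x : seq int := [:: x - 1; x + 1].

Definition env_shift s z w : env R := fun te => w (te.1 + s, te.2 + z).

Definition stationary P : Prop :=
  forall s z (A : set (env R)), measurable A -> P (env_shift s z @^-1` A) = P A.

Definition ergodic P : Prop :=
  forall A : set (env R), measurable A ->
    (forall s z, env_shift s z @` A = A) -> P A = 0%E \/ P A = 1%E.

Definition generator w t (f : int -> R) x : R :=
  \sum_(y <- neighbors x) weight w t x y * (f y - f x).

(* E[X^r] < oo for r finite, essential boundedness for r = +oo (X >= 0). *)
Definition finite_moment P (r : \bar R) (X : env R -> R) : Prop :=
  match r with
  | r'%:E => ('E_P[(fun w => X w `^ r')%R] < +oo)%E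
  | +oo%E => exists M : R, {ae P, forall w, X w <= M}
  | -oo%E => False
  end.

Definition cov_sqnorm P Psi : \bar R :=
  'E_P[(fun w => \sum_(x <- neighbors 0) weight w 0 0 x * `|Psi w x| ^+ 2)%R].

Definition cocycle P Psi : Prop :=
  {ae P, forall w, forall x y,
    Psi (env_shift 0 x w) (y - x) = Psi w y - Psi w x}.

Definition L2cov P Psi : Prop :=
  [/\ forall x, measurable_fun [set: env R] (fun w => Psi w x),
      cocycle P Psi & (cov_sqnorm P Psi < +oo)%E].

Definition gradient (phi : env R -> R) : env R -> int -> R :=
  fun w x => phi (env_shift 0 x w) - phi w.

Definition L2pot P Psi : Prop :=
  L2cov P Psi /\
  forall eps : R, 0 < eps -> exists phi : env R -> R,
    [/\ measurable_fun [set: env R] phi,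
        exists M : R, forall w, `|phi w| <= M &
        (cov_sqnorm P (fun w x => Psi w x - gradient phi w x)%R
           < (eps ^+ 2)%:E)%E].

Definition position : env R -> int -> R := fun _ x => x%:~R.

Definition oriented_integral (g : R -> R) t : R :=
  if 0 <= t then \int[lebesgue_measure]_(s in `[0, t]) g s
  else - \int[lebesgue_measure]_(s in `[t, 0]) g s.

Definition space_time_field (Phi0 : env R -> int -> R) w t x : R :=
  Phi0 (env_shift t 0 w) x -
  oriented_integral (fun s => generator w s (Phi0 (env_shift s 0 w)) 0) t.

Definition corrector (Phi0 : env R -> int -> R) w t x : R :=
  x%:~R - space_time_field Phi0 w t x.

Definition absolutely_continuous (a b : R) (f : R -> R) : Prop :=
  forall eps : R, 0 < eps -> exists2 delta : R, 0 < delta &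
    forall (n : nat) (u v : nat -> R),
      (forall i, (i < n)%N -> [/\ a <= u i, u i <= v i & v i <= b]) ->
      (forall i j, (i < j < n)%N -> v i <= u j) ->
      \sum_(i < n) (v i - u i) < delta ->
      \sum_(i < n) `|f (v i) - f (u i)| < eps.

(* Equal, outside a (ds x P)-null set, to a jointly measurable function. *)
Definition jointly_measurable P (G : R -> env R -> R) : Prop :=
  exists2 J : R * env R -> R, measurable_fun setT J &
    (lebesgue_measure \x P)%E.-negligible [set z | G z.1 z.2 <> J z].

(* What the integral in space_time_field needs: given this, it is a genuine
   Lebesgue integral for P-a.e. w, since by stationarity
   E[w_s(0,y) |Phi0 (env_shift s 0 w) y|] is finite and does not depend on s,
   so that the integrand is locally integrable in s by Fubini. *)
Definition well_defined_time_integral P (Phi0 : env R -> int -> R) : Prop :=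
  forall y, y \in neighbors 0 ->
    jointly_measurable P (fun s w =>
      weight w s 0 y * (Phi0 (env_shift s 0 w) y - Phi0 (env_shift s 0 w) 0)).

(* The equation "for almost every t" is meant for locally absolutely continuous
   paths: without this clause one could change Phi0 on a null set that almost
   every orbit meets at a discrete set of times, or add jumps in time. *)
Definition backward_equation P (Phi0 : env R -> int -> R) : Prop :=
  {ae P, forall w, forall x,
    (forall a b : R,
       absolutely_continuous a b (fun t => space_time_field Phi0 w t x)) /\
    {ae lebesgue_measure, forall t : R,
      derivable (fun s : R => space_time_field Phi0 w s x) t 1 /\
      derive1 (fun s : R => space_time_field Phi0 w s x) t
        + generator w t (space_time_field Phi0 w t) x = 0}}.

Definition harmonic_coordinate P (Phi0 : env R -> int -> R) : Prop :=
  [/\ L2cov P Phi0,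
      L2pot P (fun w x => position w x - Phi0 w x),
      well_defined_time_integral P Phi0,
      backward_equation P Phi0 &
      {ae P, forall w, space_time_field Phi0 w 0 0 = 0}].

Definition space_time_box (n : nat) : set (R * int) :=
  [set z | 0 <= z.1 <= n%:R ^+ 2 /\ - n%:Z <= z.2 <= n%:Z].

End environment.

(* Main.v *)
Require Import Defs.
From HB Require Import structures.
From mathcomp Require Import all_boot all_order all_algebra.
From mathcomp Require Import all_classical all_reals all_analysis.
From mathcomp Require Import measurable_realfun.
From mathcomp Require Import ring lra zify.
Import Order.TTheory GRing.Theory Num.Theory.
Import numFieldNormedType.Exports.
Local Open Scope classical_set_scope.
Local Open Scope ring_scope.

(** Why the corrector is sublinear.

    Let d(w) = Phi0(w, 1) - Phi0(w, 0) be the increment of the harmonic coordinate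
    across the edge at the origin, g = w_0(0, 1) d the flux through that edge, and
    Phi(t, x) the space-time field.  The field moves by minus the discrete
    divergence of the flux: d/dt Phi(t, x) = -(g(t, x) - g(t, x - 1)), where g(t, x)
    is g read in the environment shifted by (t, x) (ae_derivative).

    Monotonicity.  On the line this conservation law contracts the L^1 norm of the
    increments backward in time, whereas stationarity makes E|d(t, 0)| constant in t.
    Differentiating it gives E[sg(d) (g(., 1) - 2 g + g(., -1))] = 0
    (smooth_sign_balance and sign_balance).  As sg(d) g = |g|, there is no room for neighbouring increments
    of different signs (ae_sg_neighbor).  The common sign of all increments is
    positive since Phi0 grows like x, so Phi(t, .) is nondecreasing for all t
    (ae_field_monotone).

    Time zero.  The function x - Phi0(w, x) is a bounded gradient plus a cocycle
    with increments of small mean, and a maximal inequality makes the latter small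
    compared with n on [-n, n] (potential_sublinear).

    Positive times.  Summed over two windows of m edges, Phi(t, .) - Phi(0, .) becomes
    the difference of the fluxes that cross two adjacent windows up to time t
    (iterated_block_sum).  Up to a small error in mean, the flux is a function
    invariant under the space shift plus a coboundary (the mean ergodic theorem,
    invariant_coboundary_decomposition): the invariant part cancels in the
    difference, the coboundary telescopes, and the error is controlled by a maximal
    inequality for boxes of n^2 + 1 time steps by 12 n + 1 positions
    (maximal_ergodic_inequality).  Hence the difference is o(n^3), uniformly over
    t <= n^2 and over the windows (adjacent_blocks), and the m^2-fold average of
    Phi(t, .) near x differs from that of Phi(0, .) by o(n^3) / m^2.  With m about
    n / q this is o(n) for each fixed q.

    Conclusion.  A monotone function is trapped between its averages to the left and
    to the right, at the cost of the length 2 m of the windows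
    (monotone_block_bound).  Let n, then q, tend to infinity. *)

Set Implicit Arguments.
Unset Strict Implicit.
Unset Printing Implicit Defensive.

(** * Dominated convergence and truncation *)

Lemma exists_natr_ge (R : realType) (x : R) : exists N : nat, x <= N%:R.
Proof. by have [N _ /(_ N (leqnn N))/= hN] := nbhs_infty_ger x; exists N. Qed.

Lemma dominated_Rintegral d (T : measurableType d) (R : realType)
    (mu : {measure set T -> \bar R}) (D : set T) (f_ : nat -> T -> R)
    (f g : T -> R) :
  measurable D -> (forall n, measurable_fun D (f_ n)) -> measurable_fun D f ->
  {ae mu, forall x, D x -> f_ n x @[n --> \oo] --> f x} ->
  mu.-integrable D (EFin \o g) ->
  {ae mu, forall x n, D x -> `|f_ n x| <= g x} ->
  mu.-integrable D (EFin \o f) /\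
  \int[mu]_(x in D) f_ n x @[n --> \oo] --> \int[mu]_(x in D) f x.
Proof.
move=> mD mf_ mf f_f ig f_g.
have [] := @dominated_convergence _ T R mu D mD
  (fun n x => (f_ n x)%:E) (fun x => (f x)%:E) (fun x => (g x)%:E).
- by move=> n; apply/measurable_EFinP.
- exact/measurable_EFinP.
- by apply: filterS f_f => x h Dx; apply: cvg_EFin; [exact: nearW|exact: h].
- exact: ig.
- by apply: filterS f_g => x h n Dx; rewrite lee_fin; exact: h.
move=> intf _ h; split => //; apply: fine_cvg; rewrite fineK; first exact: h.
exact: integrable_fin_num.
Qed.

(** The excess of |f| over n tends to 0 pointwise and is dominated by |f|. *)
Lemma integral_excess_small d (T : measurableType d) (R : realType)
    (mu : {measure set T -> \bar R}) (D : set T) (f : T -> R) (eps : R) :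
  measurable D -> mu.-integrable D (EFin \o f) -> 0 < eps ->
  exists2 K : R, 0 < K &
    \int[mu]_(x in D) Num.max (`|f x| - K) 0 < eps.
Proof.
move=> mD intf eps0.
have mf : measurable_fun D f by apply/measurable_EFinP; exact: (measurable_int mu intf).
have mg n : measurable_fun D (fun x => Num.max (`|f x| - n%:R) 0).
  apply: measurable_maxr => //; apply: measurable_funB => //.
  exact: measurableT_comp.
have [] := @dominated_Rintegral _ T R mu D
  (fun n x => Num.max (`|f x| - n%:R) 0) (cst 0) (fun x => `|f x|) mD mg.
- exact: measurable_cst.
- apply: aeW => x Dx; apply: cvg_near_cst; near=> n.
  apply/max_idPr; rewrite subr_le0.
  by near: n; exact: nbhs_infty_ger.
- exact: (integrable_norm intf).
- apply: aeW => x n Dx; rewrite ger0_norm ?le_max ?lexx ?orbT//.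
  by rewrite ge_max normr_ge0 andbT gerBl.
move=> _; rewrite Rintegral_cst// mul0r => /cvgr_lt h.
have [N _ hN] := h _ eps0.
exists N.+1%:R; first by rewrite ltr0n.
exact: (hN N.+1 (leqnSn N)).
Unshelve. all: by end_near. Qed.

(** * Absolutely continuous functions *)

Lemma derive0_small (R : realType) (h : R -> R) (t eps : R) :
  is_derive t 1 h 0 -> 0 < eps ->
  exists2 r : R, 0 < r & forall v, `|v - t| < r -> `|h v - h t| <= eps * `|v - t|.
Proof.
move=> [dh val] eps0.
have : (fun s : R => s^-1 *: ((h \o shift t) (s *: (1 : R)) - h t)) @ 0^' --> (0 : R).
  by rewrite -[X in _ --> X]val; exact: dh.
move=> /cvgr0Pnorm_le /(_ _ eps0)[r /= r0 hr].
exists r => // v vr; have [->|vt] := eqVneq v t; first by rewrite !subrr normr0 mulr0.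
have vt0 : v - t != 0 by rewrite subr_eq0.
have := hr (v - t); rewrite /= sub0r normrN => /(_ vr vt0).
by rewrite [_ *: 1]mulr1 subrK normrM normfV mulrC ler_pdivrMr ?normr_gt0.
Qed.

(** Cover the null set of bad times by an open set U of measure below the delta of
    absolute continuity. Near a good time h moves with speed at most eps; around a
    bad time a whole interval lies in U, and such intervals are collected in a
    disjoint chain, along which h varies by less than eps in total. A supremum
    argument takes the place of compactness to reach b. *)
Lemma ac_derive0_const (R : realType) (a b : R) (h : R -> R) :
  a <= b -> absolutely_continuous a b h ->
  {ae lebesgue_measure, forall t, a < t < b -> is_derive t 1 h 0} ->
  h a = h b.
Proof.
move=> ab ach dh.
set mu := @lebesgue_measure R.
pose N := ~` [set t | a < t < b -> is_derive t 1 h 0] `|` [set a; b].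
have N0 : mu.-negligible N.
  apply: negligibleU; first exact: dh.
  apply: negligibleU; apply/negligibleP => //; exact: lebesgue_measure_set1.
apply/eqP; rewrite -subr_eq0 -normr_le0; apply/ler_addgt0Pr => /= e e0.
rewrite add0r.
pose eps := e / (b - a + 1).
have ba1 : 0 < b - a + 1 by rewrite ltr_wpDl// subr_ge0.
have eps0 : 0 < eps by rewrite divr_gt0.
have [delta delta0 acd] := ach _ eps0.
have [U [oU NU]] := outer_measure_open_le N (divr_gt0 delta0 (ltr0n R 2) : 0 < delta / 2).
have /negligible_outer_measure -> := N0.
rewrite add0e -/mu => muU.
have mU : measurable U by exact: open_measurable.
(* up to c, the variation of h is that of a chain of disjoint intervals inside U,
   apart from a drift of speed eps *)
pose P c := exists n (u v : nat -> R),
  [/\ forall i, (i < n)%N -> [/\ a <= u i, u i <= v i & v i <= c],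
      forall i j, (i < j < n)%N -> v i <= u j,
      ((\sum_(i < n) (v i - u i))%:E <= mu (U `&` `]a, c]))%E &
      `|h c - h a| <= eps * (c - a) + \sum_(i < n) `|h (v i) - h (u i)|].
have Pa : P a.
  exists 0%N, (fun=> 0), (fun=> 0); split => //.
    by rewrite big_ord0 measure_ge0.
  by rewrite !subrr normr0 mulr0 big_ord0 addr0.
have Pgood c c' : a <= c -> c <= c' -> P c -> `|h c' - h c| <= eps * (c' - c) -> P c'.
  move=> ac cc' [n [u [v [uv dis len var]]]] hc; exists n, u, v; split => //.
  - by move=> i /uv[? ? ?]; split => //; exact: le_trans cc'.
  - apply: le_trans len _; apply: le_measure; rewrite ?inE.
    + exact: measurableI.
    + exact: measurableI.
    + by apply: setIS => x /=; rewrite !in_itv/= => /andP[-> /le_trans]; exact.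
  - rewrite (_ : h c' - h a = (h c' - h c) + (h c - h a)); last by rewrite addrA subrK.
    by apply: le_trans (ler_normD _ _) _; lra.
have Pbad c c' : a <= c -> c <= c' -> P c -> `]c, c'] `<=` U -> P c'.
  move=> ac cc' [n [u [v [uv dis len var]]]] cU.
  pose u' i := if (i == n)%N then c else u i.
  pose v' i := if (i == n)%N then c' else v i.
  exists n.+1, u', v'; split.
  - move=> i; rewrite ltnS leq_eqVlt /u' /v'; have [_ _|_ /= /uv[? ? ?]] := eqVneq i n; split => //.
    exact: le_trans cc'.
  - move=> i j /andP[ij]; rewrite ltnS /u' /v' => jn.
    rewrite ltn_eqF; last exact: leq_trans jn.
    have [jn'|jn'] := eqVneq j n; first by have [] := uv i; rewrite -?jn'.
    by apply: dis; rewrite ij ltn_neqAle jn' jn.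
  - rewrite big_ord_recr /= /u' /v' eqxx.
    rewrite (eq_bigr (fun i : 'I_n => v i - u i)); last first.
      by move=> i _; rewrite ltn_eqF.
    rewrite (_ : [set` `]a, c']] = [set` `]a, c]] `|` [set` `]c, c']]); last first.
      by rewrite -itv_bndbnd_setU.
    rewrite setIUr /mu measureU; [|exact: measurableI|exact: measurableI|].
      rewrite EFinD; apply: leeD => //.
      have /setIidPr -> := cU.
      rewrite [leRHS](lebesgue_measure_itv `]c, c'])/= lte_fin; case: ltP => [//|c'c].
      by rewrite lee_fin subr_le0.
    apply/seteqP; split => // x/= [[_]]; rewrite !in_itv/= => /andP[_ xc] [_].
    by rewrite ltNge xc.
  - rewrite big_ord_recr /= /u' /v' eqxx.
    rewrite (eq_bigr (fun i : 'I_n => `|h (v i) - h (u i)|)); last first.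
      by move=> i _; rewrite ltn_eqF.
    rewrite (_ : h c' - h a = (h c' - h c) + (h c - h a)); last by rewrite addrA subrK.
    apply: le_trans (ler_normD _ _) _.
    have : eps * (c - a) <= eps * (c' - a) by rewrite ler_pM2l// lerB.
    by lra.
have local t : a <= t <= b -> exists2 r, 0 < r & forall u v,
    t - r < u -> u <= t -> t <= v -> v < t + r -> a <= u -> P u -> P v.
  move=> tab; have [tN|tN] := pselect (N t).
    have [r /= r0 rU] : \forall r \near 0^'+, ball t r `<=` U.
      by apply: open_subball => //; exact: NU.
    exists (r / 2); first by rewrite divr_gt0.
    move=> u v tu ut tv vt au Pu; apply: (Pbad u) => //; first exact: le_trans tv.
    apply: subset_trans (rU (r / 2) _ _) => //=; last by rewrite divr_gt0.
      move=> x/=; rewrite in_itv/= => /andP[ux xv]; rewrite /ball/= ltr_norml.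
      by apply/andP; split; lra.
    by rewrite sub0r normrN gtr0_norm; lra.
  have dt : is_derive t 1 h 0.
    have := tN; rewrite /N => /not_orP[/contrapT/= ht /not_orP[/eqP ta /eqP tb]].
    by apply: ht; rewrite !lt_neqAle eq_sym ta tb/=.
  have [r r0 hr] := derive0_small dt eps0.
  exists r => // u v tu ut tv vt au Pu.
  apply: (Pgood u) => //; first exact: le_trans tv.
  rewrite (_ : h v - h u = (h v - h t) + (h t - h u)); last by rewrite addrA subrK.
  apply: le_trans (ler_normD _ _) _.
  have := hr v; have := hr u.
  rewrite (ger0_norm (_ : 0 <= v - t)); last by rewrite subr_ge0.
  rewrite (ler0_norm (_ : u - t <= 0)); last by rewrite subr_le0.
  rewrite (distrC (h u)) => A B.
  have := A ltac:(lra); have := B ltac:(lra); lra.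
pose S := [set c | a <= c <= b /\ P c].
have Sa : S a by split => //; rewrite lexx.
have Sub : ubound S b by move=> c [/andP[_ cb] _].
have supS : has_sup S by split; [exists a|exists b].
have sab : a <= sup S <= b.
  by rewrite ub_le_sup//=; [apply: ge_sup => //; exists a|exists b].
have [r r0 hr] := local _ sab.
have [u [/andP[au ub] Pu] su] := sup_adherent r0 supS.
have us : u <= sup S by apply: ub_le_sup; [exists b|split=> //; rewrite au].
have ssb : sup S = b.
  apply/eqP; rewrite eq_le; case/andP: (sab) => as_ -> /=; rewrite leNgt; apply/negP => sb.
  pose v := Num.min b (sup S + r / 2).
  have vs : sup S < v by rewrite lt_min sb ltrDl divr_gt0.
  have : v <= sup S.
    apply: ub_le_sup; first by exists b.
    split; first by rewrite ge_min lexx andbT (le_trans as_)// ltW.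
    by apply: (hr u v) => //; [exact: ltW|rewrite gt_min; apply/orP; right; lra].
  by rewrite leNgt vs.
have [n [u' [v' [uv dis len var]]]] : P b.
  by rewrite ssb in us su hr; apply: (hr u b) => //; rewrite ltrDl.
have small : \sum_(i < n) `|h (v' i) - h (u' i)| < eps.
  apply: acd => //; rewrite -lte_fin; apply: le_lt_trans len _.
  apply: (@le_lt_trans _ _ (mu U)).
    by apply: le_measure; rewrite ?inE//; exact: measurableI.
  by apply: le_lt_trans muU _; rewrite lte_fin; lra.
rewrite distrC; apply: le_trans var _.
have -> : e = eps * (b - a) + eps by rewrite /eps; field; rewrite gt_eqF.
by rewrite lerD2l ltW.
Qed.

Lemma sum_increments_le (R : realType) (E : R -> R) (a : R) (n : nat)
    (u v : nat -> R) :
  {homo E : x y / x <= y} ->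
  (forall i, (i < n)%N -> a <= u i /\ u i <= v i) ->
  (forall i j, (i < j < n)%N -> v i <= u j) ->
  forall c, a <= c -> (forall i, (i < n)%N -> v i <= c) ->
  \sum_(i < n) (E (v i) - E (u i)) <= E c - E a.
Proof.
move=> Emono; elim: n => [|n IH] uv dis c ac vc.
  by rewrite big_ord0 subr_ge0; exact: Emono.
rewrite big_ord_recr/=.
have /IH H : forall i, (i < n)%N -> a <= u i /\ u i <= v i by move=> i /ltnW; exact: uv.
have {}H : \sum_(i < n) (E (v i) - E (u i)) <= E (u n) - E a.
  apply: H.
  - by move=> i j /andP[ij jn]; apply: dis; rewrite ij ltnS ltnW.
  - by have [] := uv n (leqnn _).
  - by move=> i ni; apply: dis; rewrite ni/=.
have := Emono _ _ (vc n (leqnn _)); lra.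
Qed.

Section primitive.
Variables (R : realType) (g : R -> R).
Local Notation mu := (@lebesgue_measure R).
Hypothesis intg : mu.-integrable setT (EFin \o g).
Let G x := \int[mu]_(t in `]-oo, x]) g t.

Lemma primitive_increment u v : u <= v -> G v - G u = \int[mu]_(t in `]u, v]) g t.
Proof.
move=> uv; rewrite /G -[RHS](@Rintegral_itvB _ _ -oo%O (BRight v)) ?bnd_simp//.
by apply: integrableS intg.
Qed.

End primitive.

(** Split |g| into its part below K, whose primitive is Lipschitz, and its excess
    over K, whose integral is small. *)
Lemma primitive_ac (R : realType) (g : R -> R) (a b : R) :
  lebesgue_measure.-integrable setT (EFin \o g) ->
  absolutely_continuous a b (fun x => \int[lebesgue_measure]_(t in `]-oo, x]) g t).
Proof.
move=> intg eps eps0.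
set mu := @lebesgue_measure R.
have eps2 : 0 < eps / 2 by rewrite divr_gt0.
have [K K0 small] := integral_excess_small measurableT intg eps2.
pose e x := Num.max (`|g x| - K) 0.
have mg : measurable_fun setT g by apply/measurable_EFinP; exact: (measurable_int mu intg).
have inte : mu.-integrable setT (EFin \o e).
  apply: le_integrable intg => //.
    apply/measurable_EFinP; apply: measurable_maxr => //; apply: measurable_funB => //.
    exact: measurableT_comp.
  move=> x _ /=; rewrite lee_fin [leLHS]ger0_norm ?le_max ?lexx ?orbT//.
  by rewrite ge_max normr_ge0 andbT gerBl// ltW.
have e0 x : 0 <= e x by rewrite le_max lexx orbT.
pose E x := \int[mu]_(t in `]-oo, x]) e t.
have Emono : {homo E : x y / x <= y}.
  by move=> x y xy; rewrite -subr_ge0 primitive_increment//; exact: Rintegral_ge0.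
have EltT x : E x <= \int[mu]_t e t.
  rewrite /E Rintegral_mkcond; apply: le_Rintegral => //.
    by rewrite -restrict_EFin -integrable_mkcond//; exact: integrableS inte.
  by move=> t _; rewrite patchE; case: ifPn.
have E0 x : 0 <= E x by exact: Rintegral_ge0.
have K20 : 0 < eps / 2 / K by rewrite divr_gt0.
exists (eps / 2 / K) => // n u v uv dis len.
apply: (@le_lt_trans _ _ (\sum_(i < n) (K * (v i - u i) + (E (v i) - E (u i))))).
  apply: ler_sum => i _; have [_ uvi _] := uv i (ltn_ord i).
  rewrite primitive_increment// primitive_increment//.
  have intgi : mu.-integrable `](u i), (v i)] (EFin \o g) by exact: integrableS intg.
  have intei : mu.-integrable `](u i), (v i)] (EFin \o e) by exact: integrableS inte.
  have intK : mu.-integrable `](u i), (v i)] (EFin \o cst K).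
    apply: measurable_bounded_integrable => //; last by exists `|K|; split => // ? ? ? ? /=; exact: ltW.
    by rewrite [ltLHS](lebesgue_measure_itv `](u i), (v i)])/=; case: ifP; rewrite ?ltry.
  apply: le_trans (le_normr_Rintegral _ intgi) _ => //.
  have -> : K * (v i - u i) = \int[mu]_(t in `](u i), (v i)]) K.
    rewrite Rintegral_cst//= [in RHS](lebesgue_measure_itv `](u i), (v i)])/= lte_fin.
    by case: ltP => // vu; rewrite (le_anti (_ : v i <= u i <= v i)) ?vu// subrr.
  rewrite -RintegralD//; apply: le_Rintegral => //.
  - exact: integrable_norm.
  - exact: (integrableD _ intK intei).
  - by move=> t _; rewrite /e -lerBlDl le_max lexx.
rewrite big_split/= -mulr_sumr (_ : eps = K * (eps / 2 / K) + eps / 2); last first.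
  by field; rewrite gt_eqF.
apply: ltr_leD; first by rewrite ltr_pM2l.
case: n => [|n] in uv dis len *; first by rewrite big_ord0 ltW.
have [a0 uv0 vb] := uv 0%N isT.
apply: le_trans (sum_increments_le Emono _ dis (c := b) (a := a) _ _) _.
- by move=> i /uv[].
- by apply: le_trans a0 _; apply: le_trans vb.
- by move=> i /uv[].
apply: (@le_trans _ _ (E b)); first by rewrite gerBl.
exact: le_trans (ltW small).
Qed.

Lemma is_derive_sub0 (R : realType) (f G : R -> R) (t c : R) :
  is_derive t 1 f c -> derivable G t 1 -> derive1 G t = c ->
  is_derive t 1 (fun x => f x - G x) 0.
Proof.
move=> df dG Gc; have dG' : is_derive t 1 G c by apply: DeriveDef => //; rewrite -derive1E.
by rewrite -(subrr c); exact: is_deriveB.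
Qed.

(** By Lebesgue differentiation the primitive G of g has derivative g almost
    everywhere, so f - G is absolutely continuous with derivative 0 almost
    everywhere, hence constant. *)
Lemma ac_FTC (R : realType) (a b : R) (f g : R -> R) :
  a <= b -> absolutely_continuous a b f ->
  lebesgue_measure.-integrable `[a, b] (EFin \o g) ->
  {ae lebesgue_measure, forall t, a < t < b -> is_derive t 1 f (g t)} ->
  f b - f a = \int[lebesgue_measure]_(t in `[a, b]) g t.
Proof.
move=> ab acf intg df.
set mu := @lebesgue_measure R.
pose g' := g \_ `[a, b].
have intg' : mu.-integrable setT (EFin \o g').
  by rewrite /g' -restrict_EFin -integrable_mkcond.
pose G x := \int[mu]_(t in `]-oo, x]) g' t.
have dG : {ae mu, forall x, derivable G x 1 /\ derive1 G x = g' x}.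
  apply: FTC1Ny; first by move=> y; exact: integrableS intg'.
  split => //.
  - by apply/measurable_EFinP; exact: (measurable_int mu intg').
  - exact: openT.
  - move=> K _ cK; apply: (@le_lt_trans _ _ (\int[lebesgue_measure]_(x in setT) `|(EFin \o g') x|)%E).
      apply: ge0_subset_integral => //.
        by apply: compact_measurable.
      do 2 apply: measurableT_comp => //.
      by apply/measurable_EFinP; exact: (measurable_int mu intg').
    by case/integrableP : intg'.
have -> : \int[mu]_(t in `[a, b]) g t = G b - G a.
  rewrite primitive_increment// /g' -Rintegral_itv_obnd_cbnd; last first.
    by apply: integrableS intg => //; exact: subset_itv_oc_cc.
  apply: eq_Rintegral => x; rewrite inE/= in_itv/= => /andP[ax xb].
  by rewrite patchE mem_set//= in_itv/= (ltW ax).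
suff : f a - G a = f b - G b by lra.
apply: (@ac_derive0_const R a b (fun x => f x - G x)) => //.
  move=> eps eps0.
  have eps2 : 0 < eps / 2 by rewrite divr_gt0.
  have [d1 d10 h1] := acf _ eps2.
  have [d2 d20 h2] := primitive_ac a b intg' eps2.
  exists (Num.min d1 d2); first by rewrite lt_min d10.
  move=> n u v uv dis; rewrite lt_min => /andP[l1 l2].
  apply: (@le_lt_trans _ _ (\sum_(i < n) (`|f (v i) - f (u i)| + `|G (v i) - G (u i)|))).
    apply: ler_sum => i _.
    have -> : f (v i) - G (v i) - (f (u i) - G (u i)) =
      (f (v i) - f (u i)) - (G (v i) - G (u i)) by ring.
    exact: ler_normB.
  rewrite big_split/=.
  have := h1 _ _ _ uv dis l1; have := h2 _ _ _ uv dis l2; rewrite -/mu; lra.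
apply: filterS2 df dG; first exact: (ae_filter_ringOfSetsType lebesgue_measure).
move=> t dft [dGt Gt] tab.
apply: (is_derive_sub0 (dft tab) dGt); rewrite Gt /g' patchE mem_set//= in_itv/=.
by case/andP: tab => /ltW-> /ltW->.
Qed.

(** * A maximal inequality for space-time boxes *)

(** Vitali covering. Pick z0 with the largest radius r; the points whose box meets
    that of z0 lie in the enlarged box Bs z0, and are discarded. The boxes of the
    remaining points are disjoint from B z0, so that the induction hypothesis adds
    up with the bound for z0. *)
Lemma sum_over_maximal_boxes (R : realDomainType) (W : finType) (B Bs : W -> {set W})
    (r : W -> nat) (C : nat) (h : W -> R) (lam : R) (E : {set W}) :
  (forall u, 0 <= h u) -> 0 <= lam ->
  (forall z, z \in E -> z \in B z) ->
  (forall z z0, z \in E -> z0 \in E -> (r z <= r z0)%N ->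
     ~~ [disjoint B z & B z0] -> z \in Bs z0) ->
  (forall z, z \in E -> (#|Bs z| <= C * #|B z|)%N) ->
  (forall z, z \in E -> lam * #|B z|%:R <= \sum_(u in B z) h u) ->
  lam * #|E|%:R <= C%:R * \sum_(u in (\bigcup_(z in E) B z)%SET) h u.
Proof.
move=> h0 lam0.
have [n] := ubnP #|E|; elim: n E => // n IH E En self_ near_ card_ avg.
have [->|[z1 z1E]] := set_0Vmem E.
  by rewrite cards0 mulr0 mulr_ge0// sumr_ge0.
have [z0 z0E rmax] : exists2 z0, z0 \in E & forall z, z \in E -> (r z <= r z0)%N.
  by case: (arg_maxnP r z1E) => z zE zmax; exists z.
pose E' := [set z in E | [disjoint B z & B z0]]%SET.
have E'E : {subset E' <= E} by move=> z; rewrite inE => /andP[].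
have z0E' : z0 \notin E'.
  rewrite inE z0E/=; apply/pred0Pn; exists z0 => /=.
  by rewrite self_.
have cE' : (#|E'| < n)%N.
  rewrite -ltnS; apply: leq_trans _ En; rewrite ltnS.
  apply: proper_card; rewrite properE; apply/andP; split; first exact/fintype.subsetP.
  by apply: contra z0E' => /fintype.subsetP/(_ _ z0E).
have H : lam * #|E'|%:R <= C%:R * \sum_(u in (\bigcup_(z in E') B z)%SET) h u.
  apply: IH => // [z /E'E|z z' /E'E zE /E'E|z /E'E|z /E'E];
    [exact: self_|exact: near_|exact: card_|exact: avg].
have cE : (#|E| <= #|E'| + #|Bs z0|)%N.
  rewrite -(cardsID E' E) (finset.setIidPr _); last by apply/fintype.subsetP; exact: E'E.
  rewrite leq_add2l; apply: subset_leq_card; apply/fintype.subsetP => z.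
  rewrite !inE => /andP[+ zE]; rewrite zE/= => ndis.
  by apply: near_ => //; exact: rmax.
apply: (@le_trans _ _ (lam * #|E'|%:R + lam * (C * #|B z0|)%:R)).
  rewrite -mulrDr ler_wpM2l// -natrD ler_nat; apply: leq_trans cE _.
  by rewrite leq_add2l card_.
rewrite (big_setID (B z0))/= mulrDr addrC; apply: lerD.
  rewrite natrM mulrCA ler_wpM2l// (finset.setIidPr _) ?avg//.
  exact: finset.bigcup_sup z0E.
apply: le_trans H _; rewrite ler_wpM2l//.
rewrite [leRHS](big_setID (\bigcup_(z in E') B z)%SET)/= (finset.setIidPr _); last first.
  apply/finset.bigcupsP => z zE'; apply/fintype.subsetP => u uz; rewrite inE.
  have := zE'; rewrite inE => /andP[zE /pred0P/(_ u)/=]; rewrite uz/= => ->/=.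
  by apply/finset.bigcupP; exists z.
by rewrite lerDl sumr_ge0.
Qed.

Lemma big_ord_window (V : nmodType) (m x a : nat) (f : nat -> V) : (x + a <= m)%N ->
  \sum_(i < m | (x <= i < x + a)%N) f i = \sum_(k < a) f (x + k)%N.
Proof.
move=> xam; transitivity (\sum_(x <= i < x + a) f i).
  by rewrite (big_nat_widen x _ m)// big_geq_mkord; apply: eq_bigl => i; rewrite /= andbC.
rewrite -{1}[x]add0n big_addn addKn big_mkord.
by apply: eq_bigr => i _; rewrite addnC.
Qed.

Lemma card_ord_window (m x y : nat) :
  (#|[set i : 'I_m | (x <= i < y)%N]%SET| <= y - x)%N.
Proof.
rewrite cardE -(size_map val) -[leqRHS](size_iota x).
apply: uniq_leq_size; first by rewrite map_inj_uniq ?enum_uniq//; exact: val_inj.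
by move=> k /mapP[i]; rewrite mem_enum finset.in_set => /andP[xi iy] ->; rewrite mem_iota /=; lia.
Qed.

Section maximal_function.
Variables (d : measure_display) (T : measurableType d) (R : realType).
Variables (th : nat -> int -> T -> T) (a b : nat -> nat) (h : T -> R) (lam : R).
Hypothesis thD : forall k y k' y' w, th k y (th k' y' w) = th (k + k') (y + y') w.
Hypothesis a0 : forall n, (0 < a n)%N.
Hypothesis a_homo : {homo a : m n / (m <= n)%N}.
Hypothesis b_homo : {homo b : m n / (m <= n)%N}.
Hypothesis h0 : forall w, 0 <= h w.
Hypothesis lam0 : 0 < lam.

(** The boxes reach forward in time only, the semigroup th being indexed by
    natural times, and are centred in space. *)
Definition boxsum (f : T -> R) n w : R :=
  \sum_(k < a n) \sum_(i < (2 * b n).+1) f (th k (i%:Z - (b n)%:Z) w).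

Definition boxsize n : nat := (a n * (2 * b n).+1)%N.

Definition large_boxsum J : set T :=
  [set w | exists2 n, (n <= J)%N & lam * (boxsize n)%:R <= boxsum h n w].

(** The covering bound on a finite piece of the orbit of w. Absorbing all smaller
    boxes that meet a given one doubles its extent in time and at most doubles it
    in space, whence the factor 4; the boxes rooted in the counting window stay
    inside the window of the right-hand side. *)
Lemma count_large_boxsum J w :
  lam * (\sum_(k < a J) \sum_(i < (2 * b J).+1)
            (th k i%:Z w \in large_boxsum J : nat))%:R <=
  4 * \sum_(k < 2 * a J) \sum_(i < (4 * b J).+1) h (th k (i%:Z - (b J)%:Z) w).
Proof.
set A := a J; set c := b J.
have cancel_corner (m i : nat) : (m + i)%N%:Z - m%:Z = i%:Z by lia.
have shift_corner (i y z m : nat) : (y <= z)%N ->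
  i%:Z - y%:Z + (z%:Z - m%:Z) = (z - y + i)%N%:Z - m%:Z by lia.
have near_corner z1 z2 s1 s2 u1 u2 x y x0 y0 : (
    (z1 <= u1 < z1 + x) && (z2 - y <= u2 < z2 - y + (2 * y).+1) &&
    ((s1 <= u1 < s1 + x0) && (s2 - y0 <= u2 < s2 - y0 + (2 * y0).+1)) ->
    x <= x0 -> y <= y0 -> y <= z2 -> y0 <= s2 ->
    (s1 - x0 <= z1 < s1 + x0) && (s2 - 2 * y0 <= z2 < s2 + (2 * y0).+1))%N by lia.
have fits1 x y m : (x < m -> y <= m -> x + y <= 2 * m)%N by lia.
have fits2 x y m : (m <= x < m + (2 * m).+1 -> y <= m ->
  x - y + (2 * y).+1 <= (4 * m).+1)%N by lia.
pose W := ('I_(2 * A) * 'I_(4 * c).+1)%type.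
pose pt (u : W) := th u.1 ((u.2 : nat)%:Z - c%:Z) w.
pose E := [set z : W | (z.1 < A)%N && (c <= z.2 < c + (2 * c).+1)%N &&
                       (pt z \in large_boxsum J)]%SET.
pose r (z : W) := xget 0%N [set n | (n <= J)%N /\ lam * (boxsize n)%:R <= boxsum h n (pt z)].
have rP z : z \in E -> (r z <= J)%N /\ lam * (boxsize (r z))%:R <= boxsum h (r z) (pt z).
  rewrite inE => /andP[_]; rewrite inE => -[n nJ hn].
  by apply: (@xgetPex _ 0%N [set n | (n <= J)%N /\ _]); exists n.
have abr z : z \in E -> (a (r z) <= A)%N /\ (b (r z) <= c)%N.
  by move=> /rP[rJ _]; split; [exact: a_homo|exact: b_homo].
have zE z : z \in E -> (z.1 < A)%N /\ (c <= z.2 < c + (2 * c).+1)%N.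
  by rewrite inE => /andP[/andP[-> ->] _].
pose win x y s t := [set u : W | (x <= u.1 < y)%N && (s <= u.2 < t)%N]%SET.
have winX x y s t : win x y s t =
    finset.setX [set i : 'I_(2 * A) | (x <= i < y)%N]%SET [set i : 'I_(4 * c).+1 | (s <= i < t)%N]%SET.
  by apply/setP => u; rewrite !inE.
have sumwin x y s t (f : nat -> nat -> R) : (x + y <= 2 * A)%N -> (s + t <= (4 * c).+1)%N ->
    \sum_(u in win x (x + y)%N s (s + t)%N) f u.1 u.2 =
    \sum_(k < y) \sum_(i < t) f (x + k)%N (s + i)%N.
  move=> xy st; rewrite -(big_ord_window (fun k => \sum_(i < t) f k (s + i)%N) xy).
  under [RHS]eq_bigr => k _ do rewrite -(big_ord_window (f k) st).
  by rewrite pair_big_dep/=; apply: eq_bigl => u; rewrite inE.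
pose B (z : W) := win z.1 (z.1 + a (r z))%N (z.2 - b (r z))%N (z.2 - b (r z) + (2 * b (r z)).+1)%N.
pose Bs (z : W) := win (z.1 - a (r z))%N (z.1 + a (r z))%N
                 (z.2 - 2 * b (r z))%N (z.2 + (2 * b (r z)).+1)%N.
have fits z : z \in E -> (z.1 + a (r z) <= 2 * A)%N /\
    (z.2 - b (r z) + (2 * b (r z)).+1 <= (4 * c).+1)%N.
  move=> zEz; have [z1 z2] := zE _ zEz; have [ar br] := abr _ zEz.
  by split; [exact: fits1|exact: fits2 z2 br].
have cardB z : z \in E -> #|B z| = boxsize (r z).
  move=> zEz; have [f1 f2] := fits _ zEz.
  apply/eqP; rewrite -(eqr_nat R) -sumr_const.
  rewrite (sumwin _ _ _ _ (fun _ _ => 1))//.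
  under eq_bigr do rewrite sumr_const card_ord.
  by rewrite sumr_const card_ord -mulrnA mulnC.
have main : lam * #|E|%:R <= 4%:R * \sum_(u in (\bigcup_(z in E) B z)%SET) h (pt u).
  apply: (@sum_over_maximal_boxes R W B Bs r 4) => //; first exact: ltW.
  - by move=> z zEz; have := a0 (r z); rewrite inE; have [? ?] := zE _ zEz; lia.
  - move=> z z0 zEz z0E rzz0 /pred0Pn[u /=]; rewrite !inE.
    have [z1 z2] := zE _ zEz; have [z01 z02] := zE _ z0E.
    have [? ?] := abr _ zEz; have [? ?] := abr _ z0E.
    move=> /near_corner; apply; [exact: a_homo|exact: b_homo| |].
      by apply: leq_trans (andP z2).1.
    by apply: leq_trans (andP z02).1.
  - move=> z zEz; rewrite cardB// /Bs winX cardsX /boxsize.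
    apply: (@leq_trans (2 * a (r z) * (4 * b (r z)).+1)).
      apply: leq_mul; apply: leq_trans (card_ord_window _ _ _) _; lia.
    nia.
  - move=> z zEz; rewrite cardB//; have [_ /le_trans] := rP _ zEz; apply.
    have [z1 z2] := zE _ zEz; have [ar br] := abr _ zEz; have [f1 f2] := fits _ zEz.
    rewrite [leRHS](sumwin _ _ _ _ (fun k i => h (th k (i%:Z - c%:Z) w)))//.
    rewrite /boxsum le_eqVlt; apply/orP; left; apply/eqP.
    apply: eq_bigr => k _; apply: eq_bigr => i _; rewrite /pt thD addnC shift_corner//.
    by apply: leq_trans br _; case/andP: z2.
have <- : #|E| = (\sum_(k < A) \sum_(i < (2 * c).+1)
    (th k i%:Z w \in large_boxsum J : nat))%N.
  pose f k i : R := (th k (i%:Z - c%:Z) w \in large_boxsum J : nat)%:R.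
  apply/eqP; rewrite -(eqr_nat R); apply/eqP.
  transitivity (\sum_(u in win 0%N (0 + A)%N c (c + (2 * c).+1)%N) f u.1 u.2).
    rewrite -sum1_card natr_sum big_mkcond [RHS]big_mkcond/=.
    apply: eq_bigr => u _; rewrite !finset.in_set /f /pt /= add0n.
    by case: ifPn => /andP; case: ifPn => // _; case: (_ \in _) => // -[].
  rewrite sumwin; [|lia|lia].
  rewrite natr_sum; apply: eq_bigr => k _; rewrite natr_sum; apply: eq_bigr => i _.
  by rewrite /f add0n cancel_corner.
apply: le_trans main _; rewrite ler_wpM2l//.
rewrite pair_big/=.
rewrite [leRHS](bigID (fun u => u \in (\bigcup_(z in E) B z)%SET))/= lerDl.
exact: sumr_ge0.
Qed.

End maximal_function.

Section measure_preserving.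
Variables (d : measure_display) (T : measurableType d) (R : realType).
Variable P : probability T R.
Implicit Types g : T -> R.

Definition integ (f : T -> R) := P.-integrable setT (EFin \o f).

Lemma integ_measurable f : integ f -> measurable_fun setT f.
Proof. by move=> h; apply/measurable_EFinP; exact: measurable_int h. Qed.

Lemma integD f g : integ f -> integ g -> integ (fun w => f w + g w).
Proof. by move=> hf hg; exact: (integrableD measurableT hf hg). Qed.

Lemma integB f g : integ f -> integ g -> integ (fun w => f w - g w).
Proof. by move=> hf hg; exact: (integrableB measurableT hf hg). Qed.

Lemma integZ c f : integ f -> integ (fun w => c * f w).
Proof. by move=> hf; exact: (integrableZl measurableT c hf). Qed.

Lemma integ_norm f : integ f -> integ (fun w => `|f w|).
Proof. by move=> hf; exact: integrable_norm. Qed.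

Lemma integ_le (f g : T -> R) : measurable_fun setT f -> integ g ->
  (forall w, `|f w| <= g w) -> integ f.
Proof.
move=> mf ig fg; apply: le_integrable ig => //; first exact/measurable_EFinP.
by move=> w _ /=; rewrite lee_fin (le_trans (fg w))// ler_norm.
Qed.

Lemma integ_bounded (f : T -> R) (K : R) : measurable_fun setT f ->
  (forall w, `|f w| <= K) -> integ f.
Proof.
move=> mf fK; apply: (integ_le mf (g := cst K)) => //.
exact: finite_measure_integrable_cst.
Qed.

Lemma integ_cst (c : R) : integ (fun=> c).
Proof. exact: finite_measure_integrable_cst. Qed.

Lemma Ecst (c : R) : \int[P]_w c = c.
Proof.
rewrite Rintegral_cst//= (_ : P setT = 1%E) ?mulr1//; exact: probability_setT.
Qed.

Lemma ED f g : integ f -> integ g ->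
  \int[P]_w (f w + g w) = \int[P]_w f w + \int[P]_w g w.
Proof. by move=> hf hg; exact: RintegralD. Qed.

Lemma EB f g : integ f -> integ g ->
  \int[P]_w (f w - g w) = \int[P]_w f w - \int[P]_w g w.
Proof. by move=> hf hg; exact: RintegralB. Qed.

Lemma EZ c f : integ f -> \int[P]_w (c * f w) = c * \int[P]_w f w.
Proof. by move=> hf; exact: RintegralZl. Qed.

Lemma E_le f g : integ f -> integ g -> (forall w, f w <= g w) ->
  \int[P]_w f w <= \int[P]_w g w.
Proof. by move=> hf hg fg; exact: le_Rintegral. Qed.

Lemma E_eq0 f : integ f -> (forall w, 0 <= f w) -> \int[P]_w f w = 0 ->
  {ae P, forall w, f w = 0}.
Proof.
move=> ifn f0 I0; have mf := integ_measurable ifn.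
have : (\int[P]_w `|(f w)%:E| = 0)%E.
  under eq_integral => w _ do rewrite gee0_abs ?lee_fin//.
  by rewrite -[LHS]fineK ?integrable_fin_num//; congr EFin.
have [H _] := @ae_eq_integral_abs _ T R P setT measurableT (EFin \o f) (measurable_int P ifn).
by move/H; apply: filterS => w /(_ I) [].
Qed.

Lemma integ_sum I (s : seq I) (f : I -> T -> R) : (forall i, integ (f i)) ->
  integ (fun w => \sum_(i <- s) f i w) /\
  \int[P]_w (\sum_(i <- s) f i w) = \sum_(i <- s) \int[P]_w f i w.
Proof.
move=> hf; elim: s => [|i s [IH1 IH2]].
  have -> : (fun w => \sum_(j <- [::]) f j w) = cst 0 by apply/funext => w; rewrite big_nil.
  rewrite big_nil Rintegral_cst// mul0r; split => //.
  by apply: (@integ_bounded _ 0) => // w; rewrite normr0.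
have -> : (fun w => \sum_(j <- i :: s) f j w) = (fun w => f i w + \sum_(j <- s) f j w).
  by apply/funext => w; rewrite big_cons.
rewrite big_cons -IH2 RintegralD; [|exact: measurableT|exact: hf|exact: IH1].
by split=> //; exact: integD.
Qed.

Definition measure_preserving (f : T -> T) : Prop :=
  measurable_fun setT f /\ forall A, measurable A -> P (f @^-1` A) = P A.

Section one_map.
Variable f : T -> T.
Hypothesis fP : measure_preserving f.

Lemma mp_measurable (g : T -> R) : measurable_fun setT g -> measurable_fun setT (g \o f).
Proof. by move=> mg; apply: measurableT_comp => //; exact: fP.1. Qed.

Lemma mp_ge0_integral (g : T -> \bar R) : measurable_fun setT g ->
  (forall w, (0 <= g w)%E) -> (\int[P]_w g (f w) = \int[P]_w g w)%E.
Proof.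
move=> mg g0; have [mf fA] := fP.
rewrite -(@ge0_integral_pushforward _ _ _ _ _ f mf P setT g)//.
by apply: eq_measure_integral => A mA _; exact: fA.
Qed.

Lemma mp_integ g : integ g -> integ (g \o f).
Proof.
move=> /integrableP[mg fin]; apply/integrableP; split.
  exact: (measurableT_comp mg fP.1).
rewrite (mp_ge0_integral (g := fun w => `|(g w)%:E|%E))//.
exact: measurableT_comp.
Qed.

Lemma mp_Rintegral g : integ g -> \int[P]_w g (f w) = \int[P]_w g w.
Proof.
move=> ig; have mg := integ_measurable ig; have [mf fA] := fP.
congr fine; rewrite -(@integral_pushforward _ _ _ _ _ f mf P setT (EFin \o g))//.
- by apply: eq_measure_integral => A mA _; exact: fA.
- exact/measurable_EFinP.
- by rewrite preimage_setT; exact: mp_integ.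
Qed.

Lemma mp_ae (Q : T -> Prop) : {ae P, forall w, Q w} -> {ae P, forall w, Q (f w)}.
Proof.
move=> [A [mA A0 QA]]; have [mf fA] := fP; exists (f @^-1` A); split.
- by rewrite -[X in measurable X]setTI; exact: mf.
- by rewrite fA.
- by move=> w /= nQ; apply: QA.
Qed.

End one_map.

End measure_preserving.

Section maximal_inequality.
Variables (d : measure_display) (T : measurableType d) (R : realType).
Variable P : probability T R.
Implicit Types g : T -> R.
Variables (th : nat -> int -> T -> T) (a b : nat -> nat) (h : T -> R).
Hypothesis thP : forall k y, measure_preserving P (th k y).
Hypothesis thD : forall k y k' y' w, th k y (th k' y' w) = th (k + k') (y + y') w.
Hypothesis a0 : forall n, (0 < a n)%N.
Hypothesis a_homo : {homo a : m n / (m <= n)%N}.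
Hypothesis b_homo : {homo b : m n / (m <= n)%N}.
Hypothesis h0 : forall w, 0 <= h w.
Hypothesis ih : integ P h.

Lemma measurable_large_boxsum lam J : measurable (large_boxsum th a b h lam J).
Proof.
have -> : large_boxsum th a b h lam J = \bigcup_(n in `I_J.+1)
    [set w | lam * (boxsize a b n)%:R <= boxsum th a b h n w].
  by apply/seteqP; split=> w [n nJ hn]; exists n.
apply: bigcup_measurable => n _.
rewrite -[X in measurable X]setTI; apply: measurable_fun_le => //.
apply: measurable_sum => k; apply: measurable_sum => i.
by apply: (mp_measurable (thP _ _)); exact: integ_measurable ih.
Qed.

(** Transference: by invariance the expectations of the two sides of
    count_large_boxsum are the sizes of the two windows times a probability and a
    mean. The constant is 16 since the covering factor and the ratio of the
    windows are both at most 4. *)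
Lemma large_boxsum_le lam J : 0 < lam ->
  (P (large_boxsum th a b h lam J) <= (16 / lam * \int[P]_w h w)%:E)%E.
Proof.
move=> lam0; set M := large_boxsum _ _ _ _ _ _.
have mM : measurable M by exact: measurable_large_boxsum.
pose ind w : R := (w \in M : nat)%:R.
have indE : ind = \1_M by apply/funext => w; rewrite indicE.
have mind : measurable_fun setT ind by rewrite indE.
have iind : integ P ind.
  by apply: (@integ_bounded _ _ _ _ _ 1) => // w; rewrite /ind; case: (_ \in _); rewrite ?normr1// normr0.
have Iind : (\int[P]_w ind w)%:E = P M.
  rewrite /Rintegral indE integral_indic// setIT fineK//; exact: fin_num_measure.
have sumI m l (g : T -> R) (e : int) : integ P g ->
    integ P (fun w => \sum_(k < m) \sum_(i < l) g (th k (i%:Z - e) w)) /\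
    \int[P]_w (\sum_(k < m) \sum_(i < l) g (th k (i%:Z - e) w)) = (m * l)%:R * \int[P]_w g w.
  move=> ig.
  have H (k : 'I_m) := @integ_sum _ _ _ P _ (index_enum 'I_l) (fun i w => g (th k (i%:Z - e) w))
    (fun i => mp_integ (thP _ _) ig).
  have [H1 H2] := @integ_sum _ _ _ P _ (index_enum 'I_m) _ (fun k => (H k).1).
  split => //; rewrite H2; under eq_bigr => k _.
    rewrite (H k).2; under eq_bigr do rewrite (mp_Rintegral (thP _ _))//.
    over.
  by rewrite /= !sumr_const !card_ord -mulrnA mulnC mulr_natl.
have [i1 E1] := sumI (a J) (2 * b J).+1 ind 0 iind.
have [i2 E2] := sumI (2 * a J)%N (4 * b J).+1 h (b J)%:Z ih.
have : lam * ((a J * (2 * b J).+1)%:R * \int[P]_w ind w) <=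
    4 * ((2 * a J * (4 * b J).+1)%:R * \int[P]_w h w).
  rewrite -E1 -E2 -!RintegralZl//; apply: le_Rintegral => //; [exact: integZ..|].
  move=> w _; have := count_large_boxsum thD a0 a_homo b_homo h0 lam0 J w.
  rewrite natr_sum; under eq_bigr do rewrite natr_sum.
  by under eq_bigr do under eq_bigr do rewrite -[X in th _ X]subr0.
have Eh0 : 0 <= \int[P]_w h w by exact: Rintegral_ge0.
have aJ : (0 : R) < (a J)%:R by rewrite ltr0n.
rewrite -Iind lee_fin mulrAC ler_pdivlMr// => H.
set c : R := (a J * (2 * b J).+1)%:R.
have c0 : 0 < c by rewrite ltr0n muln_gt0 a0.
rewrite -(ler_pM2l c0) mulrA (mulrC _ lam).
apply: le_trans H _; rewrite !mulrA ler_wpM2r// /c -!natrM ler_nat.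
nia.
Qed.

(** The bound of large_boxsum_le is uniform in J and passes to the increasing
    union. The profiles a and b are arbitrary nondecreasing ones, so as to cover
    segments in space as well as parabolic boxes. *)
Lemma maximal_ergodic_inequality lam : 0 < lam ->
  exists2 M, measurable M /\ (P M <= (16 / lam * \int[P]_w h w)%:E)%E &
    forall w, ~ M w -> forall n, boxsum th a b h n w <= lam * (boxsize a b n)%:R.
Proof.
move=> lam0; pose M := \bigcup_J large_boxsum th a b h lam J.
have mJ J : measurable (large_boxsum th a b h lam J) by exact: measurable_large_boxsum.
have mM : measurable M by exact: bigcupT_measurable.
exists M.
  split => //.
  have cM := @nondecreasing_cvg_mu _ _ _ P (large_boxsum th a b h lam) mJ mM.
  rewrite -(cvg_lim _ (cM _))//; last first.
    apply/nondecreasing_seqP => J; apply/subsetPset => w [n nJ hn].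
    by exists n => //; exact: leqW.
  apply: lime_le; last by apply: nearW => J; exact: large_boxsum_le.
  apply/cvg_ex; eexists; apply: cM.
  apply/nondecreasing_seqP => J; apply/subsetPset => w [n nJ hn].
  by exists n => //; exact: leqW.
move=> w nM n; rewrite leNgt; apply/negP => H; apply: nM; exists n => //; exists n => //.
exact: ltW.
Qed.

End maximal_inequality.

(** * The mean ergodic theorem *)

Lemma limn_sup_bounds (R : realType) (u : nat -> R) (K eps : R) :
  (forall n, `|u n| <= K) -> 0 < eps ->
  (exists N, forall n, (N <= n)%N -> u n <= limn_sup u + eps) /\
  (forall N, exists2 n, (N <= n)%N & limn_sup u - eps < u n).
Proof.
move=> uK eps0.
have bu : bounded_fun u by exists K; split; [exact: num_real|move=> x Kx n _ /=; exact: le_trans (ltW Kx)].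
have ub := bounded_fun_has_ubound bu; have lb := bounded_fun_has_lbound bu.
have lbs : has_lbound (range (sups u)) by exact: bounded_fun_has_lbound_sups.
have ne : range (sups u) !=set0 by exists (sups u 0); exists 0%N.
rewrite limn_supE//; split.
  have [_ [N _ <-] hN] := inf_adherent eps0 (conj ne lbs).
  exists N => n Nn; apply: le_trans (ltW hN); apply: ub_le_sup.
    exact: has_ubound_sdrop.
  by exists n.
move=> N; have : inf (range (sups u)) - eps < sups u N.
  rewrite ltrBlDr; apply: le_lt_trans (_ : sups u N < _); last by rewrite ltrDl.
  by apply: ge_inf => //; exists N.
by move=> /sup_gt[|_ [n Nn <-] H]; [exists (u N); exists N => /=|exists n].
Qed.

Lemma limn_sup_near_eq (R : realType) (u v : nat -> R) (K : R) :
  (forall n, `|u n| <= K) -> (forall n, `|v n| <= K) ->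
  (u n - v n @[n --> \oo] --> 0) -> limn_sup u = limn_sup v.
Proof.
suff H (u' v' : nat -> R) : (forall n, `|u' n| <= K) -> (forall n, `|v' n| <= K) ->
    (u' n - v' n @[n --> \oo] --> 0) -> limn_sup u' <= limn_sup v'.
  move=> uK vK uv; apply/eqP; rewrite eq_le !H//.
  rewrite -oppr0 (_ : (fun n => v n - u n) = (fun n => - (u n - v n))); first exact: cvgN.
  by apply/funext => n; rewrite opprB.
move=> uK vK uv; apply/ler_addgt0Pr => e e0.
have e3 : 0 < e / 3 by rewrite divr_gt0.
have [_ h1] := limn_sup_bounds uK e3; have [[N1 h2] _] := limn_sup_bounds vK e3.
move: uv => /cvgr0Pnorm_lt/(_ _ e3)[N2 _ h3].
have [n Nn hn] := h1 (maxn N1 N2).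
have := h2 n (leq_trans (leq_maxl _ _) Nn).
have := h3 n (leq_trans (leq_maxr _ _) Nn).
rewrite ltr_norml => /andP[]; lra.
Qed.

Section mean_ergodic.
Variables (d : measure_display) (T : measurableType d) (R : realType).
Variables (P : probability T R) (S : T -> T).
Hypothesis SP : measure_preserving P S.

Definition orbit_sum (f : T -> R) n w : R := \sum_(i < n) f (iter i S w).

Definition orbit_avg f n w : R := n%:R^-1 * orbit_sum f n w.

Lemma iter_mp i : measure_preserving P (iter i S).
Proof.
elim: i => [|i [IH1 IH2]]; first by split=> [|A mA] /=; [exact: measurable_id|rewrite preimage_id].
split; first by apply: measurableT_comp => //; exact: SP.1.
move=> A mA; have mSA : measurable (S @^-1` A).
  by rewrite -[_ @^-1` _]setTI; exact: SP.1.
by rewrite -[LHS]/(P (iter i S @^-1` (S @^-1` A))) IH2// SP.2.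
Qed.

Lemma orbit_sumS f n w : orbit_sum f n.+1 w = f w + orbit_sum f n (S w).
Proof.
rewrite /orbit_sum big_ord_recl; congr (_ + _).
by apply: eq_bigr => i _; rewrite -iterSr.
Qed.

Lemma measurable_orbit_sum f n : measurable_fun setT f -> measurable_fun setT (orbit_sum f n).
Proof.
move=> mf; apply: measurable_sum => i; exact: (mp_measurable (iter_mp i)).
Qed.

Lemma orbit_sum_le f K n w : (forall w, `|f w| <= K) -> `|orbit_sum f n w| <= n%:R * K.
Proof.
move=> fK; apply: le_trans (ler_norm_sum _ _ _) _.
apply: le_trans (ler_sum _ (fun i _ => fK _)) _.
by rewrite sumr_const card_ord mulr_natl.
Qed.

Lemma orbit_avg_le f K n w : (forall w, `|f w| <= K) -> `|orbit_avg f n w| <= K.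
Proof.
move=> fK; have K0 : 0 <= K by exact: le_trans (fK w).
rewrite /orbit_avg normrM normfV normr_nat.
have [->|n0] := eqVneq n 0%N; first by rewrite invr0 mul0r.
rewrite mulrC ler_pdivrMr ?ltr0n ?lt0n// mulrC; exact: orbit_sum_le.
Qed.

(** The maximum of 0 and of the first N orbit sums, in the recursive form that
    Garsia's argument uses. *)
Fixpoint orbit_max (g : T -> R) N w : R :=
  if N is N'.+1 then Num.max 0 (g w + orbit_max g N' (S w)) else 0.

Lemma orbit_max_ge0 g N w : 0 <= orbit_max g N w.
Proof. by case: N => //= N; rewrite le_max lexx. Qed.

Lemma orbit_max_ge g n N w : (n <= N)%N -> orbit_sum g n w <= orbit_max g N w.
Proof.
elim: N n w => [|N IH] [|n] w; rewrite ?leqn0//.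
- by rewrite /orbit_sum big_ord0.
- by rewrite /orbit_sum big_ord0 orbit_max_ge0.
- by rewrite ltnS orbit_sumS /= le_max => nN; rewrite lerD2l IH ?orbT.
Qed.

Lemma orbit_max_leS g N w : orbit_max g N w <= orbit_max g N.+1 w.
Proof.
elim: N w => [|N IH] w; first exact: orbit_max_ge0.
rewrite [leLHS]/= [leRHS]/= ge_max le_max lexx/= le_max; apply/orP; right.
by rewrite lerD2l.
Qed.

Lemma measurable_orbit_max g N : measurable_fun setT g -> measurable_fun setT (orbit_max g N).
Proof.
move=> mg; elim: N => [|N IH] /=; first exact: measurable_cst.
apply: measurable_maxr => //; apply: measurable_funD => //.
exact: (mp_measurable SP).
Qed.

Lemma orbit_max_le g K N w : (forall w, `|g w| <= K) -> `|orbit_max g N w| <= N%:R * K.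
Proof.
move=> gK; rewrite ger0_norm ?orbit_max_ge0//.
have K0 : 0 <= K by exact: le_trans (gK w).
elim: N w => [|N IH] w /=; first by rewrite mul0r.
rewrite ge_max mulr_ge0//= -natr1 mulrDl mul1r addrC lerD//.
exact: le_trans (ler_norm _) (gK w).
Qed.

(** Garsia's argument. Where M = orbit_max g N is positive, g >= M - M o S, and
    elsewhere M - M o S <= 0; so the integral of g over the set where M is
    positive is at least E[M - M o S] = 0. These sets exhaust the space as N
    grows. *)
Lemma garsia (g : T -> R) K : measurable_fun setT g -> (forall w, `|g w| <= K) ->
  (forall w, exists n, 0 < orbit_sum g n w) -> 0 <= \int[P]_w g w.
Proof.
move=> mg gK pos.
have ig : integ P g by exact: (@integ_bounded _ _ _ _ _ K).
pose pN N w : R := (0 < orbit_max g N w)%R%:R.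
have mpN N : measurable_fun setT (pN N).
  have -> : pN N = \1_[set w | 0 < orbit_max g N w].
    apply/funext => w; rewrite indicE /pN; congr ((nat_of_bool _)%:R).
    by apply/idP/idP; rewrite inE.
  apply/measurable_indicP; rewrite -[X in measurable X]setTI.
  rewrite (_ : [set w | _] = orbit_max g N @^-1` `]0, +oo[); last first.
    by apply/seteqP; split=> w /=; rewrite in_itv/= andbT.
  exact: measurable_orbit_max.
have step N : 0 <= \int[P]_w (g w * pN N w).
  have iM : integ P (orbit_max g N).
    apply: (@integ_bounded _ _ _ _ _ (N%:R * K)); first exact: measurable_orbit_max.
    by move=> w; exact: orbit_max_le.
  have igp : integ P (fun w => g w * pN N w).
    apply: (integ_le _ (integ_norm ig)); first exact: measurable_funM.
    move=> w; rewrite normrM ler_piMr// /pN; case: (_ < _); rewrite ?normr1 ?normr0//.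
  have : \int[P]_w (orbit_max g N w - orbit_max g N (S w)) <= \int[P]_w (g w * pN N w).
    apply: le_Rintegral => //.
      by apply: integB => //; exact: (mp_integ SP iM).
    move=> w _; rewrite /pN; case: ltP => [M0|M0]; last first.
      by rewrite mulr0 subr_le0 (le_trans M0)// orbit_max_ge0.
    rewrite mulr1 lerBlDr; case: N M0 {iM igp} => [|N]; first by rewrite ltxx.
    move=> M0; apply: le_trans (_ : g w + orbit_max g N (S w) <= _).
      move: M0; rewrite [orbit_max _ _ _]/= lt_max ltxx/= => M0.
      by rewrite ge_max lexx ltW.
    by rewrite lerD2l orbit_max_leS.
  rewrite RintegralB//; last exact: (mp_integ SP iM).
  by rewrite (mp_Rintegral SP iM) subrr.
have [] := @dominated_Rintegral _ T R P setT (fun N w => g w * pN N w) g (fun w => `|g w|) measurableT.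
- by move=> N; exact: measurable_funM.
- by [].
- apply: aeW => w _; apply: cvg_near_cst; have [n gn] := pos w.
  exists n => // N /= nN; rewrite /pN (lt_le_trans gn) ?mulr1//.
  exact: orbit_max_ge.
- exact: integ_norm.
- apply: aeW => w N _; rewrite normrM ler_piMr// /pN; case: (_ < _); rewrite ?normr1 ?normr0//.
move=> _ cv; rewrite -(cvg_lim _ cv)//; apply: limr_ge.
  by apply/cvg_ex; eexists; exact: cv.
exact: nearW.
Qed.

Definition upper_avg (f : T -> R) w : R := limn_sup (fun n => orbit_avg f n w).

Section bounded_function.
Variables (f : T -> R) (K : R).
Hypothesis mf : measurable_fun setT f.
Hypothesis fK : forall w, `|f w| <= K.

Lemma measurable_orbit_avg n : measurable_fun setT (orbit_avg f n).
Proof. by apply: measurable_funM => //; exact: measurable_orbit_sum. Qed.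

Lemma measurable_upper_avg : measurable_fun setT (upper_avg f).
Proof.
apply: (@measurable_fun_limn_sup _ _ _ _ (fun n => orbit_avg f n)) => [w _|w _|n].
- by exists K => _ [n _ <-]; apply: le_trans (ler_norm _) (orbit_avg_le _ _ fK).
- exists (- K) => _ [n _ <-]; have := orbit_avg_le n w fK.
  by rewrite ler_norml => /andP[].
- exact: measurable_orbit_avg.
Qed.

Lemma upper_avg_le w : `|upper_avg f w| <= K.
Proof.
rewrite ler_norml; apply/andP; split.
  rewrite -subr_ge0 opprK; apply/ler_addgt0Pr => e e0; rewrite addrAC.
  have [[N hN] _] := limn_sup_bounds (fun n => orbit_avg_le n w fK) e0.
  have := hN N (leqnn _); have := orbit_avg_le N w fK.
  rewrite ler_norml /upper_avg => /andP[]; lra.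
apply/ler_addgt0Pr => e e0.
have [_ /(_ 0%N)[n _ hn]] := limn_sup_bounds (fun n => orbit_avg_le n w fK) e0.
have := orbit_avg_le n w fK; rewrite ler_norml /upper_avg => /andP[]; lra.
Qed.

Lemma upper_avg_invariant w : upper_avg f (S w) = upper_avg f w.
Proof.
apply: (limn_sup_near_eq (K := K)) => [n|n|]; [exact: orbit_avg_le..|].
apply/cvgr0Pnorm_lt => e e0.
have K0 : 0 <= K by exact: le_trans (fK w).
near=> n.
have n0 : (0 < n)%N by near: n; exact: nbhs_infty_gt.
have -> : orbit_avg f n (S w) - orbit_avg f n w = n%:R^-1 * (f (iter n S w) - f w).
  rewrite /orbit_avg -mulrBr; congr (_ * _).
  have := orbit_sumS f n w; rewrite {1}/orbit_sum big_ord_recr/= -/(orbit_sum f n w).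
  lra.
rewrite normrM normfV normr_nat mulrC ltr_pdivrMr ?ltr0n//.
apply: (@le_lt_trans _ _ (K + K)).
  by apply: le_trans (ler_normB _ _) _; apply: lerD.
rewrite mulrC -ltr_pdivrMr//.
by near: n; exact: nbhs_infty_gtr.
Unshelve. all: by end_near. Qed.

Lemma upper_avg_iter i w : upper_avg f (iter i S w) = upper_avg f w.
Proof. by elim: i => //= i IH; rewrite upper_avg_invariant. Qed.

(** Apply garsia to f - upper_avg f + e: as upper_avg f is invariant, some orbit
    sum of this function is positive at every point. *)
Lemma integral_upper_avg_le : \int[P]_w upper_avg f w <= \int[P]_w f w.
Proof.
apply/ler_addgt0Pr => e e0.
have mF := measurable_upper_avg.
have ifn : integ P f by exact: integ_bounded fK.
have iF : integ P (upper_avg f) by exact: integ_bounded upper_avg_le.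
have ie : integ P (cst e) by exact: finite_measure_integrable_cst.
have i1 : integ P (fun w => f w - upper_avg f w) by exact: integB.
have : 0 <= \int[P]_w (f w - upper_avg f w + e).
  apply: (@garsia _ (K + K + e)).
  - by apply: measurable_funD => //; exact: measurable_funB.
  - move=> w; apply: le_trans (ler_normD _ _) _; rewrite lerD//; last by rewrite gtr0_norm.
    by apply: le_trans (ler_normB _ _) _; rewrite lerD// upper_avg_le.
  - move=> w; have [_ /(_ 1%N)[n n1 hn]] := limn_sup_bounds (fun n => orbit_avg_le n w fK) e0.
    exists n; have -> : orbit_sum (fun w => f w - upper_avg f w + e) n w =
        n%:R * (orbit_avg f n w - upper_avg f w + e).
      rewrite mulrDr mulrBr mulrA divff ?mul1r ?pnatr_eq0 -?lt0n//.
      rewrite /orbit_sum big_split/= sumrB; congr (_ - _ + _).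
        under eq_bigr do rewrite upper_avg_iter.
        by rewrite sumr_const card_ord mulr_natl.
      by rewrite sumr_const card_ord mulr_natl.
    by rewrite mulr_gt0 ?ltr0n//; rewrite /upper_avg; lra.
rewrite ED// EB// Ecst; lra.
Qed.

End bounded_function.

Lemma orbit_sumN f n w : orbit_sum (fun w => - f w) n w = - orbit_sum f n w.
Proof. by rewrite /orbit_sum sumrN. Qed.

(** The sum of upper_avg f and upper_avg (- f) is nonnegative with nonpositive
    integral, so the upper and lower limits of the averages agree almost surely.
    Convergence in mean follows by domination. *)
Lemma mean_ergodic (f : T -> R) K eps : measurable_fun setT f -> (forall w, `|f w| <= K) ->
  0 < eps -> exists2 n, (0 < n)%N &
    \int[P]_w `|orbit_avg f n w - upper_avg f w| < eps.
Proof.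
move=> mf fK eps0.
pose g w := - f w.
have mg : measurable_fun setT g by exact: measurableT_comp.
have gK w : `|g w| <= K by rewrite normrN.
have avgN n w : orbit_avg g n w = - orbit_avg f n w.
  by rewrite /orbit_avg orbit_sumN mulrN.
have iF : integ P (upper_avg f).
  apply: (@integ_bounded _ _ _ _ _ K); [exact: measurable_upper_avg fK|exact: upper_avg_le].
have iG : integ P (upper_avg g).
  apply: (@integ_bounded _ _ _ _ _ K); [exact: measurable_upper_avg gK|exact: upper_avg_le].
have ifn : integ P f by exact: integ_bounded fK.
have FG0 w : 0 <= upper_avg f w + upper_avg g w.
  apply/ler_addgt0Pr => e e0; have e2 : 0 < e / 2 by rewrite divr_gt0.
  have [[N hN] _] := limn_sup_bounds (fun n => orbit_avg_le n w fK) e2.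
  have [[N' hN'] _] := limn_sup_bounds (fun n => orbit_avg_le n w gK) e2.
  have := hN (maxn N N') (leq_maxl _ _); have := hN' (maxn N N') (leq_maxr _ _).
  rewrite avgN /upper_avg; move: (limn_sup _) (limn_sup _) (orbit_avg _ _ _) => x y z; lra.
have FG : {ae P, forall w, upper_avg f w + upper_avg g w = 0}.
  have I0 : \int[P]_w (upper_avg f w + upper_avg g w) = 0.
    apply/eqP; rewrite eq_le Rintegral_ge0 ?andbT//.
    rewrite ED//.
    have := integral_upper_avg_le mf fK; have := integral_upper_avg_le mg gK.
    have -> : \int[P]_w g w = - \int[P]_w f w.
      by rewrite -mulN1r -EZ//; apply: eq_Rintegral => w _; rewrite mulN1r.
    move: (\int[P]_w upper_avg f w) (\int[P]_w upper_avg g w) (\int[P]_w f w) => x y z; lra.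
  by apply: E_eq0 => //; exact: integD.
have [] := @dominated_Rintegral _ T R P setT
  (fun n w => `|orbit_avg f n w - upper_avg f w|) (cst 0) (cst (K + K)) measurableT.
- move=> n; apply: measurableT_comp => //; apply: measurable_funB.
    exact: measurable_orbit_avg.
  exact: measurable_upper_avg fK.
- exact: measurable_cst.
- apply: filterS FG => w FGw _; apply/cvgr0Pnorm_lt => e e0.
  have e2 : 0 < e / 2 by rewrite divr_gt0.
  have [[N hN] _] := limn_sup_bounds (fun n => orbit_avg_le n w fK) e2.
  have [[N' hN'] _] := limn_sup_bounds (fun n => orbit_avg_le n w gK) e2.
  exists (maxn N N') => // n /=; rewrite geq_max => /andP[/hN + /hN'].
  move: FGw; rewrite avgN normr_id ltr_norml /upper_avg => FGw h1 h2.
  by apply/andP; split; lra.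
- exact: finite_measure_integrable_cst.
- apply: aeW => w n _; rewrite normr_id; apply: le_trans (ler_normB _ _) _.
  by rewrite lerD ?upper_avg_le ?orbit_avg_le.
move=> _; rewrite Rintegral_cst// mul0r => /cvgr_lt/(_ _ eps0)[N _ hN].
by exists N.+1 => //; exact: (hN N.+1 (leqnSn N)).
Qed.

(** Truncate f to a bounded g. An orbit average of g is close in mean to the
    invariant function upper_avg g, and it differs from g by the coboundary of c,
    the average of the first orbit sums. *)
Lemma invariant_coboundary_decomposition (f : T -> R) (eps : R) : integ P f -> 0 < eps ->
  exists (G c : T -> R) (K : R), [/\ measurable_fun setT G, measurable_fun setT c,
     (forall w, G (S w) = G w), (forall w, `|G w| <= K /\ `|c w| <= K) &
     \int[P]_w `|f w - G w - (c w - c (S w))| < eps].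
Proof.
move=> ifn eps0; have eps2 : 0 < eps / 2 by rewrite divr_gt0.
have mf := integ_measurable ifn.
have [K K0 hK] := integral_excess_small measurableT ifn eps2.
pose g w := Num.max (- K) (Num.min K (f w)).
have mg : measurable_fun setT g.
  by apply: measurable_maxr => //; apply: measurable_minr.
have gK w : `|g w| <= K.
  by rewrite ler_norml le_max lexx/= ge_max ge_min lexx/= andbT; lra.
have fg w : `|f w - g w| = Num.max (`|f w| - K) 0.
  rewrite /g; have [fK|fK] := leP K (f w).
    rewrite (max_idPr _); last by lra.
    rewrite (ger0_norm (_ : 0 <= f w)); last by lra.
    by rewrite (max_idPl _) ?ger0_norm //; lra.
  have [fK'|fK'] := leP (f w) (- K).
    rewrite (ler0_norm (_ : f w <= 0)); last by lra.
    rewrite (max_idPl _); last by lra.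
    by rewrite ler0_norm; lra.
  rewrite subrr normr0 (max_idPr _)// subr_le0 ler_norml; apply/andP; split; lra.
have [n n0 hn] := mean_ergodic mg gK eps2.
pose c w := n%:R^-1 * \sum_(i < n) orbit_sum g i w.
have mc : measurable_fun setT c.
  by apply: measurable_funM => //; apply: measurable_sum => i; exact: measurable_orbit_sum.
have cK w : `|c w| <= n%:R * K.
  rewrite /c normrM normfV normr_nat ler_pdivrMl ?ltr0n//.
  apply: le_trans (ler_norm_sum _ _ _) _.
  apply: (@le_trans _ _ (\sum_(i < n) (n%:R * K))).
    apply: ler_sum => i _; apply: le_trans (orbit_sum_le _ _ gK) _.
    by apply: ler_wpM2r; [exact: ltW|rewrite ler_nat ltnW].
  by rewrite sumr_const card_ord -[leLHS]mulr_natl.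
have avgE w : g w - (c w - c (S w)) = orbit_avg g n w.
  rewrite /c -mulrBr -sumrB /orbit_avg.
  have nn : n%:R != 0 :> R by rewrite pnatr_eq0 -lt0n.
  have -> : \sum_(i < n) (orbit_sum g i w - orbit_sum g i (S w)) =
      \sum_(i < n) (g w - g (iter i S w)).
    apply: eq_bigr => i _; have := orbit_sumS g i w.
    rewrite {1}/orbit_sum big_ord_recr/= -/(orbit_sum g i w); lra.
  have -> : \sum_(i < n) (g w - g (iter i S w)) = n%:R * g w - orbit_sum g n w.
    by rewrite sumrB sumr_const card_ord mulr_natl.
  by rewrite mulrBr mulrA mulVf// mul1r opprB addrC subrK.
exists (upper_avg g), c, (K + n%:R * K); split => //.
- exact: measurable_upper_avg gK.
- exact: upper_avg_invariant gK.
- move=> w; have := upper_avg_le gK w; have := cK w.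
  have : 0 <= n%:R * K by rewrite mulr_ge0// ltW.
  by split; lra.
have iA : integ P (fun w => `|orbit_avg g n w - upper_avg g w|).
  apply: integ_norm; apply: integB.
    apply: (@integ_bounded _ _ _ _ _ K); [exact: measurable_orbit_avg|].
    by move=> w; exact: orbit_avg_le.
  apply: (@integ_bounded _ _ _ _ _ K); [exact: measurable_upper_avg gK|].
  by move=> w; exact: upper_avg_le.
have ig : integ P g by exact: integ_bounded gK.
have ifg : integ P (fun w => `|f w - g w|) by apply: integ_norm; exact: integB.
have iF : integ P (upper_avg g).
  apply: (@integ_bounded _ _ _ _ _ K); [exact: measurable_upper_avg gK|].
  by move=> w; exact: upper_avg_le.
have ic : integ P c by exact: integ_bounded cK.
apply: (@le_lt_trans _ _ (\int[P]_w (`|f w - g w| + `|orbit_avg g n w - upper_avg g w|))).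
  apply: E_le; [|exact: integD|].
    apply: integ_norm; apply: integB; first exact: integB.
    by apply: integB => //; exact: (mp_integ SP ic).
  move=> w; have -> : f w - upper_avg g w - (c w - c (S w)) =
      (f w - g w) + (orbit_avg g n w - upper_avg g w) by rewrite -avgE; lra.
  exact: ler_normD.
rewrite ED//; under eq_Rintegral => w _ do rewrite fg.
by lra.
Qed.

End mean_ergodic.

(** * Adjacent blocks in a parabolic box *)

(** Reduces an almost sure statement to statements outside of events of
    arbitrarily small probability, which is what a maximal inequality provides. *)
Lemma negligible_small d (T : measurableType d) (R : realType)
    (P : {measure set T -> \bar R}) (B : set T) :
  (forall eta : R, 0 < eta -> exists2 M, measurable M /\ (P M <= eta%:E)%E & B `<=` M) ->
  P.-negligible B.
Proof.
move=> H.
have {}H (k : nat) : exists M, [/\ measurable M, (P M <= (k.+1%:R^-1)%:E)%E & B `<=` M].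
  have k0 : (0 : R) < k.+1%:R^-1 by rewrite invr_gt0.
  by have [M [mM PM] BM] := H _ k0; exists M.
pose M k := sval (cid (H k)).
have MP k : [/\ measurable (M k), (P (M k) <= (k.+1%:R^-1)%:E)%E & B `<=` M k].
  by rewrite /M; case: cid.
exists (\bigcap_k M k); split.
- by apply: bigcapT_measurable => k; have [] := MP k.
- apply/eqP; rewrite -measure_le0; apply/lee_addgt0Pr => e e0; rewrite add0e.
  near \oo => k; have [mMk PMk _] := MP k.
  apply: (@le_trans _ _ (P (M k))).
    apply: le_measure; rewrite ?inE//.
      by apply: bigcapT_measurable => j; have [] := MP j.
    exact: bigcap_inf.
  apply: le_trans PMk _; rewrite lee_fin ltW//.
  by near: k; exact: near_infty_natSinv_lt (PosNum e0).
- by move=> w Bw k _; have [_ _] := MP k; exact.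
Unshelve. all: by end_near. Qed.

Lemma sum_window_le (R : realDomainType) (g : int -> R) (y : int) (m b : nat) :
  (forall z, 0 <= g z) -> - b%:Z <= y -> y + m%:Z <= b%:Z + 1 ->
  \sum_(i < m) g (y + i%:Z) <= \sum_(i < (2 * b).+1) g (i%:Z - b%:Z).
Proof.
move=> g0 yb ymb; pose x := absz (y + b%:Z).
have xE : y = x%:Z - b%:Z by rewrite /x; lia.
have xm : (x + m <= (2 * b).+1)%N by lia.
rewrite [leRHS](bigID (fun i : 'I_ _ => (x <= i < x + m)%N))/=.
rewrite (big_ord_window (fun i => g (i%:Z - b%:Z)) xm).
rewrite (eq_bigr (fun i : 'I_m => g ((x + i)%N%:Z - b%:Z))); last first.
  by move=> i _; rewrite xE; congr g; lia.
by rewrite lerDl; apply: sumr_ge0.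
Qed.

Lemma norm_second_diff_le (R : realFieldType) (K x1 x2 x3 : R) :
  `|x1| <= K -> `|x2| <= K -> `|x3| <= K -> `|x1 - x2 - (x2 - x3)| <= 4 * K.
Proof.
rewrite !ler_norml => /andP[? ?] /andP[? ?] /andP[? ?]; apply/andP; split; lra.
Qed.

Lemma norm_add_diff_le (R : realFieldType) (K x1 x2 x3 : R) :
  `|x1| <= K -> `|x2| <= K -> `|x3| <= K -> `|x1 + (x2 - x3)| <= 3 * K.
Proof.
rewrite !ler_norml => /andP[? ?] /andP[? ?] /andP[? ?]; apply/andP; split; lra.
Qed.

Lemma adjacent_blocks_in_box (n m : nat) (y : int) : (m <= n)%N ->
  - (4 * n)%N%:Z <= y <= (4 * n)%N%:Z ->
  [/\ - (6 * n)%N%:Z <= y, y + m%:Z <= (6 * n)%N%:Z,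
      - (6 * n)%N%:Z <= y + m%:Z & y + m%:Z + m%:Z <= (6 * n)%N%:Z].
Proof. by move=> mn yn; split; lia. Qed.

Section space_time_blocks.
Variables (d : measure_display) (T : measurableType d) (R : realType).
Variable P : probability T R.
Variable th : nat -> int -> T -> T.
Hypothesis thP : forall k y, measure_preserving P (th k y).
Hypothesis thD : forall k y k' y' w, th k y (th k' y' w) = th (k + k') (y + y') w.

Lemma invariant_th (G : T -> R) : (forall w, G (th 0 1 w) = G w) ->
  forall k y w, G (th k y w) = G (th k 0 w).
Proof.
move=> GS k y w.
have step z : G (th k (z + 1) w) = G (th k z w).
  by rewrite -[RHS]GS thD add0n addrC.
elim/int_rect: y => // n IH.
  by rewrite -IH -[RHS]step; congr (G (th _ _ _)); lia.
by rewrite -IH -[LHS]step; congr (G (th _ _ _)); lia.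
Qed.

Lemma sum_coboundary (c : T -> R) k y m w :
  \sum_(i < m) (c (th k (y + i%:Z) w) - c (th 0 1 (th k (y + i%:Z) w))) =
  c (th k y w) - c (th k (y + m%:Z) w).
Proof.
elim: m => [|m IH]; first by rewrite big_ord0 addr0 subrr.
rewrite big_ord_recr/= IH thD add0n.
have -> : 1 + (y + m%:Z) = y + m.+1%:Z by lia.
by rewrite addrA subrK.
Qed.

(** Write f as G + (c - c o th 0 1) plus a remainder, with G invariant in space.
    In the difference of two adjacent windows G cancels and the coboundary
    telescopes to four bounded terms per row, of total order n^2; the remainder is
    small by the maximal inequality. The separate row at time k serves to pass
    from integer to real times. *)
Lemma adjacent_blocks (f : T -> R) (lam : R) : integ P f -> 0 < lam ->
  {ae P, forall w, exists N : nat, forall (n k m : nat) (y : int),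
    (N <= n)%N -> (k <= n ^ 2)%N -> (m <= n)%N -> - (4 * n)%N%:Z <= y <= (4 * n)%N%:Z ->
    `|\sum_(j < k) \sum_(i < m) (f (th j (y + i%:Z) w) - f (th j (y + m%:Z + i%:Z) w))| +
    \sum_(i < m) `|f (th k (y + i%:Z) w)| <= lam * n%:R ^+ 3}.
Proof.
move=> intf lam0; apply: negligible_small => eta eta0.
(* 156 = 2 * 3 * 26: three blocks of remainder, each inside a box of at most
   26 n^3 points, must cost at most half of lam n^3 *)
pose lam' := lam / 156.
have lam'0 : 0 < lam' by rewrite divr_gt0.
pose eps := eta * lam' / 16.
have eps0 : 0 < eps by rewrite divr_gt0 ?mulr_gt0.
have [G [c [K [mG mc GS GcK small]]]] :=
  invariant_coboundary_decomposition (thP 0 1) intf eps0.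
pose h w := `|f w - G w - (c w - c (th 0 1 w))|.
have iG : integ P G by apply: (@integ_bounded _ _ _ _ _ K) => // w; have [] := GcK w.
have ic : integ P c by apply: (@integ_bounded _ _ _ _ _ K) => // w; have [] := GcK w.
have ih : integ P h.
  apply: integ_norm; apply: integB; first exact: integB.
  by apply: integB => //; exact: (mp_integ (thP 0 1) ic).
pose a n := (n ^ 2).+1; pose b n := (6 * n)%N.
have [M [mM PM] hM] : exists2 M, measurable M /\ (P M <= (16 / lam' * \int[P]_w h w)%:E)%E &
    forall w, ~ M w -> forall n, boxsum th a b h n w <= lam' * (boxsize a b n)%:R.
  apply: maximal_ergodic_inequality => //.
  - by move=> m n mn; rewrite ltnS leq_exp2r.
  - by move=> m n mn; rewrite leq_mul2l mn orbT.
  - by move=> w; exact: normr_ge0.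
exists M.
  split => //; apply: le_trans PM _; rewrite lee_fin mulrAC ler_pdivrMr//.
  have : eps * 16 = eta * lam' by rewrite /eps; field.
  move: small; rewrite -/h; move: (\int[P]_w h w) => I; lra.
move=> w /= bad; apply: contrapT => nM; apply: bad.
have [N NK] := exists_natr_ge (14 * K / lam).
exists N.+1 => n k m y Nn kn mn yn.
have n0 : (0 < n)%N by exact: leq_ltn_trans Nn.
have [y1 y2 y3 y4] := adjacent_blocks_in_box mn yn.
have K0 : 0 <= K by have [] := GcK w => /(le_trans (normr_ge0 _)).
have hbox := hM w nM n.
pose B := boxsum th a b h n w; rewrite -/B in hbox.
have block (z : int) (l : nat) : (l <= a n)%N -> - (6 * n)%N%:Z <= z -> z + m%:Z <= (6 * n)%N%:Z ->
    \sum_(j < l) \sum_(i < m) h (th j (z + i%:Z) w) <= B.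
  move=> la z1 z2; rewrite /B /boxsum (big_ord_widen _ (fun j => \sum_(i < m) h (th j (z + i%:Z) w)) la).
  rewrite big_mkcond/=; apply: ler_sum => j _; case: ifP => _; last first.
    by apply: sumr_ge0 => i _; exact: normr_ge0.
  apply: (@sum_window_le _ (fun z => h (th j z w))); [by move=> z'; exact: normr_ge0|by []|].
  by apply: le_trans z2 _; rewrite lerDl.
have fE v : f v = G v + (c v - c (th 0 1 v)) + (f v - G v - (c v - c (th 0 1 v))) by ring.
have main : `|\sum_(j < k) \sum_(i < m) (f (th j (y + i%:Z) w) - f (th j (y + m%:Z + i%:Z) w))|
    <= k%:R * (4 * K) + 2 * B.
  have row j : `|\sum_(i < m) (f (th j (y + i%:Z) w) - f (th j (y + m%:Z + i%:Z) w))| <=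
      4 * K + (\sum_(i < m) h (th j (y + i%:Z) w) + \sum_(i < m) h (th j (y + m%:Z + i%:Z) w)).
    pose r v := f v - G v - (c v - c (th 0 1 v)).
    have -> : \sum_(i < m) (f (th j (y + i%:Z) w) - f (th j (y + m%:Z + i%:Z) w)) =
        (c (th j y w) - c (th j (y + m%:Z) w)
         - (c (th j (y + m%:Z) w) - c (th j (y + m%:Z + m%:Z) w))) +
        (\sum_(i < m) r (th j (y + i%:Z) w) - \sum_(i < m) r (th j (y + m%:Z + i%:Z) w)).
      rewrite -!sum_coboundary -!sumrB -big_split/=; apply: eq_bigr => i _.
      rewrite /r (invariant_th GS j (y + i%:Z)) (invariant_th GS j (y + m%:Z + i%:Z)).
      by ring.
    have nr z : `|\sum_(i < m) r (th j (z + i%:Z) w)| <= \sum_(i < m) h (th j (z + i%:Z) w).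
      exact: ler_norm_sum.
    have [_ c1] := GcK (th j y w); have [_ c2] := GcK (th j (y + m%:Z) w).
    have [_ c3] := GcK (th j (y + m%:Z + m%:Z) w).
    apply: le_trans (ler_normD _ _) (lerD _ _).
      exact: norm_second_diff_le.
    by apply: le_trans (ler_normB _ _) (lerD _ _).
  apply: le_trans (ler_norm_sum _ _ _) _.
  apply: le_trans (ler_sum _ (fun j _ => row (nat_of_ord j))) _.
  rewrite big_split/= sumr_const card_ord -[X in X + _]mulr_natl lerD2l big_split/=.
  have ka : (k <= a n)%N by exact: leqW.
  by rewrite mulr_natl mulr2n; apply: lerD; [exact: block|exact: block].
have row : \sum_(i < m) `|f (th k (y + i%:Z) w)| <= m%:R * (3 * K) + B.
  apply: (@le_trans _ _ (\sum_(i < m) (3 * K + h (th k (y + i%:Z) w)))).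
    apply: ler_sum => i _; rewrite fE; set v := th _ _ _.
    have [g1 c1] := GcK v; have [_ c2] := GcK (th 0 1 v).
    apply: le_trans (ler_normD _ _) (lerD _ _) => //.
    exact: norm_add_diff_le.
  rewrite big_split/= sumr_const card_ord -[X in X + _]mulr_natl lerD2l.
  have := block y k.+1 kn y1 y2.
  apply: le_trans; rewrite big_ord_recr/= lerDr.
  by apply: sumr_ge0 => j _; apply: sumr_ge0 => i _; exact: normr_ge0.
have size : (boxsize a b n)%:R <= 26 * n%:R ^+ 3 :> R.
  rewrite -natrX -natrM ler_nat /boxsize /a /b.
  move: n0; clear; nia.
have n1 : (1 : R) <= n%:R by rewrite ler1n.
have kn' : k%:R <= n%:R ^+ 2 :> R by rewrite -natrX ler_nat.
have mn' : m%:R <= n%:R ^+ 2 :> R by rewrite -natrX ler_nat (leq_trans mn)// -{1}(expn1 n) leq_pexp2l.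
have NK' : 14 * K <= lam * n%:R.
  rewrite -ler_pdivrMl// mulrC; apply: le_trans NK _; rewrite ler_nat; exact: ltnW.
apply: le_trans (lerD main row) _.
have step1 : k%:R * (4 * K) + m%:R * (3 * K) <= (7 * K) * n%:R ^+ 2.
  rewrite (_ : 7 * K * _ = n%:R ^+ 2 * (4 * K) + n%:R ^+ 2 * (3 * K)); last by ring.
  by apply: lerD; apply: ler_wpM2r => //; apply: mulr_ge0.
have step2 : 7 * K * n%:R ^+ 2 <= lam / 2 * n%:R ^+ 3.
  rewrite (exprS _ 2) mulrA; apply: ler_wpM2r; first exact: exprn_ge0.
  rewrite -(ler_pM2l (ltr0n R 2 : 0 < 2)).
  rewrite (_ : 2 * (7 * K) = 14 * K); last by ring.
  by rewrite (_ : 2 * (lam / 2 * n%:R) = lam * n%:R)//; field.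
have step3 : 3 * B <= lam / 2 * n%:R ^+ 3.
  have : 3 * B <= 3 * (lam' * (26 * n%:R ^+ 3)).
    apply: ler_wpM2l => //; apply: le_trans hbox _; apply: ler_wpM2l => //; exact: ltW.
  by rewrite (_ : 3 * (lam' * _) = lam / 2 * n%:R ^+ 3)//; rewrite /lam'; field.
rewrite addrACA (_ : 2 * B + B = 3 * B); last by ring.
apply: le_trans (lerD (le_trans step1 step2) step3) _.
by rewrite -mulrDl -splitr.
Qed.

End space_time_blocks.

(** * Shifts of the environment *)

Section reindex.
Import ArrowAsProduct.

(** The shifts are Borel for the product topology because they only permute
    coordinates. *)
Lemma continuous_reindex (I : eqType) (K : topologicalType) (r : I -> I) :
  continuous (fun (f : forall _ : I, K) (i : I) => f (r i)).
Proof.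
move=> f; apply/cvg_sup; first exact/fmap_filter/nbhs_filter.
move=> i; move: f; apply: (@continuous_comp_initial _ _ K (fun g : I -> K => g i)).
exact: (@proj_continuous I (fun=> K) (r i)).
Qed.

End reindex.

Section environment.
Variable R : realType.
Implicit Types (w : env R) (s t : R) (e z x : int).

Lemma env_shiftD s z s' z' w :
  env_shift s z (env_shift s' z' w) = env_shift (s + s') (z + z') w.
Proof.
by apply/funext => -[t e]; rewrite /env_shift/= -!addrA.
Qed.

Lemma env_shift0 w : env_shift 0 0 w = w.
Proof. by apply/funext => -[t e]; rewrite /env_shift/= !addr0. Qed.

Lemma conductance_shift s z w t e :
  conductance (env_shift s z w) t e = conductance w (t + s) (e + z).
Proof. by []. Qed.

Lemma conductance_gt0 w t e : 0 < conductance w t e.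
Proof. by rewrite /conductance; exact: (set_valP (w (t, e))). Qed.

Lemma continuous_coordinate (i : R * edge) :
  continuous ((fun f => f i) : env_space R -> positive_reals R).
Proof. exact: (@proj_continuous _ (fun _ : R * edge => positive_reals R) i). Qed.

Lemma continuous_env_shift s z :
  continuous (env_shift s z : env_space R -> env_space R).
Proof.
exact: (@continuous_reindex (R * edge)%type (positive_reals R)
  (fun te => (te.1 + s, te.2 + z))).
Qed.

Lemma measurable_env_shift s z : measurable_fun [set: env R] (env_shift s z : env R -> env R).
Proof.
apply: (@measurability _ _ (env R) (env R) setT _ (@open (env_space R))) => //.
move=> _ [U oU <-]; rewrite setTI.
by apply: sub_sigma_algebra; apply: open_comp => // x _; exact: continuous_env_shift.
Qed.

Lemma measurable_conductance t e : measurable_fun [set: env R] (fun w => conductance w t e).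
Proof.
apply: (measurability _ (RGenOpens.measurableE R)) => //.
move=> _ [_ [x [y ->]] <-]; rewrite setTI.
have oU : open [set` `]x, y[] by exact: interval_open.
apply: sub_sigma_algebra; apply: (@open_comp _ _ (fun w : env_space R => set_val (w (t, e)))) => // w _.
apply: (@continuous_comp _ _ _ (fun w : env_space R => w (t, e)) set_val).
  exact: continuous_coordinate.
exact: initial_continuous.
Qed.

Lemma stationary_mp (P : probability (env R) R) s z : stationary P ->
  measure_preserving P (env_shift s z).
Proof. by move=> stP; split => [|A mA]; [exact: measurable_env_shift|exact: stP]. Qed.

End environment.

(** * Energy, and sublinearity at a fixed time *)

Section energy.
Variables (R : realType) (P : probability (env R) R).
Implicit Types (w : env R) (Psi : env R -> int -> R).

Lemma integ_expectation (X : env R -> R) : measurable_fun setT X ->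
  (forall w, 0 <= X w) -> ('E_P[X] < +oo)%E -> integ P X.
Proof.
move=> mX X0; rewrite unlock => fin; apply/integrableP; split; first exact/measurable_EFinP.
by under eq_integral => w _ do rewrite gee0_abs ?lee_fin//.
Qed.

Lemma measurable_conductanceV t e :
  measurable_fun [set: env R] (fun w => (conductance w t e)^-1).
Proof.
have -> : (fun w => (conductance w t e)^-1) = (fun w => conductance w t e `^ (-1)).
  by apply/funext => w; rewrite powR_inv1// ltW// conductance_gt0.
by apply: (measurableT_comp (measurable_powR _)); exact: measurable_conductance.
Qed.

Hypothesis P_mean : forall (t : R) (e : edge),
       ('E_P[(fun w => conductance w t e)] < +oo)%E.
Hypothesis P_mean_inv : forall (t : R) (e : edge),
       ('E_P[(fun w => (conductance w t e)^-1)%R] < +oo)%E.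

Lemma integ_conductance t e : integ P (fun w => conductance w t e).
Proof.
by apply: integ_expectation => //; [exact: measurable_conductance|move=> w; exact/ltW/conductance_gt0].
Qed.

Lemma integ_conductanceV t e : integ P (fun w => (conductance w t e)^-1).
Proof.
apply: integ_expectation => //; first exact: measurable_conductanceV.
by move=> w; rewrite invr_ge0; exact/ltW/conductance_gt0.
Qed.

Lemma sqnorm_terms w Psi :
  \sum_(x <- neighbors 0) weight w 0 0 x * `|Psi w x| ^+ 2 =
  conductance w 0 (-1) * Psi w (-1) ^+ 2 + conductance w 0 0 * Psi w 1 ^+ 2.
Proof.
by rewrite /neighbors !big_cons big_nil addr0 sub0r add0r /weight/= !real_normK ?num_real.
Qed.

Lemma energy_le_sqnorm Psi : (forall x, measurable_fun [set: env R] (fun w => Psi w x)) ->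
  ('E_P[(fun w => conductance w 0 0 * Psi w 1 ^+ 2)%R] <= cov_sqnorm P Psi)%E.
Proof.
move=> mPsi.
have me x e : measurable_fun [set: env R] (fun w => conductance w 0 e * Psi w x ^+ 2).
  by apply: measurable_funM; [exact: measurable_conductance|exact: measurable_funX].
have e0 x e w : 0 <= conductance w 0 e * Psi w x ^+ 2.
  by rewrite mulr_ge0 ?sqr_ge0// ltW// conductance_gt0.
rewrite /cov_sqnorm unlock; apply: ge0_le_integral => //.
- by move=> w _; rewrite lee_fin.
- exact/measurable_EFinP.
- by apply/measurable_EFinP; under eq_fun do rewrite sqnorm_terms; exact: measurable_funD.
- by move=> w _; rewrite sqnorm_terms lee_fin lerDr.
Qed.

Lemma integ_energy Psi : (forall x, measurable_fun [set: env R] (fun w => Psi w x)) ->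
  (cov_sqnorm P Psi < +oo)%E -> integ P (fun w => conductance w 0 0 * Psi w 1 ^+ 2).
Proof.
move=> mPsi fin; apply: integ_expectation.
- by apply: measurable_funM; [exact: measurable_conductance|exact: measurable_funX].
- by move=> w; rewrite mulr_ge0 ?sqr_ge0// ltW// conductance_gt0.
- exact: le_lt_trans (energy_le_sqnorm mPsi) fin.
Qed.

Lemma energy_le Psi (eta : R) : (forall x, measurable_fun [set: env R] (fun w => Psi w x)) ->
  (cov_sqnorm P Psi < eta%:E)%E -> \int[P]_w (conductance w 0 0 * Psi w 1 ^+ 2) <= eta.
Proof.
move=> mPsi lte; have ie := integ_energy mPsi (lt_trans lte (ltry _)).
rewrite -lee_fin fineK ?integrable_fin_num//; apply: le_trans (ltW lte).
by have := energy_le_sqnorm mPsi; rewrite unlock.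
Qed.

(** Weighted arithmetic-geometric mean inequality: the difference of the two sides
    is a square over a positive number. *)
Lemma norm_le_energy (o u c : R) : 0 < o -> 0 < c ->
  `|u| <= (c * (o * u ^+ 2) + c^-1 * o^-1) / 2.
Proof.
move=> o0 c0; rewrite -subr_ge0 -(real_normK (num_real u)).
have -> : (c * (o * `|u| ^+ 2) + c^-1 * o^-1) / 2 - `|u| =
    (c * o * `|u| - 1) ^+ 2 / (2 * c * o).
  by field; rewrite !gt_eqF.
by rewrite divr_ge0 ?sqr_ge0// !mulr_ge0// ltW.
Qed.

(** The Cauchy-Schwarz inequality without square roots: integrate norm_le_energy
    with c = 1 / eta. *)
Lemma L1_le_energy (u : env R -> R) (eta : R) : measurable_fun setT u ->
  integ P (fun w => conductance w 0 0 * u w ^+ 2) -> 0 < eta ->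
  \int[P]_w (conductance w 0 0 * u w ^+ 2) <= eta ^+ 2 ->
  integ P u /\
  \int[P]_w `|u w| <= eta * (1 + \int[P]_w (conductance w 0 0)^-1).
Proof.
move=> mu ie eta0 small.
have iV := integ_conductanceV 0 0.
pose b w := (eta^-1 * (conductance w 0 0 * u w ^+ 2) + eta * (conductance w 0 0)^-1) / 2.
have ub w : `|u w| <= b w.
  have := norm_le_energy (u w) (conductance_gt0 w 0 0) (_ : 0 < eta^-1).
  by rewrite invrK invr_gt0; apply.
have ib : integ P b.
  rewrite /b; under [X in integ P X]eq_fun do rewrite mulrC.
  by apply: integZ; apply: integD; apply: integZ.
have iu : integ P u by apply: integ_le ib ub.
split => //; apply: le_trans (E_le (integ_norm iu) ib ub) _.
have -> : \int[P]_w b w = (eta^-1 * \int[P]_w (conductance w 0 0 * u w ^+ 2) +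
    eta * \int[P]_w (conductance w 0 0)^-1) / 2.
  rewrite -!EZ// -ED; [|exact: integZ|exact: integZ].
  rewrite mulrC -EZ; last by apply: integD; apply: integZ.
  by apply: eq_Rintegral => w _; rewrite mulrC.
have h1 : eta^-1 * \int[P]_w (conductance w 0 0 * u w ^+ 2) <= eta.
  by rewrite ler_pdivrMl// -expr2.
have h2 : 0 <= eta * \int[P]_w (conductance w 0 0)^-1.
  apply: mulr_ge0; first exact: ltW.
  by apply: Rintegral_ge0 => w _; rewrite invr_ge0 ltW// conductance_gt0.
rewrite mulrDr mulr1; lra.
Qed.

End energy.

Definition lattice_shift (R : realType) (k : nat) (y : int) : env R -> env R :=
  env_shift (k%:R : R) y.

Lemma lattice_shiftD (R : realType) k y k' y' (w : env R) :
  lattice_shift k y (lattice_shift k' y' w) = lattice_shift (k + k') (y + y') w.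
Proof. by rewrite /lattice_shift env_shiftD natrD. Qed.

Section spatial.
Variables (R : realType) (P : probability (env R) R).
Hypothesis stP : stationary P.
Hypothesis P_mean_inv : forall (t : R) (e : edge),
       ('E_P[(fun w => (conductance w t e)^-1)%R] < +oo)%E.

Lemma lattice_shift_mp k y : measure_preserving P (@lattice_shift R k y).
Proof. exact: stationary_mp. Qed.

(** The variations along the line are those of one function u read along the orbit
    of the space shift, to which a maximal inequality applies. *)
Lemma cocycle_increment (Psi : env R -> int -> R) (phi : env R -> R) (w : env R) :
  (forall x y, Psi (env_shift 0 x w) (y - x) = Psi w y - Psi w x) ->
  let v x := Psi w x - gradient phi w x in
  let u w := Psi w 1 - gradient phi w 1 in
  v 0 = 0 /\ forall x, v (x + 1) - v x = u (env_shift 0 x w).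
Proof.
move=> coc v u; split.
  rewrite /v /gradient env_shift0 subrr subr0.
  by have := coc 0 0; rewrite env_shift0 !subrr.
move=> x; rewrite /v /u /gradient env_shiftD addr0 (addrC 1 x).
have := coc x (x + 1); rewrite addrAC subrr add0r => ->; ring.
Qed.

Lemma sum_increments_norm (v : int -> R) (u : int -> R) (n : nat) :
  v 0 = 0 -> (forall x, v (x + 1) - v x = u x) ->
  forall x : int, `|x| <= n%:Z ->
  `|v x| <= \sum_(i < (2 * n).+1) `|u (i%:Z - n%:Z)|.
Proof.
move=> v0 vu.
have tel y (m : nat) : v (y + m%:Z) - v y = \sum_(i < m) u (y + i%:Z).
  elim: m => [|m IH]; first by rewrite big_ord0 addr0 subrr.
  rewrite big_ord_recr/= -IH -vu.
  have -> : y + m%:Z + 1 = y + m.+1%:Z by lia.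
  by ring.
move=> x xn; have [x0|x0] := leP 0 x.
  have xE : x = 0 + (absz x)%:Z by lia.
  have := tel 0 (absz x); rewrite -xE v0 subr0 => ->.
  apply: le_trans (ler_norm_sum _ _ _) _.
  by apply: (@sum_window_le _ (fun z => `|u z|)) => //; lia.
have xE : 0 = x + (absz x)%:Z by lia.
have := tel x (absz x); rewrite -xE v0 sub0r -normrN => ->.
apply: le_trans (ler_norm_sum _ _ _) _.
by apply: (@sum_window_le _ (fun z => `|u z|)) => //; lia.
Qed.

(** Subtract the gradient of a bounded phi, which stays bounded. The increment u
    of what remains is small in mean, and the maximal inequality for the space
    shift keeps the sums of |u| over [-n, n] below a small multiple of n, outside
    of an event of small probability. *)
Lemma potential_sublinear (Psi : env R -> int -> R) (eps : R) : L2pot P Psi -> 0 < eps ->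
  {ae P, forall w, exists N : nat, forall n x, (N <= n)%N -> `|x| <= n%:Z ->
    `|Psi w x| <= eps * n%:R}.
Proof.
move=> [[mPsi coc sq] appr] eps0.
suff H : {ae P, forall w,
    (forall x y, Psi (env_shift 0 x w) (y - x) = Psi w y - Psi w x) ->
    exists N : nat, forall n x, (N <= n)%N -> `|x| <= n%:Z -> `|Psi w x| <= eps * n%:R}.
  by apply: filterS2 coc H => w cw; apply.
apply: negligible_small => eta eta0.
set I := \int[P]_w (conductance w 0 0)^-1.
have I0 : 0 <= I by apply: Rintegral_ge0 => w _; rewrite invr_ge0 ltW// conductance_gt0.
pose lam := eps / 6; have lam0 : 0 < lam by rewrite divr_gt0.
pose e := eta * lam / 16 / (1 + I).
have e0 : 0 < e by rewrite !divr_gt0 ?mulr_gt0// ltr_pwDl.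
have [phi [mphi [K phiK] small]] := appr _ e0.
pose D w x := Psi w x - gradient phi w x.
have mgrad x : measurable_fun setT (fun w => gradient phi w x).
  apply: measurable_funB => //; apply: measurableT_comp => //; exact: measurable_env_shift.
have mD x : measurable_fun setT (fun w => D w x) by exact: measurable_funB.
pose u w := D w 1.
have [iu Eu] := L1_le_energy P_mean_inv (mD 1) (integ_energy mD (lt_trans small (ltry _)))
  e0 (energy_le mD small).
have [M [mM PM] hM] : exists2 M, measurable M /\ (P M <= (16 / lam * \int[P]_w `|u w|)%:E)%E &
    forall w, ~ M w -> forall n, boxsum (@lattice_shift R) (fun=> 1%N) id (fun w => `|u w|) n w
      <= lam * (boxsize (fun=> 1%N) id n)%:R.
  apply: maximal_ergodic_inequality => //.
  - exact: lattice_shift_mp.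
  - exact: lattice_shiftD.
  - exact: integ_norm.
exists M.
  split => //; apply: le_trans PM _; rewrite lee_fin mulrAC ler_pdivrMr//.
  have : e * (1 + I) * 16 = eta * lam by rewrite /e; field; rewrite gt_eqF// ltr_pwDl.
  move: Eu; rewrite -/I -/u; set E := \int[P]_w _; set X := e * (1 + I); lra.
move=> w /= bad; apply: contrapT => nM; apply: bad => cw.
have [N NK] := exists_natr_ge (4 * K / eps).
exists N.+1 => n x Nn xn.
have n1 : (1 : R) <= n%:R by rewrite ler1n; exact: leq_ltn_trans Nn.
have [v0 vu] := cocycle_increment phi cw.
have vx := sum_increments_norm v0 vu xn.
have := hM w nM n; rewrite /boxsum big_ord1 /boxsize mul1n => hn.
have NK' : 4 * K <= eps * n%:R.
  rewrite -ler_pdivrMl// mulrC; apply: le_trans NK _; rewrite ler_nat; exact: ltnW.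
have size : (2 * n).+1%:R <= 3 * n%:R :> R.
  by rewrite -natr1 natrM; lra.
have gK : `|gradient phi w x| <= K + K.
  by apply: le_trans (ler_normB _ _) _; apply: lerD.
have -> : Psi w x = (Psi w x - gradient phi w x) + gradient phi w x by ring.
apply: le_trans (ler_normD _ _) _.
have h1 : `|Psi w x - gradient phi w x| <= eps / 2 * n%:R.
  apply: le_trans vx _; apply: le_trans hn _.
  apply: le_trans (ler_wpM2l (ltW lam0) size) _.
  by rewrite /lam le_eqVlt; apply/orP; left; apply/eqP; field.
have h2 : `|gradient phi w x| <= eps / 2 * n%:R.
  apply: le_trans gK _; move: NK'; clear -R; lra.
by apply: le_trans (lerD h1 h2) _; rewrite -mulrDl -splitr.
Qed.

End spatial.

(** * Null sets of a product and stationary fields *)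

Section product_null_sets.
Local Open Scope ereal_scope.
Context d1 d2 (T1 : measurableType d1) (T2 : measurableType d2) (R : realType).
Variable m1 : {sigma_finite_measure set T1 -> \bar R}.
Variable m2 : {sigma_finite_measure set T2 -> \bar R}.

Lemma ge0_integral_eq0_ae d (T : measurableType d) (m : {measure set T -> \bar R})
    (F : T -> \bar R) : measurable_fun setT F -> (forall x, 0 <= F x) ->
  \int[m]_x F x = 0 -> {ae m, forall x, F x = 0}.
Proof.
move=> mF F0 I0.
have [H _] := @ae_eq_integral_abs _ T R m setT measurableT F mF.
have : {ae m, forall x, setT x -> F x = cst 0 x}.
  by apply: H; under eq_integral => x _ do rewrite gee0_abs//.
by apply: filterS => x; exact.
Qed.

Lemma ae_product1 (Q : T1 -> T2 -> Prop) :
  (m1 \x m2).-negligible [set z | ~ Q z.1 z.2] ->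
  {ae m1, forall x, {ae m2, forall y, Q x y}}.
Proof.
move=> [A [mA A0 NA]].
have := @ge0_integral_eq0_ae _ T1 m1 (fubini_F m2 (EFin \o \1_A))
  (indic_measurable_fun_fubini_tonelli_F _ mA) (indic_fubini_tonelli_F_ge0 _ _).
rewrite -(@indic_fubini_tonelli1 _ _ _ _ _ m1 m2 A mA) integral_indic// setIT => /(_ A0).
apply: filterS => x; rewrite (indic_fubini_tonelli_FE _ mA)/= => Ax.
exists (xsection A x); split => //; first exact: measurable_xsection.
by move=> y /= nQ; rewrite xsectionE/=; apply: NA.
Qed.

Lemma ae_product2 (Q : T1 -> T2 -> Prop) :
  (m1 \x m2).-negligible [set z | ~ Q z.1 z.2] ->
  {ae m2, forall y, {ae m1, forall x, Q x y}}.
Proof.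
move=> [A [mA A0 NA]].
have := @ge0_integral_eq0_ae _ T2 m2 (fubini_G m1 (EFin \o \1_A))
  (indic_measurable_fun_fubini_tonelli_G _ mA) (indic_fubini_tonelli_G_ge0 _ _).
rewrite -(@indic_fubini_tonelli _ _ _ _ _ m1 m2 A mA).
rewrite -(@indic_fubini_tonelli1 _ _ _ _ _ m1 m2 A mA) integral_indic// setIT => /(_ A0).
apply: filterS => y; rewrite (indic_fubini_tonelli_GE _ mA)/= => Ay.
exists (ysection A y); split => //; first exact: measurable_ysection.
by move=> x /= nQ; rewrite ysectionE/=; apply: NA.
Qed.

End product_null_sets.

Section stationary_field.
Variables (R : realType) (P : probability (env R) R).
Hypothesis stP : stationary P.
Local Notation leb := (@lebesgue_measure R).

(** By stationarity E|K(s, .)| does not depend on s, so K is integrable over the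
    unit time interval. K stands for a jointly measurable version of the path s ->
    kap (env_shift s 0 w): for the Borel sets of an uncountable product, the path
    itself need not be measurable in (s, w). *)
Lemma stationary_field_fubini (K : R * env R -> R) (kap : env R -> R) :
  measurable_fun setT K -> integ P kap ->
  {ae leb, forall s, 0 < s < 1 -> {ae P, forall w, K (s, w) = kap (env_shift s 0 w)}} ->
  [/\ {ae P, forall w, leb.-integrable `[0, 1] (EFin \o (fun s => K (s, w)))},
      integ P (fun w => \int[leb]_(s in `[0, 1]) K (s, w)) &
      \int[P]_w (\int[leb]_(s in `[0, 1]) K (s, w)) = \int[P]_w kap w].
Proof.
move=> mK ik Kk.
pose f (z : R * env R) : \bar R := (\1_(`[0, 1] : set R) z.1 * K z)%:E.
have mf : measurable_fun setT f.
  apply/measurable_EFinP; apply: measurable_funM => //.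
  by apply: measurableT_comp => //.
have f01 : {ae leb, forall s, (0 < s < 1) \/ ~ (0 <= s <= 1)}.
  have n1 (x : R) : leb.-negligible [set x].
    by apply/negligibleP => //; exact: lebesgue_measure_set1.
  apply: negligibleS (negligibleU (n1 0) (n1 1)) => s /= /not_orP[s01 /contrapT/andP[s0 s1]].
  move: s0; rewrite le_eqVlt => /orP[/eqP <-|s0]; [by left|right].
  by move: s1; rewrite le_eqVlt => /orP[/eqP //|s1]; case: s01; rewrite s0 s1.
have fE s w : 0 < s < 1 -> f (s, w) = (K (s, w))%:E.
  move=> /andP[s0 s1]; rewrite /f indicE mem_set ?mul1r//= in_itv/= ltW//= ltW//.
have fE' s w : ~ (0 <= s <= 1) -> f (s, w) = 0%E.
  by move=> s01; rewrite /f indicE memNset ?mul0r//= in_itv/=.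
have ind1 (s : R) : 0 < s < 1 -> \1_(`[0, 1] : set R) s = 1 :> R.
  by move=> /andP[s0 s1]; rewrite indicE mem_set//= in_itv/= !ltW.
have ind0 (s : R) : ~ (0 <= s <= 1) -> \1_(`[0, 1] : set R) s = 0 :> R.
  by move=> s01; rewrite indicE memNset//= in_itv/=.
have ikn := integ_norm ik.
have mfs s : measurable_fun setT (fun w => f (s, w)) by exact: measurableT_comp.
have iind1 : leb.-integrable setT (EFin \o (\1_(`[0, 1] : set R))).
  exact: integrable_indic_itv.
have iind (c : R) : leb.-integrable setT (EFin \o (fun s => c * \1_(`[0, 1] : set R) s)).
  exact: (integrableZl measurableT c iind1).
have Iind (c : R) : (\int[leb]_s (c * \1_(`[0, 1] : set R) s)%:E = c%:E)%E.
  rewrite -[LHS]fineK; last exact: integrable_fin_num (iind c).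
  congr EFin; rewrite -/(Rintegral _ _ _) RintegralZl//.
  rewrite /Rintegral integral_indic// setIT [X in fine X](lebesgue_measure_itv `[0, 1]).
  by rewrite /= lte_fin ltr01/= subr0 mulr1.
have mp s := stationary_mp s 0 stP.
have abs_s s : 0 < s < 1 -> {ae P, forall w, K (s, w) = kap (env_shift s 0 w)} ->
    (\int[P]_w `|f (s, w)| = (\int[P]_w `|kap w|)%:E)%E.
  move=> s01 Ks.
  have -> : (\int[P]_w `|f (s, w)| = \int[P]_w `|(kap (env_shift s 0 w))%:E|)%E.
    apply: ae_eq_integral => //.
    - exact: measurableT_comp.
    - do 2 apply: measurableT_comp => //.
      by apply: (mp_measurable (mp s)); exact: integ_measurable ik.
    by apply: filterS Ks => w Kw _; rewrite fE// Kw.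
  rewrite (mp_ge0_integral (mp s) (g := fun w => `|(kap w)%:E|%E))//; last first.
    by do 2 apply: measurableT_comp => //; exact: integ_measurable ik.
  by rewrite fineK//; exact: integrable_fin_num ikn.
have int_s s : 0 < s < 1 -> {ae P, forall w, K (s, w) = kap (env_shift s 0 w)} ->
    (\int[P]_w f (s, w) = (\int[P]_w kap w)%:E)%E.
  move=> s01 Ks.
  have -> : (\int[P]_w f (s, w) = \int[P]_w (kap (env_shift s 0 w))%:E)%E.
    apply: ae_eq_integral => //.
    - apply/measurable_EFinP; apply: (mp_measurable (mp s)); exact: integ_measurable ik.
    by apply: filterS Ks => w Kw _; rewrite fE// Kw.
  rewrite -(mp_Rintegral (mp s) ik) fineK//; exact: integrable_fin_num (mp_integ (mp s) ik).
have intf : (leb \x P)%E.-integrable setT f.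
  apply/integrable12ltyP => //.
  have -> : (\int[leb]_s \int[P]_w `|f (s, w)| =
      \int[leb]_s ((\int[P]_w `|kap w|) * \1_(`[0, 1] : set R) s)%:E)%E.
    apply: ae_eq_integral => //.
    - by apply: (measurable_fun_fubini_tonelli_F (abse \o f)) => //=; exact: measurableT_comp.
    - exact: measurable_int (iind _).
    apply: filterS2 f01 Kk; first exact: (ae_filter_ringOfSetsType leb).
    move=> s [s01 /(_ s01) Ks _|s01 _ _].
      by rewrite abs_s// ind1// mulr1.
    rewrite ind0// mulr0; under eq_integral => w _ do rewrite fE'// abse0.
    by rewrite integral0.
  by rewrite Iind ltry.
have G_E w : (\int[leb]_(s in `[0%R, 1%R]) (K (s, w))%:E = fubini_G leb f w)%E.
  rewrite /fubini_G [LHS]integral_mkcond; apply: eq_integral => s _.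
  by rewrite restrict_EFin /= patchE /f indicE/=; case: ifPn => _; rewrite ?mul1r ?mul0r.
have mG := measurable_fubini_G intf.
have iG : P.-integrable setT (fubini_G leb f).
  apply/integrableP; split => //; apply: le_lt_trans ((integrable21ltyP leb P mf).1 intf).
  apply: ge0_le_integral => //; first exact: measurableT_comp.
    have mabsf : measurable_fun setT (abse \o f) by exact: measurableT_comp.
    exact: (measurable_fun_fubini_tonelli_G (m1 := leb) (abse \o f) mabsf (fun=> abse_ge0 _)).
  by move=> w _; apply: le_abse_integral => //; exact: measurableT_comp.
have ia : integ P (fun w => \int[leb]_(s in `[0, 1]) K (s, w)).
  apply: le_integrable iG => //.
    apply/measurable_EFinP; under eq_fun do rewrite /Rintegral G_E.
    exact: measurableT_comp.
  by move=> w _; rewrite /= /Rintegral G_E; case: (fubini_G _ _ _) => [r| |] //=; rewrite normr0 leey.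
split => //.
- apply: filterS (ae_integrable2 intf) => w h; rewrite integrable_mkcond//.
  apply: eq_integrable h => //= s _.
  by rewrite restrict_EFin/= patchE /f indicE/=; case: ifPn => _; rewrite ?mul1r ?mul0r.
- apply: EFin_inj; rewrite fineK; last exact: integrable_fin_num ia.
  transitivity (\int[P]_w fubini_G leb f w)%E.
    apply: ae_eq_integral => //; first by apply/measurable_EFinP; exact: integ_measurable ia.
    have := integrable_ae measurableT iG; apply: filterS => w /(_ I) fin _.
    by rewrite /Rintegral G_E fineK.
  rewrite /fubini_G -(Fubini intf).
  transitivity (\int[leb]_s ((\int[P]_w kap w) * \1_(`[0, 1] : set R) s)%:E)%E; last exact: Iind.
  apply: ae_eq_integral => //.
  - exact: measurable_fubini_F intf.
  - exact: measurable_int (iind _).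
  apply: filterS2 f01 Kk; first exact: (ae_filter_ringOfSetsType leb).
  move=> s [s01 /(_ s01) Ks _|s01 _ _].
    by rewrite int_s// ind1// mulr1.
  rewrite ind0// mulr0; under eq_integral => w _ do rewrite fE'//.
  by rewrite integral0.
Qed.

End stationary_field.

(** * Locally absolutely continuous paths *)

Lemma ae_forall_countable d (T : measurableType d) (R : realType)
    (P : {measure set T -> \bar R}) (I : countType) (Q : I -> T -> Prop) :
  (forall i, {ae P, forall w, Q i w}) -> {ae P, forall w, forall i, Q i w}.
Proof.
move=> H.
have H' (n : nat) : {ae P, forall w, if unpickle n is Some i then Q i w else True}.
  by case: (unpickle n) => [i|]; [exact: H|exact: aeW].
have := ae_foralln H'; apply: filterS => w Hw i.
by have := Hw (pickle i); rewrite pickleK.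
Qed.

Lemma lebesgue_measure_shift (R : realType) (c : R) (A : set R) : measurable A ->
  lebesgue_measure ((fun x : R => x + c) @^-1` A) = lebesgue_measure A.
Proof.
move=> mA.
have mf : measurable_fun [set: measurableTypeR R] ((fun x => x + c) : measurableTypeR R -> measurableTypeR R).
  by apply: measurable_funD => //; exact: measurable_id.
rewrite -[LHS]/(pushforward lebesgue_measure (fun x : R => x + c) A).
rewrite [RHS](@lebesgue_measure_unique R (pushforward lebesgue_measure ((fun x => x + c) : measurableTypeR R -> measurableTypeR R)))//.
move=> X [[a b] _ <-]; rewrite [LHS](lebesgue_measure_itv `]a, b])/= /pushforward.
have -> : (fun x : R => x + c) @^-1` [set` `]a, b]] = [set` `]a - c, b - c]].
  by apply/seteqP; split=> x /=; rewrite !in_itv/= ltrBlDr lerBrDr.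
rewrite [RHS](lebesgue_measure_itv `]a - c, b - c])/= !lte_fin ltrD2r.
by case: ifP => // _; rewrite -EFinB; congr EFin; ring.
Qed.

Lemma ae_lebesgue_shift (R : realType) (c : R) (Q : R -> Prop) :
  {ae lebesgue_measure, forall t : R, Q t} -> {ae lebesgue_measure, forall t : R, Q (t + c)}.
Proof.
move=> [A [mA A0 QA]]; exists ((fun x : R => x + c) @^-1` A); split.
- rewrite -[X in measurable X]setTI.
  have mf : measurable_fun [set: measurableTypeR R] ((fun x => x + c) : measurableTypeR R -> measurableTypeR R).
    by apply: measurable_funD => //; exact: measurable_id.
  exact: mf.
- by rewrite lebesgue_measure_shift.
- by move=> t /= nQ; apply: QA.
Qed.

Section absolutely_continuous_paths.
Variable R : realType.
Implicit Types f g : R -> R.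

Definition locally_ac f := forall a b, absolutely_continuous a b f.

Lemma locally_acB f g : locally_ac f -> locally_ac g -> locally_ac (fun t => f t - g t).
Proof.
move=> acf acg a b eps eps0.
have eps2 : 0 < eps / 2 by rewrite divr_gt0.
have [d1 d10 h1] := acf a b _ eps2; have [d2 d20 h2] := acg a b _ eps2.
exists (Num.min d1 d2); first by rewrite lt_min d10.
move=> n u v uv dis; rewrite lt_min => /andP[l1 l2].
apply: (@le_lt_trans _ _ (\sum_(i < n) (`|f (v i) - f (u i)| + `|g (v i) - g (u i)|))).
  apply: ler_sum => i _.
  have -> : f (v i) - g (v i) - (f (u i) - g (u i)) =
    (f (v i) - f (u i)) - (g (v i) - g (u i)) by ring.
  exact: ler_normB.
rewrite big_split/=.
have := h1 _ _ _ uv dis l1; have := h2 _ _ _ uv dis l2; lra.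
Qed.

Lemma locally_ac_lipschitz f (h : R -> R) : (forall x y, `|h x - h y| <= `|x - y|) ->
  locally_ac f -> locally_ac (fun t => h (f t)).
Proof.
move=> hL acf a b eps eps0; have [d d0 hd] := acf a b eps eps0.
exists d => // n u v uv dis l; apply: le_lt_trans (hd n u v uv dis l).
by apply: ler_sum => i _; exact: hL.
Qed.

Lemma locally_ac_shift f c : locally_ac f -> locally_ac (fun t => f (t + c)).
Proof.
move=> acf a b eps eps0; have [d d0 hd] := acf (a + c) (b + c) eps eps0.
exists d => // n u v uv dis l.
apply: (hd n (fun i => u i + c) (fun i => v i + c)).
- by move=> i /uv[? ? ?]; rewrite !lerD2r.
- by move=> i j /dis; rewrite lerD2r.
- by rewrite (eq_bigr (fun i : 'I_n => v i - u i)) => // i _; ring.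
Qed.

Lemma locally_ac_continuous f t eps : locally_ac f -> 0 < eps ->
  exists2 delta, 0 < delta & forall s, `|s - t| < delta -> `|f s - f t| < eps.
Proof.
move=> acf eps0; have [d d0 hd] := acf (t - 1) (t + 1) eps eps0.
exists (Num.min d 1); first by rewrite lt_min d0 ltr01.
move=> s; rewrite lt_min => /andP[sd s1].
have inc u v : t - 1 <= u -> u <= v -> v <= t + 1 -> v - u < d -> `|f v - f u| < eps.
  move=> tu uv vt vud; have := hd 1%N (fun=> u) (fun=> v); rewrite !big_ord1; apply => //.
  by move=> i j; rewrite ltnS leqn0 => /andP[ij /eqP j0]; rewrite j0 in ij.
move: s1; rewrite ltr_norml => /andP[s1 s1'].
have [st|ts] := leP s t.
  by rewrite distrC; apply: inc => //; move: sd; rewrite ltr_norml => /andP[]; lra.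
by apply: inc => //; move: sd; rewrite ltr_norml => /andP[]; lra.
Qed.

(** Almost sure statements hold at all rational times simultaneously; continuity
    extends them to all times. *)
Lemma locally_ac_ge0_rat f : locally_ac f -> (forall q : rat, 0 <= f (ratr q)) ->
  forall t, 0 <= f t.
Proof.
move=> acf f0 t; rewrite leNgt; apply/negP => ft.
have ft' : 0 < - f t by rewrite oppr_gt0.
have [d d0 hd] := locally_ac_continuous t acf ft'.
have td : t - d < t + d by lra.
have [q] := rat_in_itvoo td; rewrite in_itv/= => /andP[q1 q2].
have qd : `|ratr q - t| < d by rewrite ltr_norml; apply/andP; split; lra.
by have := hd _ qd; rewrite ltr_norml => /andP[_]; have := f0 q; lra.
Qed.

Lemma locally_ac_eq_rat f g : locally_ac f -> locally_ac g ->
  (forall q : rat, f (ratr q) = g (ratr q)) -> forall t, f t = g t.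
Proof.
move=> acf acg fg t; apply/eqP; rewrite eq_le -subr_ge0 -[X in _ && X]subr_ge0.
rewrite (locally_ac_ge0_rat (locally_acB acg acf)) => [|q]; last by rewrite fg subrr.
by rewrite (locally_ac_ge0_rat (locally_acB acf acg)) => // q; rewrite fg subrr.
Qed.

End absolutely_continuous_paths.

(** * Paths of the harmonic coordinate *)

Lemma integ_ae d (T : measurableType d) (R : realType) (P : probability T R)
    (f g : T -> R) : integ P f -> measurable_fun setT g ->
  {ae P, forall w, f w = g w} -> integ P g.
Proof.
move=> /integrableP[mf ifin] mg fg; apply/integrableP; split; first exact/measurable_EFinP.
rewrite (_ : (\int[P]_(x in setT) `|(EFin \o g) x|)%E = (\int[P]_(x in setT) `|(EFin \o f) x|)%E)//.
apply: ae_eq_integral => //.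
- by do 2 apply: measurableT_comp => //.
- exact: measurableT_comp.
- by apply: filterS fg => w /= ->.
Qed.

Section harmonic_coordinate_paths.
Variables (R : realType) (P : probability (env R) R) (Phi0 : env R -> int -> R).
Implicit Types (w : env R) (t s : R) (x : int).
Local Notation leb := (@lebesgue_measure R).
Local Notation Phi w t x := (space_time_field Phi0 w t x).

Definition increment w : R := Phi0 w 1 - Phi0 w 0.
Definition flux w : R := conductance w 0 0 * increment w.

Lemma field_difference w t x y :
  Phi w t y - Phi w t x = Phi0 (env_shift t 0 w) y - Phi0 (env_shift t 0 w) x.
Proof. by rewrite /space_time_field; ring. Qed.

Lemma field_difference_origin w t : Phi w t 1 - Phi w t 0 = increment (env_shift t 0 w).
Proof. exact: field_difference. Qed.

Lemma generatorE w t (f : int -> R) x :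
  generator w t f x =
  conductance w t x * (f (x + 1) - f x) - conductance w t (x - 1) * (f x - f (x - 1)).
Proof.
rewrite /generator /neighbors !big_cons big_nil addr0 /weight eqxx subrK eqxx.
have -> : (x - 1 == x + 1) = false by apply/eqP; lia.
by ring.
Qed.

Hypothesis stP : stationary P.
Hypothesis cov : L2cov P Phi0.
Hypothesis time_int : well_defined_time_integral P Phi0.
Hypothesis backward : backward_equation P Phi0.

Lemma measurable_increment : measurable_fun setT increment.
Proof. by case: cov => mPhi _ _; exact: measurable_funB. Qed.

Lemma measurable_flux : measurable_fun setT flux.
Proof. by apply: measurable_funM; [exact: measurable_conductance|exact: measurable_increment]. Qed.

Lemma ae_lattice (Q : env R -> Prop) : {ae P, forall w, Q w} ->
  {ae P, forall w, forall k y, Q (lattice_shift k y w)}.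
Proof.
move=> HQ.
have := @ae_forall_countable _ _ _ P (nat * int)%type (fun ky w => Q (lattice_shift ky.1 ky.2 w))
  (fun ky => mp_ae (lattice_shift_mp stP _ _) HQ).
by apply: filterS => w Hw k y; exact: (Hw (k, y)).
Qed.

Lemma ae_rational (Q : env R -> Prop) : {ae P, forall w, Q w} ->
  {ae P, forall w, forall (q : rat) y, Q (env_shift (ratr q) y w)}.
Proof.
move=> HQ.
have := @ae_forall_countable _ _ _ P (rat * int)%type (fun qy w => Q (env_shift (ratr qy.1) qy.2 w))
  (fun ky => mp_ae (stationary_mp _ _ stP) HQ).
by apply: filterS => w Hw k y; exact: (Hw (k, y)).
Qed.

Lemma cocycle0 w : (forall x y, Phi0 (env_shift 0 x w) (y - x) = Phi0 w y - Phi0 w x) ->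
  forall x, Phi0 (env_shift 0 x w) 0 = 0.
Proof. by move=> c x; rewrite -(subrr x) c subrr. Qed.

Lemma ae_locally_ac : {ae P, forall w, forall x, locally_ac (fun t => Phi w t x)}.
Proof. by apply: filterS backward => w H x a b; have [] := H x. Qed.

(** The null set of the cocycle property depends on the time, so that a null set
    common to all times is first found for rational ones. Both sides are
    continuous in time: the right-hand side is an increment of the field of the
    environment shifted by x. *)
Lemma ae_increment : {ae P, forall w, forall x t,
  Phi w t (x + 1) - Phi w t x = increment (env_shift t x w)}.
Proof.
have [_ coc _] := cov.
apply: filterS2 (ae_lattice ae_locally_ac) (ae_rational coc) => w ac cw x.
have ac0 y : locally_ac (fun t => Phi w t y).
  by have := ac 0%N 0 y; rewrite /lattice_shift env_shift0.
have acx y := ac 0%N x y; rewrite /lattice_shift mulr0n in acx.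
move=> t.
have -> : increment (env_shift t x w) =
    Phi (env_shift 0 x w) t 1 - Phi (env_shift 0 x w) t 0.
  by rewrite field_difference_origin env_shiftD addr0 add0r.
move: t; apply: locally_ac_eq_rat => [||q]; [exact: locally_acB|exact: locally_acB|].
rewrite field_difference field_difference_origin env_shiftD addr0 add0r.
have c := cw q 0.
have -> : env_shift (ratr q) x w = env_shift 0 x (env_shift (ratr q) 0 w).
  by rewrite env_shiftD add0r addr0.
rewrite /increment (cocycle0 c) subr0 -c; congr (Phi0 _ _); lia.
Qed.

(** The backward equation in divergence form. *)
Lemma ae_derivative : {ae P, forall w, forall x, {ae leb, forall t,
  is_derive t 1 (fun s => Phi w s x)
    (- (flux (env_shift t x w) - flux (env_shift t (x - 1) w)))}}.
Proof.
apply: filterS2 backward ae_increment => w bw incw x.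
have [_] := bw x; apply: filterS; first exact: (ae_filter_ringOfSetsType leb).
move=> t [dt eqt]; apply: DeriveDef => //.
rewrite -derive1E; move: eqt; rewrite generatorE incw.
have -> : Phi w t x - Phi w t (x - 1) = increment (env_shift t (x - 1) w).
  by rewrite -incw subrK.
rewrite /flux !conductance_shift !add0r => /eqP; rewrite addr_eq0 => /eqP //.
Qed.

(** Joint measurability holds up to a null set of the product only. One version J
    is good for all lattice translates of almost every environment. *)
Lemma flux_representative : exists J : R * env R -> R,
  [/\ measurable_fun setT J,
      {ae leb, forall s, {ae P, forall w, flux (env_shift s 0 w) = J (s, w)}} &
      {ae P, forall w, forall k y,
        {ae leb, forall s, flux (env_shift (s + k%:R) y w) = J (s, lattice_shift k y w)}}].
Proof.
have [|J mJ nJ] := time_int (y := 1); first by rewrite !inE.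
have nJ' : (leb \x P)%E.-negligible
    [set z : R * env R | ~ flux (env_shift z.1 0 z.2) = J (z.1, z.2)].
  apply: negligibleS nJ => -[s w] /=; apply: contra_not => <-.
  by rewrite /flux /increment /weight/= conductance_shift !add0r.
exists J; split => //.
  exact: (@ae_product1 _ _ _ _ _ leb P (fun s w => flux (env_shift s 0 w) = J (s, w))).
have := @ae_product2 _ _ _ _ _ leb P (fun s w => flux (env_shift s 0 w) = J (s, w)) nJ'.
move/ae_lattice; apply: filterS => w H k y.
apply: (@filterS _ _ (ae_filter_ringOfSetsType leb) _ _ _ (H k y)) => s <-.
by rewrite /lattice_shift env_shiftD add0r.
Qed.

(** With o the conductance at the origin, o d^2 being integrable, use |d| <= o d^2
    + 1 / o and o |d| <= o d^2 + o. *)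
Lemma integ_increment_flux :
  (forall (t : R) (e : edge), ('E_P[(fun w => conductance w t e)] < +oo)%E) ->
  (forall (t : R) (e : edge), ('E_P[(fun w => (conductance w t e)^-1)%R] < +oo)%E) ->
  integ P increment /\ integ P flux.
Proof.
move=> P_mean P_mean_inv; have [mPhi coc sq] := cov.
have ie := integ_energy mPhi sq.
have z : {ae P, forall w, Phi0 w 0 = 0}.
  by apply: filterS coc => w /cocycle0/(_ 0); rewrite env_shift0.
have ic := integ_conductance P_mean 0 0; have iv := integ_conductanceV P_mean_inv 0 0.
have ieI : integ P (fun w => conductance w 0 0 * increment w ^+ 2).
  apply: (integ_ae ie).
    apply: measurable_funM; [exact: measurable_conductance|apply: measurable_funX].
    exact: measurable_increment.
  by apply: filterS z => w z0; rewrite /increment z0 subr0.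
have u1 w : `|increment w| <= conductance w 0 0 * increment w ^+ 2 + (conductance w 0 0)^-1.
  have := norm_le_energy (increment w) (conductance_gt0 w 0 0) (ltr01 : 0 < 1).
  have : 0 <= conductance w 0 0 * increment w ^+ 2.
    by rewrite mulr_ge0 ?sqr_ge0// ltW// conductance_gt0.
  have : 0 <= (conductance w 0 0)^-1 by rewrite invr_ge0 ltW// conductance_gt0.
  rewrite invr1 !mul1r; lra.
have u2 w : `|flux w| <= conductance w 0 0 * increment w ^+ 2 + conductance w 0 0.
  rewrite /flux normrM gtr0_norm ?conductance_gt0//.
  rewrite -[X in _ <= _ + X]mulr1 -mulrDr ler_wpM2l//; first by rewrite ltW// conductance_gt0.
  rewrite -(real_normK (num_real (increment w))).
  have := sqr_ge0 (`|increment w| - 1); rewrite sqrrB1. have := normr_ge0 (increment w). lra.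
split.
  by apply: (integ_le measurable_increment _ u1); exact: integD.
by apply: (integ_le measurable_flux _ u2); exact: integD.
Qed.

End harmonic_coordinate_paths.

(** * Smooth approximation of the sign *)

Section smooth_absolute_value.
Variables (R : realType) (e : R).
Hypothesis e0 : 0 < e.

(** A smooth 1-Lipschitz approximation of the absolute value, which cannot itself
    be differentiated along paths that vanish. *)
Definition smooth_abs (u : R) : R := Num.sqrt (u ^+ 2 + e ^+ 2).
Definition smooth_sg (u : R) : R := u / smooth_abs u.

Lemma smooth_abs_arg_gt0 u : 0 < u ^+ 2 + e ^+ 2.
Proof. by rewrite ltr_wpDl ?sqr_ge0// exprn_gt0. Qed.

Lemma smooth_abs_gt0 u : 0 < smooth_abs u.
Proof. by rewrite sqrtr_gt0 smooth_abs_arg_gt0. Qed.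

Lemma smooth_abs_sqr u : smooth_abs u ^+ 2 = u ^+ 2 + e ^+ 2.
Proof. by rewrite sqr_sqrtr// ltW// smooth_abs_arg_gt0. Qed.

Lemma norm_le_smooth_abs u : `|u| <= smooth_abs u.
Proof. by rewrite -sqrtr_sqr ler_wsqrtr// lerDl sqr_ge0. Qed.

Lemma smooth_abs_le u : smooth_abs u <= `|u| + e.
Proof.
have ue : 0 <= `|u| + e by rewrite addr_ge0// ltW.
rewrite -[leRHS](ger0_norm ue) -sqrtr_sqr ler_wsqrtr// sqrrD (real_normK (num_real u)).
by rewrite lerD2r lerDl mulrn_wge0// mulr_ge0// ltW.
Qed.

Lemma is_derive_smooth_abs (u : R) : is_derive u (1 : R) smooth_abs (smooth_sg u).
Proof.
have h1 : is_derive u (1 : R) (fun v : R => v ^+ 2 + e ^+ 2) (2 * u).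
  apply: is_derive_eq; rewrite addr0 [u%:A]mulr1; ring.
have h2 := is_derive1_sqrt (smooth_abs_arg_gt0 u).
have := @is_derive1_comp R Num.sqrt (fun v : R => v ^+ 2 + e ^+ 2) u _ _ h2 h1.
rewrite (_ : _^-1 * (2 * u) = smooth_sg u)//.
by rewrite /smooth_sg /smooth_abs; field; rewrite gt_eqF// smooth_abs_gt0.
Qed.

Lemma smooth_sg_le1 u : `|smooth_sg u| <= 1.
Proof.
rewrite normrM normfV (gtr0_norm (smooth_abs_gt0 u)) ler_pdivrMr ?smooth_abs_gt0// mul1r.
exact: norm_le_smooth_abs.
Qed.

Lemma smooth_abs_lipschitz u v : `|smooth_abs u - smooth_abs v| <= `|u - v|.
Proof.
have s0 : 0 < smooth_abs u + smooth_abs v by rewrite addr_gt0 ?smooth_abs_gt0.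
rewrite -(ler_pM2r s0).
have -> : `|smooth_abs u - smooth_abs v| * (smooth_abs u + smooth_abs v) =
    `|u - v| * `|u + v|.
  rewrite -[X in _ * X = _]gtr0_norm// -!normrM -!subr_sqr !smooth_abs_sqr.
  by congr `|_|; ring.
apply: ler_wpM2l => //; apply: le_trans (ler_normD _ _) _.
by apply: lerD; exact: norm_le_smooth_abs.
Qed.

Lemma continuous_smooth_abs : continuous smooth_abs.
Proof.
move=> u; apply: (@continuous_comp _ _ _ (fun v : R => v ^+ 2 + e ^+ 2) Num.sqrt).
  by apply: cvgD; [exact: exprn_continuous|exact: cvg_cst].
exact: sqrt_continuous.
Qed.

Lemma continuous_smooth_sg : continuous smooth_sg.
Proof.
move=> u; apply: cvgM; first exact: cvg_id.
apply: cvgV; first by rewrite gt_eqF// smooth_abs_gt0.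
exact: continuous_smooth_abs.
Qed.

End smooth_absolute_value.

Lemma smooth_sg_cvg (R : realType) (u : R) :
  smooth_sg n.+1%:R^-1 u @[n --> \oo] --> Num.sg u.
Proof.
have [->|u0] := eqVneq u 0.
  by rewrite sgr0; under eq_cvg do rewrite /smooth_sg mul0r; exact: cvg_cst.
have -> : Num.sg u = u / Num.sqrt (u ^+ 2 + 0 ^+ 2).
  rewrite expr0n addr0 sqrtr_sqr.
  by rewrite {2}(numEsg u) mulfK// normr_eq0.
apply: cvgM; first exact: cvg_cst.
apply: cvgV; first by rewrite expr0n addr0 sqrtr_sqr normr_eq0.
have h : u ^+ 2 + n.+1%:R^-1 ^+ 2 @[n --> \oo] --> u ^+ 2 + 0 ^+ 2.
  apply: cvgD; first exact: cvg_cst.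
  have hn := @cvg_harmonic R.
  by rewrite expr2; under eq_cvg do rewrite expr2; exact: (cvgM hn hn).
have := cvg_comp _ _ h (@sqrt_continuous R (u ^+ 2 + 0 ^+ 2)).
exact.
Qed.

Section step_functions.
Variable R : realType.

(** Approximates a path by step functions on a grid of mesh 1 / N: being built
    from the values of G at fixed times, they are jointly measurable when G
    depends on the environment. *)
Definition step_sum (G : R -> R) (N : nat) (s : R) : R :=
  \sum_(i < N) (i%:R <= s * N%:R < i.+1%:R)%R%:R * G (i%:R / N%:R).

Lemma step_sumE (G : R -> R) N s :
  (exists2 i : 'I_N, (i%:R <= s * N%:R < i.+1%:R) & step_sum G N s = G (i%:R / N%:R)) \/
  (step_sum G N s = 0 /\ forall i : 'I_N, ~ (i%:R <= s * N%:R < i.+1%:R)).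
Proof.
case: (pickP (fun i : 'I_N => i%:R <= s * N%:R < i.+1%:R)) => [i si|none]; [left|right].
  exists i => //; rewrite /step_sum (bigD1 i)//= si mul1r big1 ?addr0// => j ji.
  case: (boolP (_ <= _ < _)) => [/andP[j1 j2]|_]; last by rewrite mul0r.
  move: ji => /eqP; case; apply/val_inj; move/andP: si => [i1 i2].
  have ji : (j < i.+1)%N by rewrite -(ltr_nat R); exact: le_lt_trans j1 i2.
  have ij : (i < j.+1)%N by rewrite -(ltr_nat R); exact: le_lt_trans i1 j2.
  by apply/eqP; rewrite eqn_leq -ltnS ji.
split; first by rewrite /step_sum big1// => i _; rewrite none mul0r.
by move=> i; rewrite none.
Qed.

Lemma step_sum_bound (G : R -> R) N s : (forall x, `|G x| <= 1) -> `|step_sum G N s| <= 1.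
Proof.
by move=> G1; case: (step_sumE G N s) => [[i _ ->]|[-> _]]; rewrite ?normr0.
Qed.

Lemma step_sum_cvg (G : R -> R) s : 0 <= s < 1 -> {for s, continuous G} ->
  step_sum G N s @[N --> \oo] --> G s.
Proof.
move=> /andP[s0 s1] cG; apply/cvgrPdist_lt => eps eps0.
have /cvgrPdist_lt/(_ _ eps0)[d /= d0 hd] := cG.
near=> N.
have N0 : (0 < N)%N by near: N; exact: nbhs_infty_gt.
have N0' : (0 : R) < N%:R by rewrite ltr0n.
case: (step_sumE G N s) => [[i /andP[i1 i2] ->]|[_ none]]; last first.
  exfalso; pose i := Num.truncn (s * N%:R).
  have /andP[i1 i2] : i%:R <= s * N%:R < i.+1%:R.
    by apply: truncn_itv; rewrite mulr_ge0.
  have iN : (i < N)%N.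
    by rewrite -(ltr_nat R); apply: le_lt_trans i1 _; rewrite gtr_pMl.
  by apply: (none (Ordinal iN)); rewrite i1 i2.
apply: hd => /=.
rewrite ger0_norm; last by rewrite subr_ge0 ler_pdivrMr.
rewrite ltrBlDr -ltrBlDl ltr_pdivlMr//.
rewrite mulrBl ltrBlDr; apply: lt_le_trans i2 _; rewrite -natr1 lerD2l.
rewrite mulrC -ler_pdivrMr//.
by near: N; exact: nbhs_infty_ger.
Unshelve. all: by end_near. Qed.

End step_functions.

(** * Balance of signs and monotonicity of the field *)

Lemma E_ae_eq d (T : measurableType d) (R : realType) (P : probability T R)
    (f g : T -> R) : integ P f -> integ P g -> {ae P, forall w, f w = g w} ->
  \int[P]_w f w = \int[P]_w g w.
Proof.
move=> fi gi fg; congr fine; apply: ae_eq_integral => //.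
- exact: (measurable_int P fi).
- exact: (measurable_int P gi).
- by apply: filterS fg => w ->.
Qed.

Section sign_balance.
Variables (R : realType) (P : probability (env R) R) (Phi0 : env R -> int -> R).
Implicit Types (w : env R) (t s : R) (x : int).
Local Notation leb := (@lebesgue_measure R).
Local Notation Phi w t x := (space_time_field Phi0 w t x).
Local Notation d := (increment Phi0).
Local Notation g := (flux Phi0).

Hypothesis stP : stationary P.
Hypothesis cov : L2cov P Phi0.
Hypothesis time_int : well_defined_time_integral P Phi0.
Hypothesis backward : backward_equation P Phi0.
Hypothesis P_mean : forall (t : R) (e : edge),
  ('E_P[(fun w => conductance w t e)] < +oo)%E.
Hypothesis P_mean_inv : forall (t : R) (e : edge),
  ('E_P[(fun w => (conductance w t e)^-1)%R] < +oo)%E.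

(** Minus the time derivative of the increment, by ae_derivative. *)
Definition flux_laplacian w : R :=
  g (env_shift 0 1 w) - 2 * g w + g (env_shift 0 (-1) w).

Lemma integ_flux_laplacian : integ P flux_laplacian.
Proof.
have [_ ig] := integ_increment_flux cov P_mean P_mean_inv.
have is_ x : integ P (fun w => g (env_shift 0 x w)) := mp_integ (stationary_mp 0 x stP) ig.
exact: (integD (integB (is_ 1) (integZ 2 ig)) (is_ (-1))).
Qed.

Section smooth.
Variable e : R.
Hypothesis e0 : 0 < e.

Lemma measurable_smooth_sg : measurable_fun setT (smooth_sg e).
Proof. by apply: continuous_measurable_fun; exact: continuous_smooth_sg. Qed.

Definition sg_path w s : R := smooth_sg e (d (env_shift s 0 w)).

(** An upper limit of jointly measurable step functions, equal to sg_path wherever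
    that path is continuous. *)
Definition sg_version (z : R * env R) : R :=
  limn_sup (fun N => step_sum (sg_path z.2) N z.1).

Lemma measurable_sg_version : measurable_fun setT sg_version.
Proof.
have b z N : `|step_sum (sg_path z.2) N z.1| <= 1.
  by apply: step_sum_bound => x; exact: smooth_sg_le1.
apply: (@measurable_fun_limn_sup _ _ _ _ (fun N (z : R * env R) => step_sum (sg_path z.2) N z.1)).
- by move=> z _; exists 1 => _ [N _ <-]; apply: le_trans (ler_norm _) (b _ _).
- by move=> z _; exists (-1) => _ [N _ <-]; have := b z N; rewrite ler_norml => /andP[].
move=> N; apply: measurable_sum => i; apply: measurable_funM.
  have -> : (fun z : R * env R => (i%:R <= z.1 * N%:R < i.+1%:R)%R%:R) =
      (\1_((fun s : R => s * N%:R) @^-1` [set` `[i%:R, i.+1%:R[]) : R -> R) \o fst.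
    apply/funext => z /=; rewrite indicE; congr ((nat_of_bool _)%:R).
    by apply/idP/idP; rewrite inE /= in_itv.
  apply: measurableT_comp; last exact: measurable_fst.
  apply/measurable_indicP; rewrite -[X in measurable X]setTI.
  by apply: measurable_funM.
rewrite /sg_path.
apply: (measurableT_comp measurable_smooth_sg).
apply: (measurableT_comp (measurable_increment cov)).
by apply: measurableT_comp; [exact: measurable_env_shift|exact: measurable_snd].
Qed.

Lemma ae_sg_version : {ae P, forall w, forall s, 0 < s < 1 -> sg_version (s, w) = sg_path w s}.
Proof.
apply: filterS (ae_locally_ac backward) => w ac s s01.
have acd : locally_ac (fun t => d (env_shift t 0 w)).
  have -> : (fun t => d (env_shift t 0 w)) = (fun t => Phi w t 1 - Phi w t 0).
    by apply/funext => t; rewrite field_difference_origin.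
  exact: locally_acB.
rewrite /sg_version /=.
suff : step_sum (sg_path w) N s @[N --> \oo] --> sg_path w s.
  by move/cvg_limn_inf_sup => [].
apply: step_sum_cvg; first by case/andP: s01 => /ltW ->.
apply: (@continuous_comp _ _ _ (fun t => d (env_shift t 0 w)) (smooth_sg e)).
  apply/cvgrPdist_lt => eps eps0; have [dl dl0 hd] := locally_ac_continuous s acd eps0.
  by exists dl => // t /= ts; rewrite distrC; apply: hd; rewrite distrC.
exact: continuous_smooth_sg.
Qed.

(** By stationarity the mean of smooth_abs at the increment is the same at times 0
    and 1. By ac_FTC and Fubini its change is minus the mean of smooth_sg at the
    increment times flux_laplacian. *)
Lemma smooth_sign_balance : \int[P]_w (smooth_sg e (d w) * flux_laplacian w) = 0.
Proof.
have [id_ ig] := integ_increment_flux cov P_mean P_mean_inv.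
have [J [mJ Jfix Jpath]] := flux_representative stP time_int.
pose K z := sg_version z *
  (J (z.1, env_shift 0 1 z.2) - 2 * J z + J (z.1, env_shift 0 (-1) z.2)).
have mKx x : measurable_fun setT (fun z : R * env R => J (z.1, env_shift 0 x z.2)).
  apply: measurableT_comp => //; apply: measurable_fun_pair; first exact: measurable_fst.
  by apply: measurableT_comp; [exact: measurable_env_shift|exact: measurable_snd].
have mK : measurable_fun setT K.
  apply: measurable_funM; first exact: measurable_sg_version.
  by apply: measurable_funD => //; apply: measurable_funB => //; exact: measurable_funM.
pose kap w := smooth_sg e (d w) * flux_laplacian w.
have mkap : measurable_fun setT kap.
  apply: measurable_funM; last exact: integ_measurable integ_flux_laplacian.
  by apply: (measurableT_comp measurable_smooth_sg); exact: measurable_increment cov.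
have ikap : integ P kap.
  apply: (integ_le mkap (integ_norm integ_flux_laplacian)) => w.
  by rewrite /kap normrM ler_piMl// smooth_sg_le1.
have Kk : {ae leb, forall s, 0 < s < 1 -> {ae P, forall w, K (s, w) = kap (env_shift s 0 w)}}.
  apply: (@filterS _ _ (ae_filter_ringOfSetsType leb) _ _ _ Jfix) => s Js s01.
  have J1 x := mp_ae (stationary_mp 0 x stP) Js.
  near=> w.
  have hs : sg_version (s, w) = sg_path w s.
    by have := near ae_sg_version w; apply.
  have j0 : g (env_shift s 0 w) = J (s, w) by near: w.
  have j1 : g (env_shift s 0 (env_shift 0 1 w)) = J (s, env_shift 0 1 w) by near: w; exact: J1.
  have j2 : g (env_shift s 0 (env_shift 0 (-1) w)) = J (s, env_shift 0 (-1) w).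
    by near: w; exact: J1.
  rewrite /K /kap hs /sg_path /flux_laplacian -j0 -j1 -j2 !env_shiftD.
  by rewrite !addr0 !add0r.
have [Kint iK EK] := stationary_field_fubini stP mK ikap Kk.
rewrite -/kap -EK.
pose th w := smooth_abs e (d w).
have ith : integ P th.
  apply: (integ_le (g := fun w => `|d w| + e)).
  - apply: measurableT_comp; last exact: measurable_increment cov.
    by apply: continuous_measurable_fun; exact: continuous_smooth_abs.
  - by apply: integD; [exact: integ_norm|exact: integ_cst].
  - by move=> w; rewrite gtr0_norm ?smooth_abs_gt0//; exact: smooth_abs_le.
have Kth : {ae P, forall w, \int[leb]_(s in `[0, 1]) K (s, w) = th w - th (env_shift 1 0 w)}.
  near=> w.
  have ac : forall x, locally_ac (fun t => Phi w t x) by near: w; exact: ae_locally_ac.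
  have hs : forall s, 0 < s < 1 -> sg_version (s, w) = sg_path w s.
    by near: w; exact: ae_sg_version.
  have dw : forall x, {ae leb, forall t, is_derive t 1 (fun s => Phi w s x)
      (- (g (env_shift t x w) - g (env_shift t (x - 1) w)))}.
    by near: w; exact: ae_derivative.
  have jw : forall k y, {ae leb, forall s, g (env_shift (s + k%:R) y w) = J (s, lattice_shift k y w)}.
    by near: w.
  have Kw : leb.-integrable `[0, 1] (EFin \o (fun s => K (s, w))) by near: w.
  pose D s := d (env_shift s 0 w).
  have DE : D = (fun t => Phi w t 1 - Phi w t 0).
    by apply/funext => t; rewrite field_difference_origin.
  have acD : locally_ac D by rewrite DE; exact: locally_acB.
  have acf : locally_ac (fun s => - smooth_abs e (D s)).
    apply: (locally_ac_lipschitz _ acD (h := fun u => - smooth_abs e u)) => x y.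
    by rewrite -opprD normrN; exact: smooth_abs_lipschitz.
  rewrite -(ac_FTC ler01 (acf 0 1) Kw).
    by rewrite opprK addrC /D env_shift0.
  have FL : Filter (nbhs (almost_everywhere leb)) by exact: (ae_filter_ringOfSetsType leb).
  near=> s.
  move=> s01; rewrite /K hs// /sg_path -/(D s).
  have j1 : g (env_shift s 1 w) = J (s, env_shift 0 1 w).
    by rewrite -[in LHS](addr0 s); near: s; exact: (jw 0%N 1).
  have j0 : g (env_shift s 0 w) = J (s, w).
    rewrite -[w in RHS]env_shift0 -[in LHS](addr0 s); near: s; exact: (jw 0%N 0).
  have j2 : g (env_shift s (-1) w) = J (s, env_shift 0 (-1) w).
    by rewrite -[in LHS](addr0 s); near: s; exact: (jw 0%N (-1)).
  have d1 : is_derive s (1 : R) (fun s => Phi w s 1) (- (g (env_shift s 1 w) - g (env_shift s (1 - 1) w))).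
    by near: s; exact: dw.
  have d0 : is_derive s (1 : R) (fun s => Phi w s 0) (- (g (env_shift s 0 w) - g (env_shift s (0 - 1) w))).
    by near: s; exact: dw.
  rewrite subrr in d1; rewrite sub0r in d0.
  have dD : is_derive s (1 : R) D (- (g (env_shift s 1 w) - g (env_shift s 0 w))
      - - (g (env_shift s 0 w) - g (env_shift s (-1) w))).
    by rewrite DE; exact: is_deriveB.
  have da := is_deriveN (is_derive_smooth_abs e0 (D s)).
  rewrite /= -j1 -j0 -j2.
  apply: (is_derive_eq (@is_derive1_comp R (fun u => - smooth_abs e u) D s _ _ da dD)).
  by ring.
rewrite (E_ae_eq iK _ Kth); last first.
  by apply: integB => //; exact: (mp_integ (stationary_mp 1 0 stP) ith).
rewrite EB//; last exact: (mp_integ (stationary_mp 1 0 stP) ith).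
by rewrite (mp_Rintegral (stationary_mp 1 0 stP) ith) subrr.
Unshelve. all: by end_near. Qed.

End smooth.
End sign_balance.

Section positivity.
Variables (R : realType) (P : probability (env R) R) (Phi0 : env R -> int -> R).
Implicit Types (w : env R) (t s : R) (x : int).
Local Notation leb := (@lebesgue_measure R).
Local Notation Phi w t x := (space_time_field Phi0 w t x).
Local Notation d := (increment Phi0).
Local Notation g := (flux Phi0).

Hypothesis stP : stationary P.
Hypothesis cov : L2cov P Phi0.
Hypothesis pot : L2pot P (fun w x => position w x - Phi0 w x).
Hypothesis time_int : well_defined_time_integral P Phi0.
Hypothesis backward : backward_equation P Phi0.
Hypothesis P_mean : forall (t : R) (e : edge),
  ('E_P[(fun w => conductance w t e)] < +oo)%E.
Hypothesis P_mean_inv : forall (t : R) (e : edge),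
  ('E_P[(fun w => (conductance w t e)^-1)%R] < +oo)%E.

Lemma measurable_sg : measurable_fun [set: R] (@Num.sg R).
Proof.
have -> : @Num.sg R = (fun u : R => (\1_[set` `]0, +oo[] : R -> R) u - (\1_[set` `]-oo, 0[] : R -> R) u).
  apply/funext => u; rewrite !indicE.
  have -> : (u \in [set` `]0, +oo[]) = (0 < u).
    by apply/idP/idP; rewrite inE /= in_itv/= andbT.
  have -> : (u \in [set` `]-oo, 0[]) = (u < 0) by apply/idP/idP; rewrite inE /= in_itv/=.
  by case: (ltrgt0P u) => [u0|u0|->];
    rewrite ?(gtr0_sg u0) ?(ltr0_sg u0) ?sgr0 ?subr0 ?sub0r.
by apply: measurable_funB; apply/measurable_indicP; exact: measurable_itv.
Qed.

Lemma sg_mul_flux w : Num.sg (d w) * g w = `|g w|.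
Proof.
by rewrite /flux normrM (gtr0_norm (conductance_gt0 _ _ _)) mulrCA -normrEsg.
Qed.

Lemma sign_balance : \int[P]_w (Num.sg (d w) * flux_laplacian Phi0 w) = 0.
Proof.
have ilap := integ_flux_laplacian stP cov P_mean P_mean_inv.
have mlap := integ_measurable ilap; have md := measurable_increment cov.
have [] := @dominated_Rintegral _ _ R P setT
  (fun n w => smooth_sg n.+1%:R^-1 (d w) * flux_laplacian Phi0 w)
  (fun w => Num.sg (d w) * flux_laplacian Phi0 w) (fun w => `|flux_laplacian Phi0 w|) measurableT.
- move=> n; apply: measurable_funM => //.
  by apply: (measurableT_comp (measurable_smooth_sg _)) => //; rewrite invr_gt0.
- by apply: measurable_funM => //; exact: (measurableT_comp measurable_sg).
- by apply: aeW => w _; apply: cvgM; [exact: smooth_sg_cvg|exact: cvg_cst].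
- exact: integ_norm.
- apply: aeW => w n _; rewrite normrM ler_piMl//; apply: smooth_sg_le1.
  by rewrite invr_gt0.
move=> _ /cvg_lim <- //.
have z (n : nat) : \int[P]_w (smooth_sg n.+1%:R^-1 (d w) * flux_laplacian Phi0 w) = 0.
  by apply: smooth_sign_balance => //; rewrite invr_gt0.
by rewrite (_ : (fun n => _) = (fun=> 0)) ?lim_cst//; apply/funext => n; exact: z.
Qed.

Lemma sg_eq_of_alignment (a b o o' : R) : 0 < o -> 0 < o' ->
  `|o' * b| = Num.sg a * (o' * b) -> `|o * a| = Num.sg b * (o * a) -> Num.sg b = Num.sg a.
Proof.
move=> o0 o'0; rewrite !normrM (gtr0_norm o0) (gtr0_norm o'0) ![Num.sg _ * (_ * _)]mulrCA.
move/(mulfI (lt0r_neq0 o'0)) => h1 /(mulfI (lt0r_neq0 o0)) h2.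
have [a0|a0] := eqVneq a 0.
  by move: h1; rewrite a0 sgr0 mul0r => /eqP; rewrite normr_eq0 => /eqP ->; rewrite sgr0.
by apply: (mulIf a0); rewrite -h2 [LHS]normrEsg.
Qed.

(** Let d', g' be d, g one edge to the right. As sg(d) g = |g|, sign_balance and
    stationarity in space give E[sg(d) g'] + E[sg(d') g] = E|g'| + E|g|. Both
    terms on the left are at most their counterparts on the right, hence sg(d) g'
    = |g'| and sg(d') g = |g| almost surely, which forces equal signs. *)
Lemma ae_sg_neighbor : {ae P, forall w, Num.sg (d (env_shift 0 1 w)) = Num.sg (d w)}.
Proof.
have [id_ ig] := integ_increment_flux cov P_mean P_mean_inv.
have md := measurable_increment cov.
have mp x := stationary_mp 0 x stP.
have igx x : integ P (fun w => g (env_shift 0 x w)) := mp_integ (mp x) ig.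
have sg1 (u : R) : `|Num.sg u| <= 1 by rewrite normr_sg; case: (_ != _).
have msd : measurable_fun setT (fun w => Num.sg (d w)) by exact: (measurableT_comp measurable_sg).
have isg x : integ P (fun w => Num.sg (d w) * g (env_shift 0 x w)).
  apply: (integ_le _ (integ_norm (igx x))).
    by apply: measurable_funM => //; exact: integ_measurable (igx x).
  by move=> w; rewrite normrM ler_piMl.
have i2 : integ P (fun w => Num.sg (d (env_shift 0 1 w)) * g w).
  have -> : (fun w => Num.sg (d (env_shift 0 1 w)) * g w) =
      (fun w => Num.sg (d w) * g (env_shift 0 (-1) w)) \o env_shift 0 1.
    by apply/funext => w /=; rewrite env_shiftD addr0 addNr env_shift0.
  exact: (mp_integ (mp 1) (isg (-1))).
have B : \int[P]_w (Num.sg (d (env_shift 0 1 w)) * g w) =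
    \int[P]_w (Num.sg (d w) * g (env_shift 0 (-1) w)).
  rewrite -(mp_Rintegral (mp 1) (isg (-1))); apply: eq_Rintegral => w _.
  by rewrite env_shiftD addr0 addNr env_shift0.
have E0 : \int[P]_w `|g (env_shift 0 1 w)| = \int[P]_w `|g w|.
  exact: (mp_Rintegral (mp 1) (integ_norm ig)).
have bal : \int[P]_w (Num.sg (d w) * g (env_shift 0 1 w)) +
    \int[P]_w (Num.sg (d (env_shift 0 1 w)) * g w) = 2 * \int[P]_w `|g w|.
  rewrite B -EZ; last exact: integ_norm.
  have ia := integD (isg 1) (isg (-1)); have ib := integZ 2 (integ_norm ig).
  rewrite -(ED (isg 1) (isg (-1))); apply/eqP; rewrite -subr_eq0; apply/eqP.
  transitivity (\int[P]_w (Num.sg (d w) * g (env_shift 0 1 w) +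
      Num.sg (d w) * g (env_shift 0 (-1) w) - 2 * `|g w|)); first by rewrite (EB ia ib).
  rewrite -[RHS]sign_balance; apply: eq_Rintegral => w _.
  by rewrite -sg_mul_flux /flux_laplacian; ring.
pose h w := (`|g (env_shift 0 1 w)| - Num.sg (d w) * g (env_shift 0 1 w)) +
            (`|g w| - Num.sg (d (env_shift 0 1 w)) * g w).
have le1 (u v : R) : Num.sg u * v <= `|v|.
  by apply: le_trans (ler_norm _) _; rewrite normrM ler_piMl.
have i3 := integB (integ_norm (igx 1)) (isg 1).
have i4 := integB (integ_norm ig) i2.
have : {ae P, forall w, h w = 0}.
  apply: E_eq0; first exact: integD.
    by move=> w; rewrite /h addr_ge0// subr_ge0.
  rewrite /h (ED i3 i4) (EB (integ_norm (igx 1)) (isg 1)) (EB (integ_norm ig) i2).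
  by rewrite E0; move: bal; lra.
apply: filterS => w hw.
have h1 : 0 <= `|g (env_shift 0 1 w)| - Num.sg (d w) * g (env_shift 0 1 w) by rewrite subr_ge0.
have h2 : 0 <= `|g w| - Num.sg (d (env_shift 0 1 w)) * g w by rewrite subr_ge0.
apply: (@sg_eq_of_alignment _ _ (conductance w 0 0) (conductance (env_shift 0 1 w) 0 0));
  rewrite ?conductance_gt0//.
- by move: hw; rewrite /h /flux => hw; apply/eqP; rewrite -subr_eq0; apply/eqP; move: h1 h2; rewrite /flux; lra.
- by move: hw; rewrite /h /flux => hw; apply/eqP; rewrite -subr_eq0; apply/eqP; move: h1 h2; rewrite /flux; lra.
Qed.

(** All increments along the line have the same sign. If they were not positive,
    Phi0 w would be nonpositive on the positive half-line, where it grows like x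
    by potential_sublinear. *)
Lemma ae_increment_gt0 : {ae P, forall w, 0 < d w}.
Proof.
have [_ coc _] := cov.
have half : (0 : R) < 2^-1 by rewrite invr_gt0.
have sub := potential_sublinear stP P_mean_inv pot half.
near=> w.
have cw : forall x y, Phi0 (env_shift 0 x w) (y - x) = Phi0 w y - Phi0 w x by near: w.
have nb : forall k y, Num.sg (d (env_shift 0 1 (lattice_shift k y w))) = Num.sg (d (lattice_shift k y w)).
  by near: w; exact: (ae_lattice stP ae_sg_neighbor).
have [N hN] : exists N : nat, forall n x, (N <= n)%N -> `|x| <= n%:Z ->
    `|position w x - Phi0 w x| <= 2^-1 * n%:R by near: w.
have sgn (n : nat) : Num.sg (d (env_shift 0 n%:Z w)) = Num.sg (d w).
  elim: n => [|n IH]; first by rewrite env_shift0.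
  rewrite -IH; have := nb 0%N n%:Z; rewrite /lattice_shift env_shiftD add0r => <-.
  by congr (Num.sg (d (env_shift _ _ _))); lia.
have step (n : nat) : Phi0 w n.+1%:Z - Phi0 w n%:Z = d (env_shift 0 n%:Z w).
  rewrite /increment (cocycle0 cw) subr0 -cw; congr (Phi0 _ _); lia.
have P00 : Phi0 w 0 = 0 by have := cocycle0 cw 0; rewrite env_shift0.
rewrite ltNge; apply/negP => d0.
have neg (n : nat) : Phi0 w n%:Z <= 0.
  elim: n => [|n IH]; first by rewrite P00.
  have : d (env_shift 0 n%:Z w) <= 0 by rewrite -sgr_le0 sgn sgr_le0.
  by rewrite -step; move: IH; lra.
have := hN N.+1 N.+1%:Z (leqnSn _) (lexx _); have := neg N.+1.
rewrite /position ler_norml => h1 /andP[_]; rewrite -[N.+1%:Z%:~R]/(N.+1%:R).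
have : (0 : R) < N.+1%:R by rewrite ltr0n.
lra.
Unshelve. all: by end_near. Qed.

(** Positivity at rational times passes to all times as a weak inequality. *)
Lemma ae_field_monotone : {ae P, forall w, forall t x, Phi w t x <= Phi w t (x + 1)}.
Proof.
apply: filterS3 (ae_increment stP cov backward) (ae_rational stP ae_increment_gt0)
  (ae_locally_ac backward) => w incw pos ac t x.
rewrite -subr_ge0; move: t; apply: locally_ac_ge0_rat; first exact: locally_acB.
by move=> q; rewrite incw ltW.
Qed.

End positivity.

(** * From block averages to values *)

Section block_comparison.
Variable R : realType.
Implicit Types (F V : int -> R) (m n : nat) (x y z : int).

Lemma sum_backward_difference V m y :
  \sum_(i < m) (V (y + i%:Z + 1) - V (y + i%:Z)) = V (y + m%:Z) - V y.
Proof.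
elim: m => [|m IH]; first by rewrite big_ord0 addr0 subrr.
rewrite big_ord_recr/= IH (_ : y + m.+1%:Z = y + m%:Z + 1); first by ring.
by rewrite -addn1 PoszD addrA.
Qed.

(** Summing a discrete divergence over a window leaves two boundary terms; summing
    these over a second window leaves the difference of two adjacent windows. *)
Lemma iterated_block_sum F0 F1 V m y :
  (forall x, F1 x - F0 x = - (V x - V (x - 1))) ->
  \sum_(j < m) \sum_(i < m) (F1 (y + 1 + j%:Z + i%:Z) - F0 (y + 1 + j%:Z + i%:Z)) =
  - \sum_(j < m) (V (y + m%:Z + j%:Z) - V (y + j%:Z)).
Proof.
move=> FV; rewrite -sumrN; apply: eq_bigr => j _.
rewrite (_ : y + m%:Z + j%:Z = y + j%:Z + m%:Z); last by rewrite addrAC.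
rewrite -sum_backward_difference -sumrN; apply: eq_bigr => i _.
by rewrite FV; congr (- (V _ - V _)); ring.
Qed.

Lemma sum_square_const (m : nat) (c : R) : \sum_(j < m) \sum_(i < m) c = m%:R ^+ 2 * c.
Proof. by rewrite !sumr_const !card_ord -mulrnA mulnn -natrX mulr_natl. Qed.

Lemma square_index_bounds x (m : nat) (n : nat) (i j : 'I_m) : `|x| <= n%:Z -> (m <= n)%N ->
  [/\ `|x + 1 + j%:Z + i%:Z| <= (3 * n)%N%:Z, `|x - (2 * m)%N%:Z + 1 + j%:Z + i%:Z| <= (3 * n)%N%:Z,
      x <= x + 1 + j%:Z + i%:Z <= x + (2 * m)%N%:Z &
      x - (2 * m)%N%:Z <= x - (2 * m)%N%:Z + 1 + j%:Z + i%:Z <= x].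
Proof.
case: i j => i im [j jm] /=; move=> xn mn; split; lia.
Qed.

(** By monotonicity, F1 x lies between the averages of F1 over the m by m windows
    to its left and to its right. These averages differ by at most L / m^2 from
    those of F0, which is within B of the identity, over points at distance at
    most 2 m from x. *)
Lemma monotone_block_bound F0 F1 V (m n : nat) x (B L : R) :
  (0 < m)%N -> (m <= n)%N -> `|x| <= n%:Z ->
  (forall z z', z <= z' -> F1 z <= F1 z') ->
  (forall z, F1 z - F0 z = - (V z - V (z - 1))) ->
  (forall z, `|z| <= (3 * n)%N%:Z -> `|z%:~R - F0 z| <= B) ->
  (forall y, - (3 * n)%N%:Z <= y <= (3 * n)%N%:Z ->
     `|\sum_(j < m) (V (y + m%:Z + j%:Z) - V (y + j%:Z))| <= L) ->
  `|x%:~R - F1 x| <= 2 * m%:R + B + L / m%:R ^+ 2.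
Proof.
move=> m0 mn xn mono FV F0B VL.
have m2 : (0 : R) < m%:R ^+ 2 by rewrite exprn_gt0// ltr0n.
have idx (i j : 'I_m) := square_index_bounds i j xn mn.
have x1 : - (3 * n)%N%:Z <= x <= (3 * n)%N%:Z by clear -xn; lia.
have x2 : - (3 * n)%N%:Z <= x - (2 * m)%N%:Z <= (3 * n)%N%:Z by clear -xn mn; lia.
have block y : let S (F : int -> R) := \sum_(j < m) \sum_(i < m) F (y + 1 + j%:Z + i%:Z) in
    - (3 * n)%N%:Z <= y <= (3 * n)%N%:Z -> `|S F1 - S F0| <= L.
  move=> S yn; rewrite /S -sumrB (eq_bigr (fun j : 'I_m =>
    \sum_(i < m) (F1 (y + 1 + j%:Z + i%:Z) - F0 (y + 1 + j%:Z + i%:Z)))); last first.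
    by move=> j _; rewrite sumrB.
  by rewrite (iterated_block_sum _ _ FV) normrN; exact: VL.
have bd z : `|z| <= (3 * n)%N%:Z -> F0 z <= z%:~R + B /\ z%:~R - B <= F0 z.
  by move=> /F0B; rewrite ler_norml => /andP[? ?]; split; lra.
have up : m%:R ^+ 2 * F1 x <= m%:R ^+ 2 * (x%:~R + 2 * m%:R + B) + L.
  have := block _ x1; rewrite ler_norml => /andP[_].
  set S1 := \sum_(j < m) _; set S0 := \sum_(j < m) _.
  have h1 : m%:R ^+ 2 * F1 x <= S1.
    rewrite -sum_square_const; apply: ler_sum => j _; apply: ler_sum => i _.
    by apply: mono; have [_ _ /andP[? ?] /andP[? ?]] := idx i j.
  have h0 : S0 <= m%:R ^+ 2 * (x%:~R + 2 * m%:R + B).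
    rewrite -sum_square_const; apply: ler_sum => j _; apply: ler_sum => i _.
    have [z3 _ /andP[_ zx] _] := idx i j; have [F0z _] := bd _ z3.
    apply: le_trans F0z _; rewrite lerD2r; move: zx; rewrite -(ler_int R) [in X in _ <= X -> _]intrD.
    by rewrite -[(2 * m)%N%:Z%:~R]/((2 * m)%N%:R) natrM.
  by move=> h; lra.
have lo : m%:R ^+ 2 * (x%:~R - 2 * m%:R - B) - L <= m%:R ^+ 2 * F1 x.
  have := block _ x2; rewrite ler_norml => /andP[+ _].
  set S1 := \sum_(j < m) _; set S0 := \sum_(j < m) _.
  have h1 : S1 <= m%:R ^+ 2 * F1 x.
    rewrite -sum_square_const; apply: ler_sum => j _; apply: ler_sum => i _.
    by apply: mono; have [_ _ /andP[? ?] /andP[? ?]] := idx i j.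
  have h0 : m%:R ^+ 2 * (x%:~R - 2 * m%:R - B) <= S0.
    rewrite -sum_square_const; apply: ler_sum => j _; apply: ler_sum => i _.
    have [_ z3 _ /andP[zx _]] := idx i j; have [_ F0z] := bd _ z3.
    apply: le_trans F0z; rewrite lerD2r; move: zx; rewrite -(ler_int R) [in X in X <= _ -> _]intrB.
    by rewrite -[(2 * m)%N%:Z%:~R]/((2 * m)%N%:R) natrM.
  by move=> h; lra.
have e : m%:R ^+ 2 * (L / m%:R ^+ 2) = L by rewrite mulrCA mulfV ?mulr1// gt_eqF.
rewrite ler_norml; apply/andP; split; rewrite -(ler_pM2l m2).
  by rewrite mulrN !mulrDr mulrN e; move: up; rewrite !mulrDr; lra.
by rewrite !mulrDr mulrN e; move: lo; rewrite !mulrDr !mulrN; lra.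
Qed.

End block_comparison.

(** * Flux through an edge over time *)

Section corrector_bound.
Variables (R : realType) (P : probability (env R) R) (Phi0 : env R -> int -> R).
Implicit Types (w : env R) (t s : R) (x : int).
Local Notation leb := (@lebesgue_measure R).
Local Notation Phi w t x := (space_time_field Phi0 w t x).
Local Notation d := (increment Phi0).
Local Notation g := (flux Phi0).

(** Meant for J a jointly measurable version of the flux. *)
Definition cumulated_flux (J : R * env R -> R) w (r : R) : R :=
  \int[leb]_(s in `[0, r]) J (s, w).

Hypothesis stP : stationary P.
Hypothesis cov : L2cov P Phi0.
Hypothesis pot : L2pot P (fun w x => position w x - Phi0 w x).
Hypothesis time_int : well_defined_time_integral P Phi0.
Hypothesis backward : backward_equation P Phi0.
Hypothesis P_mean : forall (t : R) (e : edge),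
  ('E_P[(fun w => conductance w t e)] < +oo)%E.
Hypothesis P_mean_inv : forall (t : R) (e : edge),
  ('E_P[(fun w => (conductance w t e)^-1)%R] < +oo)%E.

Lemma is_derive_shift_arg (f : R -> R) (c t l : R) :
  is_derive (t + c) 1 f l -> is_derive t 1 (fun s => f (s + c)) l.
Proof.
move=> df.
have dh : is_derive t (1 : R) (fun s : R => s + c) 1.
  by rewrite -[X in is_derive _ _ _ X]addr0; exact: is_deriveD.
have := @is_derive1_comp R f (fun s => s + c) t l 1 df dh.
by rewrite mulr1.
Qed.

Lemma cumulated_flux_bounds (J : R * env R -> R) w (r : R) : 0 <= r <= 1 ->
  leb.-integrable `[0, 1] (EFin \o (fun s => J (s, w))) -> {ae leb, forall s, 0 <= J (s, w)} ->
  0 <= cumulated_flux J w r <= cumulated_flux J w 1.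
Proof.
move=> /andP[r0 r1] iJ J0.
have sub : [set` `[0, r]] `<=` [set` `[0, (1 : R)]].
  by move=> s /=; rewrite !in_itv/= => /andP[-> sr]; exact: (le_trans sr).
have ir : leb.-integrable `[0, r] (EFin \o (fun s => J (s, w))) by apply: integrableS iJ.
have FL : Filter (nbhs (almost_everywhere leb)) by exact: (ae_filter_ringOfSetsType leb).
have J0' : ae_eq leb setT (fun s => (J (s, w))%:E) (fun s => `|J (s, w)|%:E).
  by apply: filterS J0 => s s0 _; rewrite ger0_norm.
have e (a : R) : leb.-integrable `[0, a] (EFin \o (fun s => J (s, w))) ->
    cumulated_flux J w a = \int[leb]_(s in `[0, a]) `|J (s, w)|.
  move=> ia; rewrite /cumulated_flux /Rintegral; congr fine; apply: ae_eq_integral => //.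
  - exact: (measurable_int _ ia).
  - by case/integrableP: (integrable_norm ia).
  - by apply: filterS J0' => s h _; exact: h.
rewrite !e//; apply/andP; split; first exact: Rintegral_ge0.
have fn (a : R) : leb.-integrable `[0, a] (EFin \o (fun s => J (s, w))) ->
    (\int[leb]_(s in `[0%R, a]) (`|J (s, w)|%R)%:E)%E \is a fin_num.
  move=> ia; apply: integrable_fin_num => //.
  exact: (integrable_norm ia).
rewrite /Rintegral fine_le ?fn//.
apply: ge0_subset_integral => //.
by case/integrableP: (integrable_norm iJ).
Qed.

(** Integrate ae_derivative over the time interval from k to k + r. The bounds
    hold because the flux is nonnegative, the field being nondecreasing in space. *)
Lemma ae_unit_step : exists J : R * env R -> R,
  integ P (fun w => cumulated_flux J w 1) /\
  {ae P, forall w, forall (k : nat) x r, 0 <= r <= 1 ->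
    Phi w (r + k%:R) x - Phi w k%:R x =
      - (cumulated_flux J (lattice_shift k x w) r -
         cumulated_flux J (lattice_shift k (x - 1) w) r) /\
    0 <= cumulated_flux J (lattice_shift k x w) r
      <= cumulated_flux J (lattice_shift k x w) 1}.
Proof.
have [J [mJ Jfix Jpath]] := flux_representative stP time_int.
have [_ ig] := integ_increment_flux cov P_mean P_mean_inv.
have [|iJ ia _] := stationary_field_fubini stP mJ ig.
  by apply: (@filterS _ _ (ae_filter_ringOfSetsType leb) _ _ _ Jfix) => s Js _;
    apply: filterS Js => w ->.
exists J; split => //.
near=> w.
have incw : forall x t, Phi w t (x + 1) - Phi w t x = d (env_shift t x w).
  by near: w; exact: ae_increment.
have mono : forall t x, Phi w t x <= Phi w t (x + 1) by near: w; exact: ae_field_monotone.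
have acw : forall x, locally_ac (fun t => Phi w t x) by near: w; exact: ae_locally_ac.
have dw : forall x, {ae leb, forall t, is_derive t 1 (fun s => Phi w s x)
    (- (g (env_shift t x w) - g (env_shift t (x - 1) w)))} by near: w; exact: ae_derivative.
have Jw : forall k y, {ae leb, forall s, g (env_shift (s + k%:R) y w) = J (s, lattice_shift k y w)}.
  by near: w.
have iw : forall k y, leb.-integrable `[0, 1] (EFin \o (fun s => J (s, lattice_shift k y w))).
  by near: w; exact: (ae_lattice stP iJ).
have FL : Filter (nbhs (almost_everywhere leb)) by exact: (ae_filter_ringOfSetsType leb).
have J0 k y : {ae leb, forall s, 0 <= J (s, lattice_shift k y w)}.
  apply: filterS (Jw k y) => s <-; rewrite mulr_ge0//; first by rewrite ltW// conductance_gt0.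
  by rewrite -incw subr_ge0.
move=> k x r r01; split; last exact: cumulated_flux_bounds.
have /andP[r0 r1] := r01.
have sub : [set` `[0, r]] `<=` [set` `[0, (1 : R)]].
  by move=> s /=; rewrite !in_itv/= => /andP[-> sr]; exact: (le_trans sr).
have ir y : leb.-integrable `[0, r] (EFin \o (fun s => J (s, lattice_shift k y w))).
  by apply: integrableS (iw k y).
have -> : Phi w k%:R x = Phi w (0 + k%:R) x by rewrite add0r.
rewrite (@ac_FTC _ 0 r (fun s => Phi w (s + k%:R) x)
  (fun s => J (s, lattice_shift k (x - 1) w) - J (s, lattice_shift k x w)) r0).
- by rewrite /cumulated_flux RintegralB// opprB.
- exact: (locally_ac_shift k%:R (acw x)).
- exact: (integrableB _ (ir (x - 1)) (ir x)).
- have dwk := ae_lebesgue_shift k%:R (dw x).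
  apply: filterS3 dwk (Jw k x) (Jw k (x - 1)) => s ds <- <- _.
  rewrite -opprB; exact: is_derive_shift_arg.
Unshelve. all: by end_near. Qed.

Lemma ae_time_increment : exists J : R * env R -> R,
  integ P (fun w => cumulated_flux J w 1) /\
  {ae P, forall w, forall (k : nat) x r, 0 <= r <= 1 ->
    let V x := \sum_(j < k) cumulated_flux J (lattice_shift j x w) 1 +
      cumulated_flux J (lattice_shift k x w) r in
    Phi w (r + k%:R) x - Phi w 0 x = - (V x - V (x - 1)) /\
    `|cumulated_flux J (lattice_shift k x w) r| <=
    `|cumulated_flux J (lattice_shift k x w) 1|}.
Proof.
have [J [iJ H]] := ae_unit_step; exists J; split => //.
apply: filterS H => w Hw k x r r01; have [e /andP[a0 a1]] := Hw k x r r01.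
split; last by rewrite !ger0_norm// (le_trans a0).
have tel (j : nat) : Phi w j%:R x - Phi w 0 x =
    - (\sum_(i < j) cumulated_flux J (lattice_shift i x w) 1 -
       \sum_(i < j) cumulated_flux J (lattice_shift i (x - 1) w) 1).
  elim: j => [|j IH]; first by rewrite !big_ord0 !subrr oppr0.
  rewrite !big_ord_recr/=; have [|ej _] := Hw j x 1; first by rewrite ler01 lexx.
  by move: IH ej; rewrite -natr1 [1 + _]addrC; lra.
by move: (tel k) e; lra.
Qed.

End corrector_bound.

(** * The corrector in a parabolic box *)

Lemma block_side_le (n q : nat) : (1 < q)%N -> (1 < n)%N -> ((n %/ q).+1 <= n)%N.
Proof.
move=> q1 n1; have h := leq_trunc_div n q.
have : (n %/ q * 2 <= n)%N by apply: leq_trans h; rewrite leq_mul2l q1 orbT.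
by move: (n %/ q)%N => X h'; clear h; lia.
Qed.

(** Order of choices: first q large, so that the window length m, about n / q, is
    a small multiple of n; then the precision 1 / (j + 1) small with respect to 1
    / q^2, since n^3 / m^2 <= q^2 n. *)
Lemma block_error_small (R : realType) (eps : R) : 0 < eps ->
  exists q j N : nat, forall n : nat, (N <= n)%N ->
    let m := (n %/ q).+1 in
    (0 < n)%N /\ (m <= n)%N /\
    2 * m%:R + j.+1%:R^-1 * (3 * n)%N%:R + (2 * (j.+1%:R^-1 * n%:R ^+ 3)) / m%:R ^+ 2 <= eps * n%:R.
Proof.
move=> eps0; have [q0 hq0] := exists_natr_ge (8 / eps).
pose q := q0.+2.
have q0' : (0 : R) < q%:R by rewrite ltr0n.
have hq : 8 <= eps * q%:R.
  rewrite -ler_pdivrMl// mulrC; apply: le_trans hq0 _; rewrite ler_nat /q; lia.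
have [j hj] := exists_natr_ge (12 / eps + 8 * q%:R ^+ 2 / eps).
have j0 : (0 : R) < j.+1%:R by rewrite ltr0n.
have c1 : 0 <= 12 / eps by rewrite divr_ge0// ltW.
have c2 : 0 <= 8 * q%:R ^+ 2 / eps by rewrite divr_ge0 ?mulr_ge0 ?sqr_ge0// ltW.
have hj' : 12 / eps + 8 * q%:R ^+ 2 / eps <= j.+1%:R by apply: le_trans hj _; rewrite ler_nat.
have j1 : 12 * j.+1%:R^-1 <= eps.
  by rewrite ler_pdivrMr// [leRHS]mulrC -ler_pdivrMr//; lra.
have j2 : 8 * q%:R ^+ 2 * j.+1%:R^-1 <= eps.
  by rewrite ler_pdivrMr// [leRHS]mulrC -ler_pdivrMr//; lra.
exists q, j, q => n qn m.
have n0 : (1 < n)%N by apply: leq_trans qn.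
have n0' : (0 : R) <= n%:R by rewrite ler0n.
split; first exact: ltnW.
split; first exact: block_side_le.
have qnR : (q%:R : R) <= n%:R by rewrite ler_nat.
have X1 : ((n %/ q)%N%:R : R) * q%:R <= n%:R by rewrite -natrM ler_nat leq_trunc_div.
have X2 : (n%:R : R) <= m%:R * q%:R by rewrite -natrM ler_nat ltnW// ltn_ceil.
have m0 : (0 : R) < m%:R by rewrite ltr0n.
have t1 : 2 * m%:R <= eps / 2 * n%:R.
  rewrite /m -natr1; set X := (n %/ q)%N%:R in X1 *.
  have X0 : 0 <= X by rewrite ler0n.
  have a1 : X * 8 <= X * (eps * q%:R) by rewrite ler_wpM2l.
  have a2 : eps * (X * q%:R) <= eps * n%:R by rewrite ler_wpM2l// ltW.
  have a3 : eps * q%:R <= eps * n%:R by rewrite ler_wpM2l// ltW.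
  have a4 : X * (eps * q%:R) = eps * (X * q%:R) by rewrite mulrCA.
  rewrite (_ : eps / 2 * n%:R = eps * n%:R / 2); last by ring.
  by move: a1 a2 a3 hq; rewrite a4; set u := eps * (X * _); set v := eps * n%:R;
     set r := eps * q%:R; lra.
have t2 : j.+1%:R^-1 * (3 * n)%N%:R <= eps / 4 * n%:R.
  rewrite natrM mulrA ler_wpM2r//; move: j1; set i := (j.+1%:R^-1 : R); lra.
have t3 : (2 * (j.+1%:R^-1 * n%:R ^+ 3)) / m%:R ^+ 2 <= eps / 4 * n%:R.
  rewrite ler_pdivrMr ?exprn_gt0//.
  have -> : (n%:R : R) ^+ 3 = n%:R * n%:R ^+ 2 by rewrite -exprS.
  have b1 : (n%:R : R) ^+ 2 <= m%:R ^+ 2 * q%:R ^+ 2 by rewrite -exprMn lerXn2r// ?nnegrE ?mulr_ge0 ?ler0n.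
  have i0 : 0 <= (j.+1%:R^-1 : R) by rewrite invr_ge0 ler0n.
  apply: (@le_trans _ _ (2 * (j.+1%:R^-1 * (n%:R * (m%:R ^+ 2 * q%:R ^+ 2))))).
    by rewrite ler_pM2l// ler_wpM2l// ler_wpM2l.
  have -> : 2 * (j.+1%:R^-1 * (n%:R * (m%:R ^+ 2 * q%:R ^+ 2))) =
    (8 * q%:R ^+ 2 * j.+1%:R^-1) * (n%:R * m%:R ^+ 2 / 4) :> R by field; rewrite gt_eqF.
  have -> : eps / 4 * n%:R * m%:R ^+ 2 = eps * (n%:R * m%:R ^+ 2 / 4) by ring.
  by rewrite ler_wpM2r// divr_ge0// mulr_ge0// sqr_ge0.
apply: le_trans (lerD (lerD t1 t2) t3) _.
by rewrite -!mulrDl ler_wpM2r//; lra.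
Qed.

Section sublinear_corrector.
Variables (R : realType) (P : probability (env R) R) (Phi0 : env R -> int -> R).
Implicit Types (w : env R) (t s : R) (x : int).
Local Notation Phi w t x := (space_time_field Phi0 w t x).

Hypothesis stP : stationary P.
Hypothesis cov : L2cov P Phi0.
Hypothesis pot : L2pot P (fun w x => position w x - Phi0 w x).
Hypothesis time_int : well_defined_time_integral P Phi0.
Hypothesis backward : backward_equation P Phi0.
Hypothesis zero : {ae P, forall w, Phi w 0 0 = 0}.
Hypothesis P_mean : forall (t : R) (e : edge),
  ('E_P[(fun w => conductance w t e)] < +oo)%E.
Hypothesis P_mean_inv : forall (t : R) (e : edge),
  ('E_P[(fun w => (conductance w t e)^-1)%R] < +oo)%E.

Lemma homo_int (F : int -> R) : (forall x, F x <= F (x + 1)) ->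
  forall x y, x <= y -> F x <= F y.
Proof.
move=> F1 x y xy; have -> : y = x + `|y - x|%N%:Z by clear -xy; lia.
elim: `|y - x|%N => [|n IH]; first by rewrite addr0.
apply: le_trans IH _; rewrite (_ : x + n.+1%:Z = x + n%:Z + 1) ?F1//.
by rewrite -addn1 PoszD addrA.
Qed.

Lemma block_position (n m : nat) (y : int) : (m <= n)%N -> - (3 * n)%N%:Z <= y <= (3 * n)%N%:Z ->
  (- (4 * n)%N%:Z <= y <= (4 * n)%N%:Z) /\ (- (4 * n)%N%:Z <= y + m%:Z <= (4 * n)%N%:Z).
Proof. by move=> mn yn; split; lia. Qed.

(** Compare Phi(t, .) with Phi(0, .) = Phi0 by monotone_block_bound. The
    sublinearity of x - Phi0 is used on [-3 n, 3 n], since the windows around x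
    reach as far as |x| + 2 m. The fluxes through adjacent windows up to time t
    are compared by adjacent_blocks at the integer part of t. *)
Lemma ae_corrector_bound : {ae P, forall w, forall eps : R, 0 < eps ->
  exists N : nat, forall (n : nat) t x, (N <= n)%N -> 0 <= t <= n%:R ^+ 2 ->
    `|x| <= n%:Z -> (0 < n)%N /\ `|corrector Phi0 w t x| <= eps * n%:R}.
Proof.
have [J [iJ Jw]] := ae_time_increment stP cov pot time_int backward P_mean P_mean_inv.
(* the precision runs through the countable set of the 1 / (j + 1), so that one
   null set serves every eps *)
have inv0 (j : nat) : 0 < (j.+1%:R^-1 : R) by rewrite invr_gt0 ltr0n.
have subl := ae_foralln (fun j : nat => potential_sublinear stP P_mean_inv pot (inv0 j)).
have blk := ae_foralln (fun j : nat =>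
  adjacent_blocks (lattice_shift_mp stP) (@lattice_shiftD R) iJ (inv0 j)).
near=> w.
have zw : Phi w 0 0 = 0 by near: w.
have cw : forall x y, Phi0 (env_shift 0 x w) (y - x) = Phi0 w y - Phi0 w x.
  by near: w; case: cov.
have mono : forall t x, Phi w t x <= Phi w t (x + 1) by near: w; exact: ae_field_monotone.
have incr : forall (k : nat) x r, 0 <= r <= 1 ->
    let V x := \sum_(j < k) cumulated_flux J (lattice_shift j x w) 1 +
      cumulated_flux J (lattice_shift k x w) r in
    Phi w (r + k%:R) x - Phi w 0 x = - (V x - V (x - 1)) /\
    `|cumulated_flux J (lattice_shift k x w) r| <=
    `|cumulated_flux J (lattice_shift k x w) 1| by near: w.
have sublw : forall j : nat, exists N : nat, forall n x, (N <= n)%N -> `|x| <= n%:Z ->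
    `|position w x - Phi0 w x| <= j.+1%:R^-1 * n%:R by near: w.
have blkw : forall j : nat, exists N : nat, forall (n k m : nat) (y : int),
    (N <= n)%N -> (k <= n ^ 2)%N -> (m <= n)%N -> - (4 * n)%N%:Z <= y <= (4 * n)%N%:Z ->
    `|\sum_(j < k) \sum_(i < m) (cumulated_flux J (lattice_shift j (y + i%:Z) w) 1 -
        cumulated_flux J (lattice_shift j (y + m%:Z + i%:Z) w) 1)| +
    \sum_(i < m) `|cumulated_flux J (lattice_shift k (y + i%:Z) w) 1|
      <= j.+1%:R^-1 * n%:R ^+ 3 by near: w.
have Phi0E x : Phi w 0 x = Phi0 w x.
  have := field_difference Phi0 w 0 0 x; rewrite zw subr0 => ->; rewrite env_shift0.
  by have := cocycle0 cw 0; rewrite env_shift0 => ->; rewrite subr0.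
move=> eps eps0.
have [q [j [N0 HN0]]] := block_error_small eps0.
have [N1 HN1] := sublw j; have [N2 HN2] := blkw j.
exists (N0 + N1 + N2)%N => n t x Nn /andP[t0 tn] xn.
have [N0n N1n N2n] : [/\ (N0 <= n)%N, (N1 <= 3 * n)%N & (N2 <= n)%N] by clear -Nn; split; lia.
have [n0 [mn small]] := HN0 n N0n; split => //.
set m := (n %/ q).+1 in mn small.
apply: le_trans small.
(* fluxes are controlled at integer times; the remaining time r is paid for by the
   row of unit time steps that starts at k *)
pose k := Num.truncn t; pose r := t - k%:R.
have kt : (k%:R <= t < k.+1%:R) by exact: truncn_itv.
have /andP[k1 k2] := kt.
have r01 : 0 <= r <= 1.
  by rewrite /r subr_ge0 k1 lerBlDl natr1 ltW.
have kn : (k <= n ^ 2)%N by rewrite -(ler_nat R) natrX (le_trans k1).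
have tE : t = r + k%:R by rewrite /r subrK.
rewrite /corrector tE.
(* the flux that crosses the edge at y up to time t *)
pose V y := \sum_(j < k) cumulated_flux J (lattice_shift j y w) 1 +
      cumulated_flux J (lattice_shift k y w) r.
apply: (@monotone_block_bound R (fun y => Phi w 0 y) (fun y => Phi w (r + k%:R) y) V m n) => //.
- exact: homo_int.
- by move=> y; have [] := incr k y r r01.
- by move=> z zn; rewrite Phi0E; have := HN1 _ _ N1n zn.
move=> y yn; have [y1 y2] := block_position mn yn.
have b1 := HN2 n k m y N2n kn mn y1; have b2 := HN2 n k m (y + m%:Z) N2n kn mn y2.
have -> : \sum_(i < m) (V (y + m%:Z + i%:Z) - V (y + i%:Z)) =
    - \sum_(j < k) \sum_(i < m) (cumulated_flux J (lattice_shift j (y + i%:Z) w) 1 -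
        cumulated_flux J (lattice_shift j (y + m%:Z + i%:Z) w) 1) +
    \sum_(i < m) cumulated_flux J (lattice_shift k (y + m%:Z + i%:Z) w) r -
    \sum_(i < m) cumulated_flux J (lattice_shift k (y + i%:Z) w) r.
  rewrite exchange_big/= -!sumrN -!big_split/=; apply: eq_bigr => i _.
  by rewrite /V sumrB; ring.
have le_r y' : `|\sum_(i < m) cumulated_flux J (lattice_shift k (y' + i%:Z) w) r| <=
    \sum_(i < m) `|cumulated_flux J (lattice_shift k (y' + i%:Z) w) 1|.
  apply: le_trans (ler_norm_sum _ _ _) _; apply: ler_sum => i _.
  by have [] := incr k (y' + i%:Z) r r01.
have c1 := le_r y; have c2 := le_r (y + m%:Z).
apply: le_trans (ler_normB _ _) _; apply: le_trans (lerD (ler_normD _ _) (lexx _)) _.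
rewrite normrN mulr_natl mulr2n; apply: le_trans (lerD b1 b2).
rewrite addrAC; apply: lerD; first by rewrite lerD2l.
by apply: le_trans c2 _; rewrite lerDr.
Unshelve. all: by end_near. Qed.

End sublinear_corrector.

Lemma ereal_sup_cvg0 (R : realType) (T : Type) (A : nat -> set T) (f : nat -> T -> R) :
  (forall n, A n !=set0) -> (forall n z, 0 <= f n z) ->
  (forall eps : R, 0 < eps -> exists N : nat, forall n z, (N <= n)%N -> A n z -> f n z <= eps) ->
  ereal_sup [set (f n z)%:E | z in A n] @[n --> \oo] --> 0%E.
Proof.
move=> A0 f0 H.
have ge0 n : (0 <= ereal_sup [set (f n z)%:E | z in A n])%E.
  have [z Az] := A0 n; apply: (@le_trans _ _ (f n z)%:E); first by rewrite lee_fin.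
  by apply: ereal_sup_ubound; exists z.
have le (n : nat) eps : (forall z, A n z -> f n z <= eps) ->
    (ereal_sup [set (f n z)%:E | z in A n] <= eps%:E)%E.
  by move=> h; apply: ge_ereal_sup => _ [z Az <-]; rewrite lee_fin h.
have fn (n : nat) eps : (forall z, A n z -> f n z <= eps) ->
    ereal_sup [set (f n z)%:E | z in A n] \is a fin_num.
  by move=> h; rewrite ge0_fin_numE// (le_lt_trans (le _ _ h))// ltry.
apply/fine_cvgP; split.
  have [N HN] := H 1 ltr01; exists N => // n /= Nn; apply: (fn n 1) => z; exact: HN.
apply/cvgrPdist_le => eps eps0; have [N HN] := H eps eps0.
exists N => // n /= Nn; have h z := HN n z Nn.
rewrite sub0r normrN ger0_norm ?fine_ge0//.
by rewrite -lee_fin fineK ?(fn n eps)// le.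
Qed.

Theorem proposition3p1 (R : realType) (P : probability (env R) R)
    (p q : \bar R) (Phi0 : env R -> int -> R)
    (P_stationary : stationary P)
    (P_ergodic : ergodic P)
    (P_mean : forall (t : R) (e : edge),
       ('E_P[(fun w => conductance w t e)] < +oo)%E)
    (P_mean_inv : forall (t : R) (e : edge),
       ('E_P[(fun w => (conductance w t e)^-1)%R] < +oo)%E)
    (p_ge1 : (1 <= p)%E)
    (q_ge1 : (1 <= q)%E)
    (pq_cond : ((p - 1)^-1 + (q * (p - 1))^-1 < 1)%E)
    (P_moment_p : forall (t : R) (e : edge),
       finite_moment P p (fun w => conductance w t e))
    (P_moment_q : forall (t : R) (e : edge),
       finite_moment P q (fun w => (conductance w t e)^-1))
    (Phi0_corrector : harmonic_coordinate P Phi0) :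
  {ae P, forall w,
    ereal_sup [set (`|n%:R^-1 * corrector Phi0 w z.1 z.2|)%:E
              | z in space_time_box n] @[n --> \oo] --> 0%E}.
Proof.
have [cov pot time_int backward zero] := Phi0_corrector.
have bound :=
  ae_corrector_bound P_stationary cov pot time_int backward zero P_mean P_mean_inv.
apply: filterS bound => w bound.
apply: (@ereal_sup_cvg0 R _ (@space_time_box R)
  (fun n z => `|n%:R^-1 * corrector Phi0 w z.1 z.2|)) => //.
- by move=> n; exists (0, 0); rewrite /space_time_box/= lexx sqr_ge0; split=> //; lia.
- move=> eps eps0; have [N HN] := bound eps eps0; exists N => n [t x] Nn [/= tn xn].
  have [|n0 le_eps] := HN n t x Nn tn; first by rewrite ler_norml.
  by rewrite normrM normfV normr_nat mulrC ler_pdivrMr ?ltr0n.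
Qed.
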